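(* Let $\mu$ be a finite positive Borel measure on $(-1,1)$ that is regular. Let $I$ be a closed subinterval of $(-1,1)$ in which $w$ is bounded below by a positive constant. Then if $I'$ is a closed subinterval of the interior $I^0$ of $I$, uniformly for $a,b$ in compact subsets of the complex plane, $$\lim_{n\to\infty}\int_{I'}\left|\frac1n K_n\left(x+\frac{\pi a\sqrt{1-x^2}}{n},\,x+\frac{\pi b\sqrt{1-x^2}}{n}\right)-\frac{1}{\pi w(x)\sqrt{1-x^2}}\,\frac{\sin\pi(a-b)}{\pi(a-b)}\right|dx=0.$$
   Context: For a finite positive Borel measure $\mu$ on $(-1,1)$ with infinite support, the orthonormal polynomials are $p_n(x)=\gamma_n x^n+\cdots$, $\gamma_n>0$, $n\ge 0$, with $\int_{-1}^1 p_np_m\,d\mu=\delta_{mn}$. The measure $\mu$ is called regular (on $[-1,1]$) if $\lim_{n\to\infty}\gamma_n^{1/n}=2$. The function $w=d\mu/dx$ denotes the density of the absolutely continuous part of $\mu$ (absolute continuity of $\mu$ is not assumed). The reproducing kernel is $K_n(x,y)=\sum_{k=0}^{n-1}p_k(x)p_k(y)$ (a polynomial in $x,y$, so defined for complex arguments). When $a=b$, $\frac{\sin\pi(a-b)}{\pi(a-b)}$ is interpreted as $1$. *)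

(* Defs.v *)
From HB Require Import structures.
From mathcomp Require Export all_boot all_order all_algebra.
From mathcomp Require Export all_classical all_reals all_analysis.
From mathcomp Require Export complex.

Set Implicit Arguments.
Unset Strict Implicit.
Unset Printing Implicit Defensive.

Export Order.TTheory GRing.Theory Num.Theory numFieldNormedType.Exports.

Local Open Scope classical_set_scope.
Local Open Scope ring_scope.
Local Open Scope complex_scope.

Section measures.
Context {R : realType}.
Implicit Types mu nu : set (measurableTypeR R) -> \bar R.

Definition msupport mu : set R :=
  [set x | forall U : set R, open U -> U x -> (0 < mu U)%E].

Definition mutually_singular mu nu : Prop :=
  exists N : set (measurableTypeR R),
    [/\ measurable N, mu N = 0%E & nu (~` N) = 0%E].

(* [w] is a (nonnegative, Borel) version of the density of the absolutely
   continuous part in the Lebesgue decomposition of [mu]. It is determined by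
   [mu] only up to Lebesgue-null sets. *)
Definition ac_density mu (w : measurableTypeR R -> R) : Prop :=
  [/\ measurable_fun setT w,
      forall x, 0 <= w x
    & exists nu : {measure set (measurableTypeR R) -> \bar R},
        mutually_singular nu lebesgue_measure /\
        forall A : set (measurableTypeR R), measurable A ->
          mu A = (nu A + \int[lebesgue_measure]_(x in A) (w x)%:E)%E].

End measures.

Section orthogonal_polynomials.
Context {R : realType}.

(* [size q] is one more than the degree of [q]. *)
Definition orthonormal_polys (mu : {measure set (measurableTypeR R) -> \bar R})
    (p : nat -> {poly R}) : Prop :=
  [/\ forall n, size (p n) = n.+1,
      forall n, 0 < lead_coef (p n)
    & forall n m,
        (\int[mu]_(x in `](-1)%R, 1%R[) ((p n).[x] * (p m).[x])%:E)%E
        = ((n == m)%:R)%:E].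

(* Regularity on [-1, 1] of the measure whose orthonormal polynomials are
   [p]. *)
Definition regular_polys (p : nat -> {poly R}) : Prop :=
  lead_coef (p n) `^ (n%:R^-1) @[n --> \oo] --> (2 : R).

Definition rkernel (p : nat -> {poly R}) (n : nat) (x y : R[i]) : R[i] :=
  \sum_(k < n) (map_poly (real_complex R) (p k)).[x] *
               (map_poly (real_complex R) (p k)).[y].

End orthogonal_polynomials.

Section complex_sine.
Context {R : realType}.
Implicit Type z : R[i].

Definition cexp z : R[i] :=
  (expR (complex.Re z))%:C * (cos (complex.Im z) +i* sin (complex.Im z)).

Definition csin z : R[i] :=
  (cexp ((0 +i* 1) * z) - cexp (- ((0 +i* 1) * z))) / (2 * (0 +i* 1)).

(* sin (pi z) / (pi z) *)
Definition csinc z : R[i] :=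
  if z == 0 then 1 else csin (pi%:C * z) / (pi%:C * z).

End complex_sine.

Definition cmod {R : realType} (z : R[i]) : R := ComplexField.Normc.normc z.

(* Main.v *)
(** Let L_n be the reproducing kernel of the arcsine measure, s = sqrt(1 - x^2), and compare K_n with
    L_n / (pi s w). Expanding the square and using the reproducing property,
      E_n(x) = (1/n) \int (K_n(x,t) - L_n(x,t) / (pi s w)(x))^2 dmu(t)
    equals (1/n) (K_n(x,x) - 2 L_n(x,x) / (pi s w) + (pi s w)^(-2) \int L_n(x,t)^2 dmu(t)). Integrated against
    pi s w dx, the first term tends to |I| because regularity forces the measures K_n(x,x) dmu / n to converge
    to the arcsine measure, the second to -2 |I|, and the third to |I| because L_n(x,t)^2 / n is an
    approximate identity; near the singular part of mu one uses a cutoff. Hence E_n tends to 0 in L^1.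
    As w is bounded below on I, Bernstein type inequalities turn this into L^1 asymptotics for
    d_y^k K_n(x,y) / n^(k+1) at y = x. The mixed derivatives d_x^j d_y^k K_n follow by induction on j, since
    the derivative of a sequence of polynomials converging in L^1, with Q'' = O(n^2), is o(n) in L^1.
    Taylor expansion of K_n at (x,x) then gives the limit with complex shifts, the Taylor coefficients of
    L_n supplying those of the sine kernel.

    Convergence to the arcsine measure comes from the recurrence coefficients: regularity bounds the
    geometric mean of the a_n from below by 1/2, the growth of p_n outside [-1, 1] bounds the averages of
    b_n^2 + 2 a_n^2 from above by 1/2, so that a_n -> 1/2 and b_n -> 0 in Cesaro mean, and then T_k p_m is
    close to (p_(m+k) + p_(m-k)) / 2 on average. *)

From HB Require Import structures.
Require Import Defs.
From mathcomp Require Import measurable_realfun ring lra.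

Set Implicit Arguments.
Unset Strict Implicit.
Unset Printing Implicit Defensive.

Local Open Scope classical_set_scope.
Local Open Scope ring_scope.

(** Since E_n is nonnegative, one-sided estimates of its three terms suffice. The factor 1 / (pi s
    w) is only measurable in x, and E_n(x) compares the kernels as polynomials in t for fixed x:
    derivatives in t can be compared, derivatives in x cannot. The mixed derivatives are reached on
    the diagonal, where kap(j, k)' = kap(j+1, k) + kap(j, k+1). If kap(j, k) / n^(j+k+1) converges
    in L^1, its derivative is o(n), so kap(j+1, k) and kap(j, k+1) have opposite limits at scale
    n^(j+k+2); this produces the signs (-1)^j of the sine kernel. The measure may have a singular
    part inside I, and w need not be bounded above. Hence mu is dominated by a continuous density
    close to w plus a rest of bounded mass that is small only against the cutoff. Uniformity in a
    and b comes from the bound A C^(j+k) n^(j+k+1) on the Taylor coefficients: the expansion is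
    truncated at an order fixed before n, and the integrand lies below a function of x alone. *)

Lemma cont_cst {R : realType} (a : R) : continuous (fun _ : R => a).
Proof. by move=> x; exact: cvg_cst. Qed.
Arguments cont_cst {R} a.

(** * Positive functionals and orthonormal polynomials *)

Section PositiveFunctional.
Context {R : realType}.
Implicit Types (f g : R -> R) (l : (R -> R) -> R).

(* [l f] stands for the integral of [f] against a finite measure on [-1, 1]; [l] is only ever applied to
   continuous functions, so that no measurability is needed before the last part. *)
Record posfun l : Prop := PosFun {
  posfunP : forall a f g, continuous f -> continuous g ->
    l (fun x => a * f x + g x) = a * l f + l g;
  posfun_ge0 : forall f, continuous f ->
    (forall x, -1 <= x <= 1 -> 0 <= f x) -> 0 <= l f }.

Lemma contD f g : continuous f -> continuous g -> continuous (fun x => f x + g x).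
Proof. by move=> cf cg x; apply: cvgD; [exact: cf|exact: cg]. Qed.

Lemma contM f g : continuous f -> continuous g -> continuous (fun x => f x * g x).
Proof. by move=> cf cg x; apply: cvgM; [exact: cf|exact: cg]. Qed.

Lemma contN f : continuous f -> continuous (fun x => - f x).
Proof. by move=> cf x; apply: cvgN; exact: cf. Qed.

Lemma contB f g : continuous f -> continuous g -> continuous (fun x => f x - g x).
Proof. by move=> cf cg; apply: contD => //; exact: contN. Qed.

Lemma contZ (a : R) f : continuous f -> continuous (fun x => a * f x).
Proof. by move=> cf; apply: contM => //; exact: cont_cst. Qed.

Lemma cont_poly (q : {poly R}) : continuous (fun x => q.[x]).
Proof. exact: continuous_horner. Qed.

Lemma cont_sum (I : Type) (r : seq I) (P : pred I) (F : I -> R -> R) :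
  (forall i, P i -> continuous (F i)) ->
  continuous (fun x => \sum_(i <- r | P i) F i x).
Proof.
move=> cF; elim: r => [|i r IH].
  by under eq_fun do rewrite big_nil; exact: cont_cst.
under eq_fun do rewrite big_cons.
by case: (boolP (P i)) => // /cF ci; exact: contD.
Qed.

Section Basics.
Context l (hl : posfun l).

Lemma posfun0 : l (fun=> 0) = 0.
Proof.
have := posfunP hl (-1) (cont_cst 0) (cont_cst 0).
by under eq_fun do rewrite mulr0 addr0; move=> ->; ring.
Qed.

Lemma posfunZ a f : continuous f -> l (fun x => a * f x) = a * l f.
Proof.
move=> cf; have := posfunP hl a cf (cont_cst 0).
by under eq_fun do rewrite addr0; rewrite posfun0 addr0.
Qed.

Lemma posfunD f g : continuous f -> continuous g ->
  l (fun x => f x + g x) = l f + l g.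
Proof.
move=> cf cg; have := posfunP hl 1 cf cg.
by under eq_fun do rewrite mul1r; rewrite mul1r.
Qed.

Lemma posfunB f g : continuous f -> continuous g ->
  l (fun x => f x - g x) = l f - l g.
Proof.
move=> cf cg; have := posfunP hl (-1) cg cf.
by under eq_fun do rewrite mulN1r addrC; rewrite mulN1r addrC.
Qed.

Lemma posfun_sum (I : Type) (r : seq I) (P : pred I) (F : I -> R -> R) :
  (forall i, P i -> continuous (F i)) ->
  l (fun x => \sum_(i <- r | P i) F i x) = \sum_(i <- r | P i) l (F i).
Proof.
move=> cF; elim: r => [|i r IH].
  by under eq_fun do rewrite big_nil; rewrite big_nil posfun0.
under eq_fun do rewrite big_cons.
rewrite big_cons; case: ifP => // /cF ci.
by rewrite posfunD ?IH//; exact: cont_sum.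
Qed.

Lemma posfun_le f g : continuous f -> continuous g ->
  (forall x, -1 <= x <= 1 -> f x <= g x) -> l f <= l g.
Proof.
move=> cf cg fg; rewrite -subr_ge0 -posfunB//.
by apply: (posfun_ge0 hl) => [|x /fg]; [exact: contB|rewrite subr_ge0].
Qed.

Lemma posfun_eq f g : continuous f -> continuous g ->
  (forall x, -1 <= x <= 1 -> f x = g x) -> l f = l g.
Proof.
by move=> cf cg fg; apply/eqP; rewrite eq_le !posfun_le// => x /fg ->.
Qed.

Lemma posfun_norm f g : continuous f -> continuous g ->
  (forall x, -1 <= x <= 1 -> `|f x| <= g x) -> `|l f| <= l g.
Proof.
move=> cf cg fg; rewrite ler_norml; apply/andP; split.
  rewrite lerNl -mulN1r -posfunZ//; apply: posfun_le => // [|x /fg].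
    exact: contZ.
  by rewrite ler_norml mulN1r => /andP[]; lra.
by apply: posfun_le => // x /fg; rewrite ler_norml => /andP[].
Qed.

End Basics.

(** Fubini for a kernel of finite rank: linearity alone gives the exchange, and no product measure
    has to be formed. *)
Lemma posfun_swap l l' (I : Type) (r : seq I) (F H : I -> R -> R) :
  posfun l -> posfun l' ->
  (forall i, continuous (F i)) -> (forall i, continuous (H i)) ->
  l (fun x => l' (fun t => \sum_(i <- r) F i x * H i t)) =
  l' (fun t => l (fun x => \sum_(i <- r) F i x * H i t)).
Proof.
move=> hl hl' cF cH.
have e1 x : l' (fun t => \sum_(i <- r) F i x * H i t) =
            \sum_(i <- r) l' (H i) * F i x.
  rewrite posfun_sum//; last by move=> i _; exact: contZ.
  by apply: eq_bigr => i _; rewrite posfunZ// mulrC.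
have e2 t : l (fun x => \sum_(i <- r) F i x * H i t) =
            \sum_(i <- r) l (F i) * H i t.
  rewrite posfun_sum//; last by move=> i _; apply: contM => //; exact: cont_cst.
  by apply: eq_bigr => i _; under eq_fun do rewrite mulrC; rewrite posfunZ// mulrC.
under eq_fun do rewrite e1.
under [in RHS]eq_fun do rewrite e2.
rewrite !posfun_sum//; try by move=> i _; exact: contZ.
by apply: eq_bigr => i _; rewrite !posfunZ// mulrC.
Qed.

End PositiveFunctional.

Section PolyFunctional.
Context {R : realType}.
Implicit Types (q r : {poly R}).

Lemma CS_sum (I : Type) (s : seq I) (a b : I -> R) :
  (\sum_(i <- s) a i * b i) ^+ 2 <=
  (\sum_(i <- s) a i ^+ 2) * (\sum_(i <- s) b i ^+ 2).
Proof.
elim: s => [|i s IH]; first by rewrite !big_nil mul0r expr0n.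
rewrite !big_cons; set X := \sum_(_ <- _) _ in IH *.
set A := \sum_(_ <- _) _ in IH *; set B := \sum_(_ <- _) _ in IH *.
have A0 : 0 <= A by apply: sumr_ge0 => j _; exact: sqr_ge0.
have B0 : 0 <= B by apply: sumr_ge0 => j _; exact: sqr_ge0.
have h : 2 * a i * b i * X <= a i ^+ 2 * B + b i ^+ 2 * A.
  have h1 : (a i * b i * X) ^+ 2 <= (a i ^+2 * B) * (b i ^+ 2 * A).
    rewrite exprMn (_ : _ * _ * (_ * A) = (a i * b i)^+2 * (A * B)); last by ring.
    by rewrite ler_wpM2l// sqr_ge0.
  have h2 := sqr_ge0 (a i ^+2 * B - b i ^+ 2 * A).
  have h3 : (2 * (a i * b i * X)) ^+ 2 <= (a i ^+2 * B + b i ^+ 2 * A) ^+ 2 by nra.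
  have h4 : 0 <= a i ^+2 * B + b i ^+ 2 * A.
    by apply: addr_ge0; apply: mulr_ge0 => //; exact: sqr_ge0.
  apply: le_trans (_ : `|2 * (a i * b i * X)| <= _).
    by rewrite !mulrA; exact: ler_norm.
  by rewrite -ler_sqr ?nnegrE// real_normK ?num_real.
by nra.
Qed.

Definition pint (l : (R -> R) -> R) q := l (fun x => q.[x]).

Context (l : (R -> R) -> R) (hl : posfun l).

Lemma pintD q r : pint l (q + r) = pint l q + pint l r.
Proof.
rewrite /pint; under eq_fun do rewrite hornerD.
by rewrite (posfunD hl)//; exact: cont_poly.
Qed.

Lemma pintZ a q : pint l (a *: q) = a * pint l q.
Proof.
rewrite /pint; under eq_fun do rewrite hornerZ.
by rewrite (posfunZ hl)//; exact: cont_poly.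
Qed.

Lemma pint0 : pint l 0 = 0.
Proof. by have := pintZ 0 0; rewrite scale0r mul0r. Qed.

Lemma pintN q : pint l (- q) = - pint l q.
Proof. by rewrite -scaleN1r pintZ mulN1r. Qed.

Lemma pintB q r : pint l (q - r) = pint l q - pint l r.
Proof. by rewrite pintD pintN. Qed.

Lemma pint_sum (I : Type) (s : seq I) (P : pred I) (F : I -> {poly R}) :
  pint l (\sum_(i <- s | P i) F i) = \sum_(i <- s | P i) pint l (F i).
Proof.
elim/big_rec2: _ => [|i x y _ <-]; first exact: pint0.
by rewrite pintD.
Qed.

Lemma pint_le q r : (forall x, -1 <= x <= 1 -> q.[x] <= r.[x]) ->
  pint l q <= pint l r.
Proof. by move=> h; apply: (posfun_le hl) => //; exact: cont_poly. Qed.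

Lemma pint_sqr_ge0 q : 0 <= pint l (q ^+ 2).
Proof.
apply: (posfun_ge0 hl) => [|x _]; first exact: cont_poly.
by rewrite horner_exp sqr_ge0.
Qed.

Lemma pint_CS q r : pint l (q * r) ^+ 2 <= pint l (q ^+ 2) * pint l (r ^+ 2).
Proof.
set A := pint l (q ^+ 2); set B := pint l (r ^+ 2); set X := pint l (q * r).
have h t : 0 <= A + 2 * t * X + t ^+ 2 * B.
  have := pint_sqr_ge0 (q + t *: r).
  rewrite sqrrD -scalerAr exprZn !pintD !pintZ -/A -/B -/X => h.
  by apply: le_trans h _; rewrite le_eqVlt; apply/orP; left; apply/eqP; ring.
have B0 : 0 <= B by exact: pint_sqr_ge0.
have [B1|B1] := leP B 0.
  have -> : B = 0 by apply/eqP; rewrite eq_le B0 B1.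
  have X0 : X = 0.
    apply/eqP; apply: contraT => X0.
    (* With B = 0 and X nonzero, this t makes A + 2 t X equal to -1, against [h]. *)
    have := h (- (A + 1) / (2 * X)).
    have -> : B = 0 by apply/eqP; rewrite eq_le B0 B1.
    rewrite mulr0 addr0 (_ : 2 * _ * X = - (A + 1)); last by field.
    by lra.
  by rewrite X0 expr0n mulr0.
have := h (- X / B).
rewrite (_ : A + _ + _ = (A * B - X ^+ 2) / B); last by field; rewrite gt_eqF.
by rewrite pmulr_lge0 ?invr_gt0// subr_ge0.
Qed.

Section Orthonormal.
Context (p : nat -> {poly R}).
Definition onpolys :=
  (forall n, size (p n) = n.+1) /\
  (forall n m, pint l (p n * p m) = (n == m)%:R).
Context (hp : onpolys).
Let sp := hp.1.
Let op := hp.2.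

Lemma on_expand n q : (size q <= n)%N ->
  q = \sum_(i < n) pint l (q * p i) *: p i.
Proof.
elim: n q => [q|n IH q sq].
  by rewrite leqn0 size_poly_eq0 => /eqP ->; rewrite big_ord0.
have lp : lead_coef (p n) != 0 by rewrite lead_coef_eq0 -size_poly_eq0 sp.
set c := q`_n / lead_coef (p n).
have sq' : (size (q - c *: p n)%R <= n)%N.
  apply/leq_sizeP => j; rewrite leq_eqVlt => /predU1P[<-|nj].
    rewrite coefB coefZ /c -[X in _ - _ * X](_ : lead_coef (p n) = _).
      by rewrite divfK// subrr.
    by rewrite lead_coefE sp.
  rewrite coefB coefZ nth_default; last exact: leq_trans sq nj.
  by rewrite [X in _ * X]nth_default ?sp// mulr0 subr0.
have := IH _ sq'.
set q' := q - _ => e.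
have qe : q = q' + c *: p n by rewrite /q' subrK.
clearbody q'.
have h0 : pint l (q' * p n) = 0.
  rewrite e mulr_suml pint_sum big1// => i _.
  by rewrite -scalerAl pintZ op ltn_eqF// mulr0.
rewrite big_ord_recr /= [in LHS]qe; congr (_ + _).
  rewrite [LHS]e; apply: eq_bigr => i _; congr (_ *: _).
  by rewrite [in RHS]qe mulrDl pintD -scalerAl pintZ op gtn_eqF// mulr0 addr0.
by rewrite [in RHS]qe mulrDl pintD h0 add0r -scalerAl pintZ op eqxx mulr1.
Qed.

Lemma on_parseval n q r : (size q <= n)%N ->
  pint l (q * r) = \sum_(i < n) pint l (q * p i) * pint l (r * p i).
Proof.
move=> sq; rewrite {1}(on_expand sq) mulr_suml pint_sum.
by apply: eq_bigr => i _; rewrite -scalerAl pintZ [p i * r]mulrC.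
Qed.

Lemma on_orth n q : (size q <= n)%N -> pint l (q * p n) = 0.
Proof.
move=> sq; rewrite (on_parseval _ sq) big1// => i _.
by rewrite op gtn_eqF// mulr0.
Qed.

(** The second variable is the polynomial one, so that K_n(x, t) can be differentiated and
    integrated in t for fixed real x. *)
Definition kpoly n x : {poly R} := \sum_(i < n) (p i).[x] *: p i.

Lemma size_kpoly n x : (size (kpoly n x) <= n)%N.
Proof.
apply: (leq_trans (size_sum _ _ _)); apply/bigmax_leqP => i _.
by apply: (leq_trans (size_scale_leq _ _)); rewrite sp.
Qed.

Lemma kpolyE n x t : (kpoly n x).[t] = \sum_(i < n) (p i).[x] * (p i).[t].
Proof. by rewrite horner_sum; apply: eq_bigr => i _; rewrite hornerZ. Qed.

Lemma kpolyC n x t : (kpoly n x).[t] = (kpoly n t).[x].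
Proof. by rewrite !kpolyE; apply: eq_bigr => i _; rewrite mulrC. Qed.

Lemma reproducing n q x : (size q <= n)%N -> pint l (q * kpoly n x) = q.[x].
Proof.
move=> sq; rewrite {2}(on_expand sq) horner_sum mulr_sumr pint_sum.
by apply: eq_bigr => i _; rewrite -scalerAr pintZ hornerZ mulrC.
Qed.

(** Cauchy-Schwarz on the coefficients of q: the sum is the squared norm of the functional sending q
    to the k-th derivative at x. It serves for upper bounds on q and for lower bounds on the sum. *)
Lemma on_eval_sqr n q x k : (size q <= n)%N ->
  q^`(k).[x] ^+ 2 <= pint l (q ^+ 2) * \sum_(i < n) (p i)^`(k).[x] ^+ 2.
Proof.
move=> sq; have -> : q^`(k).[x] = \sum_(i < n) pint l (q * p i) * (p i)^`(k).[x].
  rewrite {1}(on_expand sq) linear_sum horner_sum.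
  by apply: eq_bigr => i _; rewrite linearZ hornerZ.
rewrite expr2 (on_parseval _ sq); apply: le_trans (CS_sum _ _ _) _.
by under eq_bigr do rewrite expr2.
Qed.

End Orthonormal.
End PolyFunctional.

(** * Chebyshev polynomials and recurrence coefficients *)

Section Chebyshev.
Context {R : realType}.

Fixpoint cheb (n : nat) : {poly R} :=
  match n with
  | 0%N => 1
  | 1%N => 'X
  | (m.+1 as k).+1 => 2%:P * 'X * cheb k - cheb m
  end.

Lemma chebSS n : cheb n.+2 = 2%:P * 'X * cheb n.+1 - cheb n.
Proof. by []. Qed.

Lemma cheb_ind2 (P : nat -> Prop) : P 0%N -> P 1%N ->
  (forall n, P n -> P n.+1 -> P n.+2) -> forall n, P n.
Proof.
move=> P0 P1 IH n; suff [] : P n /\ P n.+1 by [].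
by elim: n => // n [Pn Pn1]; split => //; exact: IH.
Qed.

Lemma size_cheb n : size (cheb n) = n.+1.
Proof.
elim/cheb_ind2: n => [||n s0 s1]; rewrite ?size_poly1 ?size_polyX//.
rewrite chebSS -mulrA mul_polyC size_polyDl.
  rewrite size_scale ?pnatr_eq0// mulrC size_mulX ?s1//.
  by rewrite -size_poly_eq0 s1.
by rewrite size_polyN s0 size_scale ?pnatr_eq0// mulrC size_mulX ?s1// -size_poly_eq0 s1.
Qed.

Lemma cheb_cos n (t : R) : (cheb n).[cos t] = cos (n%:R * t).
Proof.
elim/cheb_ind2: n => [||n s0 s1].
- by rewrite hornerC mul0r cos0.
- by rewrite hornerX mul1r.
rewrite chebSS !hornerE s0 s1.
rewrite (_ : n.+2%:R * t = n.+1%:R * t + t); last by rewrite -!natr1; ring.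
rewrite (_ : n%:R * t = n.+1%:R * t - t); last by rewrite -!natr1; ring.
by rewrite cosB cosD; ring.
Qed.

Lemma cheb_le1 n (x : R) : -1 <= x <= 1 -> `|(cheb n).[x]| <= 1.
Proof.
move=> x1; have <- : cos (acos x) = x by apply: acosK; rewrite in_itv.
by rewrite cheb_cos cos_max.
Qed.

Lemma cheb_zeta n (z : R) : z != 0 ->
  (cheb n).[(z + z^-1) / 2] = (z ^+ n + z ^- n) / 2.
Proof.
move=> z0; elim/cheb_ind2: n => [||n s0 s1].
- by rewrite hornerC !expr0 invr1; field.
- by rewrite hornerX !expr1.
rewrite chebSS !hornerE /= s0 s1 -!exprVn; set y := z^-1.
have zy : z * y = 1 by rewrite divff.
rewrite !exprS; transitivity ((z * (z * z ^+ n) + y * (y * y ^+ n)) / 2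
  + (z * y - 1) * (z ^+ n + y ^+ n) / 2); first by field.
by rewrite zy subrr !mul0r addr0.
Qed.

Lemma chebN n (x : R) : (cheb n).[- x] = (-1) ^+ n * (cheb n).[x].
Proof.
elim/cheb_ind2: n => [||n s0 s1].
- by rewrite !hornerC expr0 mul1r.
- by rewrite !hornerX expr1 mulN1r.
by rewrite chebSS !hornerE s0 s1 !exprS; ring.
Qed.

Lemma chebM m n : (m <= n)%N ->
  2%:P * (cheb m * cheb n) = cheb (n + m) + cheb (n - m).
Proof.
elim/cheb_ind2: m => [||m s0 s1] mn.
- by rewrite addn0 subn0 mul1r mul_polyC -mulr2n scaler_nat.
- case: n mn => // n _.
  by rewrite addn1 chebSS subn1 [n.+1.-1]/= subrK mulrA.
have e0 := s0 (ltnW (ltnW mn)); have e1 := s1 (ltnW mn).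
have -> : 2%:P * (cheb m.+2 * cheb n) =
  2%:P * 'X * (2%:P * (cheb m.+1 * cheb n)) - 2%:P * (cheb m * cheb n).
  by rewrite chebSS; ring.
rewrite e0 e1 !addnS.
have [k ->] : exists k, n = (k + m.+2)%N by exists (n - m.+2)%N; rewrite subnK.
rewrite addnK (_ : k + m.+2 - m.+1 = k.+1)%N; last by rewrite addnS -addSn addnK.
rewrite (_ : k + m.+2 - m = k.+2)%N; last by rewrite 2!addnS -!addSn addnK.
by rewrite [in RHS]chebSS (chebSS k); ring.
Qed.

End Chebyshev.

Section Jacobi.
Context {R : realType} (l : (R -> R) -> R) (hl : posfun l).
Context (p : nat -> {poly R}) (hp : onpolys l p).
Context (lp : forall n, 0 < lead_coef (p n)).
Let sp : forall n, size (p n) = n.+1 := hp.1.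
Let op : forall n m, pint l (p n * p m) = (n == m)%:R := hp.2.

(** The Jacobi matrix entries a_n and b_n, as matrix coefficients of multiplication by x. [jam n] is
    a_(n-1) and [pm n] is p_(n-1), both 0 at n = 0, so that the recurrence has no boundary case. *)
Definition ja n := pint l ('X * p n * p n.+1).
Definition jb n := pint l ('X * p n * p n).
Definition jam n := if n is m.+1 then ja m else 0.
Definition pm n := if n is m.+1 then p m else 0.

Lemma size_mulX_p n : size ('X * p n) = n.+2.
Proof. by rewrite mulrC size_mulX ?sp// -size_poly_eq0 sp. Qed.

Lemma three_term n : 'X * p n = ja n *: p n.+1 + jb n *: p n + jam n *: pm n.
Proof.
rewrite {1}(on_expand hl hp (n := n.+2) (q := 'X * p n)) ?size_mulX_p//.
rewrite 2!big_ord_recr /= -/(ja n) -/(jb n) addrC -addrA; congr (_ + _); rewrite addrC; congr (_ + _).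
case: n => [|n] /=; first by rewrite big_ord0 scaler0.
rewrite big_ord_recr /= big1 ?add0r; last first.
  move=> i _; rewrite -mulrA [p _ * _]mulrC mulrA (on_orth hl hp) ?scale0r//.
  by rewrite size_mulX_p ltnS.
by congr (_ *: _); rewrite /ja -!mulrA [p n * _]mulrC.
Qed.

Lemma lead_ja n : lead_coef (p n) = ja n * lead_coef (p n.+1).
Proof.
have : ('X * p n)`_n.+1 = (ja n *: p n.+1 + jb n *: p n + jam n *: pm n)`_n.+1.
  by rewrite three_term.
rewrite coefXM /= !coefD !coefZ.
rewrite [X in _ + jb n * X]nth_default ?sp// mulr0 addr0.
rewrite [X in _ + jam n * X]nth_default; last by case: n => [|n] /=; rewrite ?size_poly0 ?sp.
by rewrite mulr0 addr0 !lead_coefE !sp.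
Qed.

Lemma ja_gt0 n : 0 < ja n.
Proof. by have := lp n; rewrite lead_ja pmulr_lgt0. Qed.

Lemma jam_ge0 n : 0 <= jam n.
Proof. by case: n => [|n] //=; exact/ltW/ja_gt0. Qed.

Lemma pint_XX q : pint l (('X * q) ^+ 2) <= pint l (q ^+ 2).
Proof.
apply: (pint_le hl) => x x1; rewrite !hornerE exprMn ler_piMl ?sqr_ge0//.
by move: x1; nra.
Qed.

(** The left side is the squared norm of x p_n, and |x| <= 1 on the support. *)
Lemma jacobi_norm n : ja n ^+ 2 + jb n ^+ 2 + jam n ^+ 2 <= 1.
Proof.
have e : (n == n :> nat)%:R = 1 :> R by rewrite eqxx.
rewrite -e -op; have := pint_XX (p n); rewrite -expr2; apply: le_trans.
rewrite [X in _ <= pint l X]expr2 {1}three_term 2!mulrDl !(pintD hl) -!scalerAl !(pintZ hl).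
rewrite [p n.+1 * _]mulrC -/(ja n) [p n * _]mulrC -/(jb n).
rewrite [pm n * _]mulrC.
have -> : pint l ('X * p n * pm n) = jam n.
  case: n {e} => [|n] /=; first by rewrite mulr0 (pint0 hl).
  by rewrite /ja -!mulrA [p n * _]mulrC.
by rewrite !expr2.
Qed.

Lemma ja_le1 n : ja n <= 1.
Proof.
have := jacobi_norm n; have := ja_gt0 n.
by have := sqr_ge0 (jb n); have := sqr_ge0 (jam n); nra.
Qed.

Lemma jam_le1 n : jam n <= 1.
Proof. by case: n => [|n] //=; exact: ja_le1. Qed.

Lemma jb_le1 n : `|jb n| <= 1.
Proof.
rewrite ler_norml; have := jacobi_norm n.
by have := sqr_ge0 (ja n); have := sqr_ge0 (jam n); nra.
Qed.

Lemma horner_three_term n y :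
  y * (p n).[y] = ja n * (p n.+1).[y] + jb n * (p n).[y] + jam n * (pm n).[y].
Proof. by have := congr1 (horner^~ y) (three_term n); rewrite !hornerE. Qed.

Lemma christoffel_darboux n y :
  (y%:P - 'X) * kpoly p n.+1 y =
  ja n *: ((p n.+1).[y] *: p n - (p n).[y] *: p n.+1).
Proof.
have step m : (y%:P - 'X) * ((p m).[y] *: p m) =
    ja m *: ((p m.+1).[y] *: p m - (p m).[y] *: p m.+1) +
    jam m *: ((pm m).[y] *: p m - (p m).[y] *: pm m).
  rewrite -scalerAr mulrBl three_term mul_polyC scalerBr scalerA [_ * y]mulrC.
  by rewrite horner_three_term -!mul_polyC !(polyCD, polyCM); ring.
elim: n => [|n IH]; rewrite /kpoly big_ord_recr /=.
  by rewrite big_ord0 add0r step /= scale0r addr0.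
by rewrite mulrDr IH step /= -!mul_polyC; ring.
Qed.

(** Integrating the Christoffel-Darboux formula against the kernel: p_n is reproduced at y, while
    p_(n+1) is orthogonal to the kernel. For y outside [-1, 1] the factor y - t keeps one sign,
    which makes the left side a positive quantity. *)
Lemma christoffel_darboux_int n y :
  pint l ((y%:P - 'X) * kpoly p n.+1 y ^+ 2) = ja n * ((p n.+1).[y] * (p n).[y]).
Proof.
rewrite expr2 mulrA christoffel_darboux -scalerAl (pintZ hl) mulrBl -!scalerAl.
rewrite (pintB hl) !(pintZ hl) (reproducing hl hp) ?sp//.
by rewrite [p n.+1 * _]mulrC (on_orth hl hp) ?(size_kpoly hp)// mulr0 subr0.
Qed.

Section OutsidePoint.
Context (sg z : R) (sg2 : sg ^+ 2 = 1) (z2 : 2 <= z).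
Let y := sg * z.

(** On [-1, 1] one has sg (y - t) = z - sg t >= z - 1, and the integral of the squared kernel is its
    diagonal value. *)
Lemma pp_lower n : (z - 1) * \sum_(i < n.+1) (p i).[y] ^+ 2 <=
  sg * (ja n * ((p n.+1).[y] * (p n).[y])).
Proof.
rewrite -christoffel_darboux_int -(pintZ hl).
have -> : \sum_(i < n.+1) (p i).[y] ^+ 2 = pint l (kpoly p n.+1 y ^+ 2).
  rewrite expr2 (reproducing hl hp) ?(size_kpoly hp)// kpolyE.
  by apply: eq_bigr => i _; rewrite expr2.
rewrite -(pintZ hl); apply: (pint_le hl) => x x1.
have : 0 <= (kpoly p n.+1 y ^+ 2).[x] by rewrite horner_exp sqr_ge0.
move: (kpoly _ _ _ ^+ 2) => k2 k20; rewrite !hornerZ hornerM hornerD hornerC hornerN hornerX mulrA.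
rewrite ler_wpM2r// mulrBr mulrA -expr2 sg2 mul1r lerB//.
move: x1; have : sg = 1 \/ sg = -1.
  by move/eqP: sg2; rewrite sqrf_eq1 => /orP[] /eqP; [left|right].
by case=> -> ; lra.
Qed.

Lemma p0_const : (p 0%N).[y] = lead_coef (p 0%N).
Proof.
rewrite [p 0%N]size1_polyC ?sp// hornerC lead_coefE size_polyC.
by case: (_ != 0); rewrite /= coefC.
Qed.

Lemma py_neq0 n : (p n).[y] != 0.
Proof.
apply/eqP => h; have := lp 0; rewrite -p0_const => h0.
have h1 m : (p 0%N).[y] ^+ 2 <= \sum_(i < m.+1) (p i).[y] ^+ 2.
  by rewrite big_ord_recl /= lerDl sumr_ge0// => i _; exact: sqr_ge0.
have h2 : 0 < (p 0%N).[y] ^+ 2 by rewrite exprn_gt0.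
have := pp_lower n; have := h1 n; rewrite h !mulr0 => h3 h4.
by move: z2; nra.
Qed.

(** The factor [sg] makes the ratio positive both at z and at -z. *)
Definition jr n := sg * (ja n * (p n.+1).[y] / (p n).[y]).

Lemma jr_ge n : z - 1 <= jr n.
Proof.
have h := pp_lower n; have n0 := py_neq0 n.
have q0 : 0 < (p n).[y] ^+ 2 by rewrite exprn_even_gt0.
rewrite -(ler_pM2r q0) /jr.
have -> : sg * (ja n * (p n.+1).[y] / (p n).[y]) * (p n).[y] ^+ 2 =
          sg * (ja n * ((p n.+1).[y] * (p n).[y])) by field.
apply: le_trans h; rewrite ler_wpM2l//; first by move: z2; lra.
by rewrite big_ord_recr /= lerDr sumr_ge0// => i _; exact: sqr_ge0.
Qed.

(** Last term of the continued fraction step jr_n = z - sg b_n - a_(n-1)^2 / jr_(n-1). At n = 0 the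
    numerator is 0 and the denominator 1 is a filler. *)
Definition ju n := jam n ^+ 2 / (if n is m.+1 then jr m else 1).

Lemma jrE n : jr n = z - sg * jb n - ju n.
Proof.
rewrite /jr; have n0 := py_neq0 n.
have e : ja n * (p n.+1).[y] = y * (p n).[y] - jb n * (p n).[y] - jam n * (pm n).[y].
  by rewrite horner_three_term; ring.
rewrite e mulrBl mulrBl mulrBr mulrBr !mulfK//.
rewrite {1}/y mulrA -expr2 sg2 mul1r; congr (_ - _).
rewrite /ju; case: n n0 e => [|n] n0 e /=; first by rewrite !(mul0r, mulr0) expr0n mul0r.
have m0 := py_neq0 n; have a0 := ja_gt0 n.
have s0 : sg != 0 by apply/eqP => s0; move: sg2; rewrite s0 expr0n => /eqP; rewrite eq_sym oner_eq0.
have -> : sg * (ja n * (p n).[y] / (p n.+1).[y]) =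
          sg ^+ 2 * (ja n * (p n).[y] / (p n.+1).[y]) / sg by field; rewrite s0 n0.
rewrite sg2 /jr; field.
by rewrite n0 m0 s0 gt_eqF.
Qed.

Lemma jr_le n : jr n <= z + 1.
Proof.
rewrite jrE; have := jb_le1 n; rewrite ler_norml => h.
have u0 : 0 <= ju n.
  rewrite /ju mulr_ge0 ?sqr_ge0// invr_ge0; case: n h => [|n] h //.
  by apply: le_trans (jr_ge n); move: z2; lra.
have : sg = 1 \/ sg = -1.
  by move/eqP: sg2; rewrite sqrf_eq1 => /orP[] /eqP; [left|right].
by case=> ->; lra.
Qed.

(** The ratio jr lies within 1 of z, so z ju_n is a_(n-1)^2 up to O(1 / z). *)
Lemma ju_bounds n :
  [/\ jam n ^+ 2 - 1 / z <= z * ju n, 0 <= ju n & ju n <= 2 / z].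
Proof.
have z0 : 0 < z by move: z2; lra.
have A1 : jam n ^+ 2 <= 1 by rewrite expr_le1// ?jam_le1 ?jam_ge0.
have A0 : 0 <= jam n ^+ 2 by exact: sqr_ge0.
rewrite /ju; case: n A1 A0 => [|n] A1 A0 /=.
  rewrite expr0n !mul0r mulr0; split=> //; last by rewrite mulr_ge0// invr_ge0 ltW.
  by rewrite sub0r oppr_le0 mulr_ge0// invr_ge0 ltW.
have r1 := jr_ge n; have r2 := jr_le n.
rewrite /= in A1 A0; set A := _ ^+ 2 in A1 A0 *; set r := jr n in r1 r2 *.
have r0 : 0 < r by move: z2; lra.
split.
- have k0 : 0 <= A / r by rewrite divr_ge0// ltW.
  have kr : A / r * r = A by rewrite divfK// gt_eqF.
  have [rz|zr] := leP r z.
    have i0 : 0 <= 1 / z by rewrite divr_ge0// ltW.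
    by nra.
  have ki : A / r <= 1 / z by rewrite ler_pM// ?invr_ge0 ?lef_pV2 ?posrE// ltW.
  by nra.
- by rewrite mulr_ge0// invr_ge0 ltW.
- rewrite ler_pdivrMr// mulrAC ler_pdivlMr//.
  by move: z2; nra.
Qed.

(** Multiply [pp_lower] by jr_n >= z - 1: the right side becomes (a_n p_(n+1)(y))^2, and a_n <=
    1. *)
Lemma p_outside_lower n :
  (z - 1) ^+ 2 * \sum_(i < n.+1) (p i).[y] ^+ 2 <= (p n.+1).[y] ^+ 2.
Proof.
have h := pp_lower n; have r1 := jr_ge n; have n0 := py_neq0 n.
have a0 := ja_gt0 n; have a1 := ja_le1 n.
have z0 : 0 < z - 1 by move: z2; lra.
set S := \sum_(_ < _) _ in h *.
have S0 : 0 <= S by apply: sumr_ge0 => i _; exact: sqr_ge0.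
have e : sg * (ja n * ((p n.+1).[y] * (p n).[y])) * jr n =
         (ja n * (p n.+1).[y]) ^+ 2.
  by rewrite /jr -[RHS]mul1r -sg2; field.
have h1 : (z - 1) * S * (z - 1) <= (ja n * (p n.+1).[y]) ^+ 2.
  by rewrite -e; apply: ler_pM => //; [rewrite mulr_ge0// ltW|exact: ltW].
have h2 : (ja n * (p n.+1).[y]) ^+ 2 <= (p n.+1).[y] ^+ 2.
  by rewrite exprMn ler_piMl ?sqr_ge0// expr_le1// ltW.
by apply: le_trans h2; apply: le_trans h1; rewrite expr2; nra.
Qed.

Lemma prod_jr n : \prod_(i < n) jr i =
  sg ^+ n * (\prod_(i < n) ja i) * (p n).[y] / (p 0%N).[y].
Proof.
elim: n => [|n IH]; first by rewrite !big_ord0 expr0 !mul1r divff// py_neq0.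
have n0 := py_neq0 n; have m0 := py_neq0 0.
by rewrite !big_ord_recr /= IH /jr exprS; field; rewrite n0 m0.
Qed.

End OutsidePoint.

Lemma prod_ja n : \prod_(i < n) ja i = lead_coef (p 0%N) / lead_coef (p n).
Proof.
elim: n => [|n IH]; first by rewrite big_ord0 divff// gt_eqF.
rewrite big_ord_recr /= IH (lead_ja n); field.
by rewrite !gt_eqF// ja_gt0.
Qed.

End Jacobi.

(** An n-th root comparison without roots: ((y - e) / y)^n falls below c. The threshold for n does
    not depend on X, which will itself vary with n. *)
Lemma eventually_root (R : realType) (c y e : R) : 0 < c -> 0 < e ->
  \forall n \near \oo, forall X, 0 <= X -> c * y ^+ n <= X ^+ n -> y - e <= X.
Proof.
move=> c0 e0; have [ye|ye] := leP (y - e) 0.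
  by near=> n => X X0 _; exact: le_trans ye X0.
have y0 : 0 < y by rewrite subr_gt0 in ye; exact: lt_trans ye.
set r := (y - e) / y.
have r1 : `|r| < 1.
  rewrite ger0_norm; first by rewrite ltr_pdivrMr// mul1r ltrBlDr ltrDl.
  by rewrite divr_ge0// ltW.
have := cvg_expr r1 => /cvgrPdist_lt /(_ _ c0) => H.
near=> n => X X0 h; rewrite leNgt; apply/negP => Xy.
have : `|0 - r ^+ n| < c by near: n.
rewrite sub0r normrN ger0_norm ?exprn_ge0 ?divr_ge0// ?ltW// => rc.
have yn : 0 < y ^+ n by rewrite exprn_gt0.
have : X ^+ n <= (y - e) ^+ n by rewrite lerXn2r ?nnegrE//; exact: ltW.
have -> : (y - e) ^+ n = r ^+ n * y ^+ n by rewrite -exprMn divfK ?gt_eqF.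
by rewrite leNgt (lt_le_trans _ h)// ltr_pM2r.
Unshelve. all: by end_near. Qed.

Lemma AGM_ord (R : realType) n (F : nat -> R) : (forall i, 0 <= F i) ->
  \prod_(i < n) F i <= ((\sum_(i < n) F i) / n%:R) ^+ n.
Proof.
move=> F0; have := (leif_AGM (A := [pred i : 'I_n | true]) (E := fun i => F i)).
by rewrite card_ord => h; apply: h => i _; exact: F0.
Qed.

(** * Cesaro convergence of the recurrence coefficients *)

Section Cesaro.
Context {R : realType} (l : (R -> R) -> R) (hl : posfun l).
Context (p : nat -> {poly R}) (hp : onpolys l p).
Context (lp : forall n, 0 < lead_coef (p n)).
Context (hreg : forall d : R, 0 < d ->
  \forall n \near \oo, lead_coef (p n) <= (2 + d) ^+ n).
Let sp : forall n, size (p n) = n.+1 := hp.1.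
Let op : forall n m, pint l (p n * p m) = (n == m)%:R := hp.2.
Notation ja := (ja l p).
Notation jb := (jb l p).
Notation jam := (jam l p).

Let M := pint l 1.

Lemma mass_gt0 : 0 < M.
Proof.
have p0 : p 0%N = (lead_coef (p 0%N))%:P.
  rewrite [LHS]size1_polyC ?sp// lead_coefE sp; by [].
have := op 0 0; rewrite p0 eqxx -rmorphM /= -alg_polyC (pintZ hl) -/M => h.
rewrite ltNge; apply/negP => M0; have := lp 0 => q0.
have : lead_coef (p 0) * lead_coef (p 0) * M <= 0 by rewrite pmulr_rle0// mulr_gt0.
by rewrite h ler10.
Qed.

(** T_n is at most 1 on [-1, 1], so its squared norm is at most the mass M, whereas at z = (ze + 1 /
    ze) / 2 it is at least ze^n / 2. By [on_eval_sqr] this forces the sum of p_i(z)^2 to grow like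
    ze^(2n). The ze^2 in the denominator shifts n to n + 1. *)
Lemma p_cheb_lower (sg ze z : R) n : sg ^+ 2 = 1 -> 4 <= ze ->
  z = (ze + ze^-1) / 2 ->
  (z - 1) ^+ 2 / (4 * M * ze ^+ 2) * (ze ^+ 2) ^+ n.+1 <= (p n.+1).[sg * z] ^+ 2.
Proof.
move=> sg2 ze4 zE; have ze0 : 0 < ze by lra.
have z2 : 2 <= z.
  have zi0 : 0 < ze^-1 by rewrite invr_gt0.
  by rewrite zE; lra.
have M0 := mass_gt0.
apply: le_trans (p_outside_lower hl hp lp sg2 z2 n).
rewrite -mulrA ler_wpM2l ?sqr_ge0//.
have := on_eval_sqr hl hp (sg * z) 0 (q := cheb n) (n := n.+1).
rewrite size_cheb => /(_ (leqnn _)).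
rewrite derivn0; under [X in _ <= _ * X -> _]eq_bigr do rewrite derivn0.
set S := \sum_(_ < _) _.
have S0 : 0 <= S by apply: sumr_ge0 => i _; exact: sqr_ge0.
have cM : pint l (cheb n ^+ 2) <= M.
  apply: (pint_le hl) => x x1; rewrite horner_exp hornerC.
  by rewrite -real_normK ?num_real// expr_le1// cheb_le1.
have sgE : sg = 1 \/ sg = -1.
  by move/eqP: sg2; rewrite sqrf_eq1 => /orP[] /eqP; [left|right].
have -> : (cheb n).[sg * z] ^+ 2 = (cheb n).[z] ^+ 2.
  by case: sgE => ->; rewrite ?mul1r// mulN1r chebN exprMn -exprM mulnC exprM sqrrN expr1n expr1n mul1r.
rewrite {1}zE cheb_zeta ?gt_eqF// => h.
have h2 : ze ^+ n ^+ 2 / 4 <= M * S.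
  apply: le_trans (le_trans h _); last by rewrite ler_wpM2r.
  rewrite expr_div_n (_ : 2 ^+ 2 = 4 :> R); last by rewrite expr2; lra.
  rewrite ler_pM2r ?invr_gt0// lerXn2r ?nnegrE//; last 1 first.
  - by rewrite lerDl invr_ge0 exprn_ge0// ltW.
  - by rewrite exprn_ge0// ltW.
  - by rewrite addr_ge0 ?invr_ge0 ?exprn_ge0// ltW.
rewrite mulrC [ze ^+ 2 ^+ n.+1]exprS ler_pdivrMr; last by rewrite !mulr_gt0// exprn_gt0.
have -> : ze ^+ 2 ^+ n = ze ^+ n ^+ 2 by rewrite -!exprM mulnC.
have e2 : 0 < ze ^+ 2 by rewrite exprn_gt0.
have -> : S * (4 * M * ze ^+ 2) = ze ^+ 2 * (M * S * 4) by ring.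
by rewrite ler_pM2l// -ler_pdivrMr.
Qed.

(** In the product (z - b - u) (z + b - v) the linear terms in b cancel, and z u, z v are each at
    least a_(n-1)^2 - 1 / z. The error 6 / z is 2 / z for each of z u + z v, b (v - u) and u v. *)
Lemma jr_prod_upper (z : R) n : 2 <= z ->
  jr l p 1 z n * jr l p (-1) z n <= z ^+ 2 - (jb n ^+ 2 + 2 * jam n ^+ 2) + 6 / z.
Proof.
move=> z2; have s1 : (1 : R) ^+ 2 = 1 by rewrite expr1n.
have s2 : (-1 : R) ^+ 2 = 1 by rewrite sqrrN expr1n.
rewrite (jrE hl hp lp s1 z2) (jrE hl hp lp s2 z2).
have [] := ju_bounds hl hp lp s1 z2 n; set u := ju _ _ _ _ _ => u1 u2 u3.
have [] := ju_bounds hl hp lp s2 z2 n; set v := ju _ _ _ _ _ => v1 v2 v3.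
have := jb_le1 hl hp n; rewrite ler_norml => /andP[b1 b2].
move: v1 v2 v3 u1 u2 u3.
rewrite div1r; set i := z^-1.
have i1 : i <= 1/2 by rewrite /i -div1r ler_pM// ?invr_ge0 ?lef_pV2 ?posrE//; lra.
have i0 : 0 <= i by rewrite invr_ge0; lra.
set A := jam n ^+ 2; set b := jb n in b1 b2 * => v1 v2 v3 u1 u2 u3.
have -> : (z - 1 * b - u) * (z - -1 * b - v) =
  z ^+ 2 - b ^+ 2 - (z * u + z * v) + b * (v - u) + u * v by ring.
have h1 : b * (v - u) <= 2 * i.
  apply: le_trans (ler_norm _) _; rewrite normrM -[2 * i]mul1r.
  by apply: ler_pM => //; rewrite ler_norml; lra.
have h2 : u * v <= 2 * i by nra.
by lra.
Qed.

Definition jS n := \sum_(i < n) (jb i ^+ 2 + 2 * jam i ^+ 2).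

(* At the points z and -z the ratios [jr] are z - b - a^2/r and z + b - a^2/r. By AM-GM their product is at
   most about (z^2 - (b^2 + 2 a^2))^n on average, whereas [prod_jr] and [p_cheb_lower] bound it from below by the
   square of T_n(z); letting z grow yields the claim. *)
Lemma jS_upper (eps : R) : 0 < eps -> \forall n \near \oo, jS n <= (1 / 2 + eps) * n%:R.
Proof.
(* Then 1 / ze <= eps / 50, so that 6 / z <= 12 / ze and the term ze^(-2) / 4 of z^2 fit together in
   eps / 2. Below, d = eps / ze^2 is small enough that replacing 2 by 2 + d in [Y] costs at most eps
   / 4. *)
move=> e0; set ze := 4 + 50 / eps; set z := (ze + ze^-1) / 2.
have q0 : 0 < 50 / eps by rewrite divr_gt0.
have ze4 : 4 <= ze by rewrite /ze; lra.
have ze0 : 0 < ze by lra.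
have zi0 : 0 < ze^-1 by rewrite invr_gt0.
have z2 : 2 <= z by rewrite /z; lra.
have s1 : (1 : R) ^+ 2 = 1 by rewrite expr1n.
have s2 : (-1 : R) ^+ 2 = 1 by rewrite sqrrN expr1n.
set d := eps / ze ^+ 2; have d0 : 0 < d by rewrite divr_gt0// exprn_gt0.
set Y := ze ^+ 2 / (2 + d) ^+ 2.
have M0 := mass_gt0.
set c := (z - 1) ^+ 2 / (4 * M * ze ^+ 2).
have c0 : 0 < c by rewrite divr_gt0 ?mulr_gt0 ?exprn_gt0//; lra.
have e4 : 0 < eps / 4 by lra.
have Hr := @eventually_root R c Y (eps / 4) c0 e4.
have Hg := hreg d0.
near=> n.
have n0 : (0 < n)%N by near: n; exact: nbhs_infty_gt.
have nR : 0 < n%:R :> R by rewrite ltr0n.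
pose F i := jr l p 1 z i * jr l p (-1) z i.
have F0 i : 0 <= F i.
  apply: mulr_ge0.
    by apply: le_trans (jr_ge hl hp lp s1 z2 i); lra.
  by apply: le_trans (jr_ge hl hp lp s2 z2 i); lra.
have agm := AGM_ord n F0.
have low : c * Y ^+ n <= \prod_(i < n) F i.
  have P0 : 0 <= \prod_(i < n) F i by apply: prodr_ge0 => i _; exact: F0.
  have q1 := @p_cheb_lower 1 ze z n.-1 s1 ze4 erefl; have q2 := @p_cheb_lower (-1) ze z n.-1 s2 ze4 erefl.
  rewrite prednK// -/c in q1 q2.
  have g0 := lp n; have gd : lead_coef (p n) <= (2 + d) ^+ n by near: n; exact: Hg.
  have cY0 : 0 <= c * (ze ^+ 2) ^+ n by rewrite mulr_ge0 ?exprn_ge0// ltW.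
  apply: (@le_trans _ _ (c * (ze ^+ 2) ^+ n / lead_coef (p n) ^+ 2)).
    rewrite -mulrA ler_pM2l// /Y expr_div_n ler_pM2l ?exprn_gt0//.
    rewrite lef_pV2 ?posrE ?exprn_gt0//; last by lra.
    have d20 : 0 <= (2 + d) ^+ n by rewrite exprn_ge0//; lra.
    by rewrite -exprM mulnC exprM lerXn2r ?nnegrE//; exact: ltW.
  (* Squaring removes the sign of p_n(z) p_n(-z) and matches the squared bound of [p_cheb_lower]. *)
  rewrite -ler_sqr ?nnegrE//; last by rewrite divr_ge0// exprn_ge0// ltW.
  rewrite /F big_split /= (prod_jr hl hp lp s1 z2) (prod_jr hl hp lp s2 z2).
  rewrite (prod_ja hl hp lp) !(p0_const hp).
  have -> : (1 ^+ n * (lead_coef (p 0%N) / lead_coef (p n)) * (p n).[1 * z] /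
     lead_coef (p 0%N) * ((-1) ^+ n * (lead_coef (p 0%N) / lead_coef (p n)) *
     (p n).[-1 * z] / lead_coef (p 0%N))) ^+ 2 =
     (p n).[1 * z] ^+ 2 * (p n).[-1 * z] ^+ 2 / (lead_coef (p n) ^+ 2) ^+ 2.
    rewrite expr1n mul1r !exprMn -exprM mulnC exprM s2 expr1n !exprVn.
    by field; rewrite !gt_eqF.
  rewrite expr_div_n ler_pM2r ?invr_gt0 ?exprn_gt0// expr2.
  exact: ler_pM.
have SF0 : 0 <= (\sum_(i < n) F i) / n%:R by rewrite divr_ge0// sumr_ge0.
have YX : Y - eps / 4 <= (\sum_(i < n) F i) / n%:R.
  have H : forall X, 0 <= X -> c * Y ^+ n <= X ^+ n -> Y - eps / 4 <= X by near: n; exact: Hr.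
  by apply: H => //; exact: le_trans low agm.
have FX : \sum_(i < n) F i <= (z ^+ 2 + 6 / z) * n%:R - jS n.
  apply: (@le_trans _ _ (\sum_(i < n) (z ^+ 2 - (jb i ^+ 2 + 2 * jam i ^+ 2) + 6 / z))).
    by apply: ler_sum => i _; exact: jr_prod_upper.
  rewrite le_eqVlt; apply/orP; left; apply/eqP; move: (z ^+ 2) (6 / z) => A B.
  transitivity (\sum_(i < n) ((A + B) - (jb i ^+ 2 + 2 * jam i ^+ 2))).
    by apply: eq_bigr => i _; ring.
  by rewrite sumrB sumr_const card_ord mulr_natr.
rewrite ler_pdivlMr// in YX.
have Yl : ze ^+ 2 / 4 - eps / 4 <= Y.
  have zz0 : 0 < ze ^+ 2 by rewrite exprn_gt0.
  have dz : d * ze ^+ 2 = eps by rewrite /d divfK// gt_eqF.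
  rewrite /Y ler_pdivlMr; last by rewrite exprn_gt0//; lra.
  have -> : ze ^+ 2 / 4 - eps / 4 = ze ^+ 2 * ((1 - d) / 4) by rewrite -dz; field.
  rewrite -mulrA ler_piMr//; first exact: ltW.
  by have := sqr_ge0 d; nra.
have zE : z ^+ 2 = ze ^+ 2 / 4 + 1 / 2 + ze^-1 ^+ 2 / 4.
  by rewrite /z; field; rewrite gt_eqF.
have zei : ze^-1 <= eps / 50.
  by rewrite -[eps / 50]invf_div lef_pV2 ?posrE// /ze; lra.
have zei2 : ze^-1 ^+ 2 <= ze^-1.
  have zi1 : ze^-1 <= 1 by rewrite invf_le1//; lra.
  by rewrite expr2 ler_piMr// ltW.
have z6 : 6 / z <= 12 * ze^-1.
  have zz : 0 < z by lra.
  rewrite ler_pdivrMr// /z.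
  have -> : 12 * ze^-1 * ((ze + ze^-1) / 2) = 6 + 6 * ze^-1 ^+ 2 by field; rewrite gt_eqF.
  by rewrite lerDl mulr_ge0// sqr_ge0.
have : (Y - eps / 4) * n%:R <= (z ^+ 2 + 6 / z) * n%:R - jS n by exact: le_trans YX FX.
have : Y - eps / 4 >= z ^+ 2 + 6 / z - (1 / 2 + eps).
  rewrite zE; lra.
by nra.
Unshelve. all: by end_near. Qed.

Lemma ja_avg_lower (eps : R) : 0 < eps ->
  \forall n \near \oo, (1 / 2 - eps) * n%:R <= \sum_(i < n) ja i.
Proof.
move=> e0; have e2 : 0 < eps / 2 by lra.
have Hr := @eventually_root R (lead_coef (p 0%N)) (1 / (2 + eps)) (eps / 2) (lp 0) e2.
have Hg := hreg e0.
near=> n.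
have n0 : (0 < n)%N by near: n; exact: nbhs_infty_gt.
have nR : 0 < n%:R :> R by rewrite ltr0n.
rewrite -ler_pdivlMr//.
have a0 i : 0 <= ja i by rewrite ltW// (ja_gt0 hl hp lp).
have H : forall X, 0 <= X -> lead_coef (p 0%N) * (1 / (2 + eps)) ^+ n <= X ^+ n ->
    (1 / (2 + eps)) - eps / 2 <= X by near: n; exact: Hr.
apply: le_trans (H _ _ _).
- suff : 1 / 2 - eps / 4 <= 1 / (2 + eps) by lra.
  by rewrite ler_pdivlMr; nra.
- by rewrite divr_ge0// sumr_ge0.
apply: le_trans (AGM_ord n a0).
rewrite (prod_ja hl hp lp) ler_pM2l// div1r exprVn lef_pV2 ?posrE//; last 1 first.
- by rewrite exprn_gt0//; lra.
by near: n.
Unshelve. all: by end_near. Qed.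

Definition jD n := \sum_(i < n) (jb i ^+ 2 + 2 * (ja i - 1 / 2) ^+ 2).

(** As 2 (a - 1/2)^2 = 2 a^2 - 2 a + 1/2, the two averaged bounds add up to at most 1/2 - 1 + 1/2 =
    0 in the limit. Passing from [jam] to [ja] costs one boundary term a_(n-1)^2 <= 1. *)
Lemma jD_small (eps : R) : 0 < eps -> \forall n \near \oo, jD n <= eps * n%:R.
Proof.
move=> e0; have e4 : 0 < eps / 4 by lra.
have e8 : 0 < eps / 8 by lra.
have H1 := jS_upper e4; have H2 := ja_avg_lower e8.
near=> n.
have s1 : jS n <= (1 / 2 + eps / 4) * n%:R by near: n.
have s2 : (1 / 2 - eps / 8) * n%:R <= \sum_(i < n) ja i by near: n.
have n4 : 8 / eps <= n%:R by near: n; exact: nbhs_infty_ger.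
have s3 : \sum_(i < n) ja i ^+ 2 <= \sum_(i < n) jam i ^+ 2 + 1.
  case: (n) => [|m]; first by rewrite !big_ord0 add0r.
  rewrite big_ord_recr [in X in _ <= X]big_ord_recl /= expr0n add0r lerD2l.
  by rewrite expr_le1// ?(ja_le1 hl hp lp)// ltW// (ja_gt0 hl hp lp).
have -> : jD n = \sum_(i < n) jb i ^+ 2 + 2 * \sum_(i < n) ja i ^+ 2 -
    2 * \sum_(i < n) ja i + n%:R / 2.
  rewrite (_ : n%:R / 2 = \sum_(i < n) 1 / 2); last by rewrite -mulr_suml sumr_const card_ord.
  rewrite !mulr_sumr -big_split /= -sumrB -big_split /=.
  by apply: eq_bigr => i _; field.
move: s1; rewrite /jS big_split /= -mulr_sumr.
have : 8 <= n%:R * eps by rewrite -ler_pdivrMr.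
by lra.
Unshelve. all: by end_near. Qed.

(* [cerr k j] is the error made in replacing T_k p_m by (p_(m+k) + p_(m-k)) / 2 for m = j + k; it vanishes when
   a_i = 1/2 and b_i = 0 throughout. *)
Definition jerr j : {poly R} := 'X * p j.+1 - (1 / 2) *: (p j.+2 + p j).
Definition cerr k j : {poly R} :=
  cheb k * p (j + k)%N - (1 / 2) *: (p (j + k + k)%N + p j).

Lemma jerr_norm j : pint l (jerr j ^+ 2) =
  (ja j.+1 - 1 / 2) ^+ 2 + jb j.+1 ^+ 2 + (ja j - 1 / 2) ^+ 2.
Proof.
have -> : jerr j = (ja j.+1 - 1 / 2) *: p j.+2 + jb j.+1 *: p j.+1 + (ja j - 1 / 2) *: p j.
  by rewrite /jerr (three_term hl hp) /= -!mul_polyC !rmorphB /=; ring.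
rewrite expr2 !mulrDl !mulrDr -!scalerAl -!scalerAr !(pintD hl) !(pintZ hl) !op !eqxx.
have e1 : (j.+1 == j) = false by rewrite gtn_eqF.
have e2 : (j == j.+1) = false by rewrite ltn_eqF.
have e3 : (j.+2 == j) = false by rewrite gtn_eqF// ltnW.
have e4 : (j == j.+2) = false by rewrite ltn_eqF// ltnW.
by rewrite !eqSS e1 e2 e3 e4 /=; ring.
Qed.

Lemma pint_sqr_add q r : pint l ((q + r) ^+ 2) <= 2 * (pint l (q ^+ 2) + pint l (r ^+ 2)).
Proof.
rewrite -(pintD hl) -(pintZ hl); apply: (pint_le hl) => x _.
rewrite hornerZ hornerD !horner_exp hornerD.
by have := sqr_ge0 (q.[x] - r.[x]); nra.
Qed.

Lemma cerr0 j : cerr 0 j = 0.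
Proof.
rewrite /cerr /= !addn0 mul1r.
have -> : p j + p j = 2%:R *: p j by rewrite scaler_nat mulr2n.
by rewrite scalerA divfK ?pnatr_eq0// scale1r subrr.
Qed.

Lemma cerr1 j : cerr 1 j = jerr j.
Proof. by rewrite /cerr /jerr /= !addn1. Qed.

Lemma cerrSS k j : cerr k.+2 j =
  2%:P * ('X * cerr k.+1 j.+1) + jerr (j + k + k).+2 + jerr j - cerr k j.+2.
Proof.
rewrite /cerr /jerr chebSS.
have -> : (j + k.+2 = (j + k).+2)%N by rewrite !addnS.
have -> : (j.+1 + k.+1 = (j + k).+2)%N by rewrite !(addnS, addSn).
have -> : (j.+2 + k = (j + k).+2)%N by rewrite !addSn.
rewrite !addnS !addSn -!mul_polyC.
set h := (1 / 2)%:P : {poly R}.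
have h2 : 2%:P * h = 1 by rewrite -polyCM mulrC divfK ?pnatr_eq0.
have e q : 'X * q = (2%:P * h) * ('X * q) :> {poly R} by rewrite h2 mul1r.
rewrite [X in _ + (X - _) + _ - _]e [X in _ + _ + (X - _) - _]e.
by ring.
Qed.

Definition jE n := \sum_(j < n) pint l (jerr j ^+ 2).

Lemma jerr_le j : pint l (jerr j ^+ 2) <= 3.
Proof.
rewrite jerr_norm; have := jb_le1 hl hp j.+1; rewrite ler_norml.
have := ja_le1 hl hp lp j; have := ja_gt0 hl hp lp j.
have := ja_le1 hl hp lp j.+1; have := ja_gt0 hl hp lp j.+1.
by nra.
Qed.

Lemma jE_ge0 n : 0 <= jE n.
Proof. by apply: sumr_ge0 => j _; exact: pint_sqr_ge0. Qed.

Lemma jE_shift n k : jE (n + k) <= jE n + 3 * k%:R.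
Proof.
elim: k => [|k IH]; first by rewrite addn0 mulr0 addr0.
by rewrite addnS /jE big_ord_recr /= -natr1; have := jerr_le (n + k); move: IH; rewrite /jE; lra.
Qed.

Lemma jE_le n : jE n <= 2 * jD n.+1.
Proof.
have h1 : \sum_(j < n) ((ja j.+1 - 1 / 2) ^+ 2 + jb j.+1 ^+ 2) <= jD n.+1.
  rewrite /jD big_ord_recl /= ler_wpDl//.
    by apply: addr_ge0; [|apply: mulr_ge0 => //]; exact: sqr_ge0.
  apply: ler_sum => i _; rewrite -[bump 0 i]/i.+1.
  by have := sqr_ge0 (ja i.+1 - 1 / 2); lra.
have h2 : \sum_(j < n) (ja j - 1 / 2) ^+ 2 <= jD n.+1.
  rewrite /jD big_ord_recr /= ler_wpDr//.
    by apply: addr_ge0; [|apply: mulr_ge0 => //]; exact: sqr_ge0.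
  apply: ler_sum => i _.
  by have := sqr_ge0 (ja i - 1 / 2); have := sqr_ge0 (jb i); lra.
rewrite /jE; under eq_bigr do rewrite jerr_norm.
by rewrite big_split /=; lra.
Qed.

Lemma jE_small (eps : R) : 0 < eps -> \forall n \near \oo, jE n <= eps * n%:R.
Proof.
move=> e0; have e4 : 0 < eps / 4 by lra.
have [N _ H] := jD_small e4.
near=> n.
have Nn : (N <= n.+1)%N by rewrite leqW//; near: n; exact: nbhs_infty_ge.
have n1 : 1 <= n%:R :> R by rewrite ler1n; near: n; exact: nbhs_infty_gt.
have := H n.+1 Nn; have := jE_le n; rewrite -natr1 => h1 h2.
by nra.
Unshelve. all: by end_near. Qed.

(** By [cerrSS] the error at k + 2 consists of errors at k + 1 and k and of two [jerr], and
    multiplication by x does not increase the norm. The shifts of index only add boundedly many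
    terms, each at most 3; the summand 1 absorbs them. *)
Lemma cerr_sum k : exists2 C : R, 0 <= C & forall n,
  \sum_(j < n) pint l (cerr k j ^+ 2) <= C * (jE n + 1).
Proof.
elim/cheb_ind2: k => [||k [C0 C00 H0] [C1 C10 H1]].
- exists 0 => // n; rewrite mul0r big1// => i _.
  by rewrite cerr0 expr0n /= (pint0 hl).
- exists 1 => // n; under eq_bigr do rewrite cerr1.
  by rewrite mul1r lerDl.
have pos q : 0 <= pint l (q ^+ 2) by exact: pint_sqr_ge0.
(* 16 is 2 times 2 from two uses of [pint_sqr_add] times the square of the 2 in the recursion. The
   factors 4, 7 and 7 + 3 (k + k) pay for shifting [jE] by 1, 2 and k + k + 2. *)
exists (16 * C1 * 4 + 4 * (7 + 3 * (k + k)%:R) + 4 + 4 * C0 * 7).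
  by rewrite !addr_ge0 ?mulr_ge0// addr_ge0 ?mulr_ge0.
move=> n.
have step j : pint l (cerr k.+2 j ^+ 2) <= 16 * pint l (cerr k.+1 j.+1 ^+ 2) +
  4 * pint l (jerr (j + k + k).+2 ^+ 2) + 4 * pint l (jerr j ^+ 2) +
  4 * pint l (cerr k j.+2 ^+ 2).
  have -> : cerr k.+2 j = (2%:P * ('X * cerr k.+1 j.+1) + jerr (j + k + k).+2) +
      (jerr j + - cerr k j.+2) by rewrite cerrSS; ring.
  apply: le_trans (pint_sqr_add _ _) _.
  have := pint_sqr_add (2%:P * ('X * cerr k.+1 j.+1)) (jerr (j + k + k).+2).
  have := pint_sqr_add (jerr j) (- cerr k j.+2).
  have e4 q : pint l ((2%:P * q) ^+ 2) = 4 * pint l (q ^+ 2).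
    by rewrite -(pintZ hl) exprMn -polyC_exp mul_polyC; congr (pint l (_ *: _)); ring.
  rewrite sqrrN e4.
  by have := pint_XX hl (cerr k.+1 j.+1); lra.
have sh (F : nat -> R) m : (forall i, 0 <= F i) ->
    \sum_(j < n) F (j + m)%N <= \sum_(j < n + m) F j.
  move=> F0; rewrite [in X in _ <= X]addnC big_split_ord /=.
  by rewrite ler_wpDl ?sumr_ge0//; apply: ler_sum => i _; rewrite addnC.
apply: (@le_trans _ _ (16 * \sum_(j < n) pint l (cerr k.+1 (j + 1)%N ^+ 2) +
    4 * \sum_(j < n) pint l (jerr (j + (k + k).+2)%N ^+ 2) + 4 * jE n +
    4 * \sum_(j < n) pint l (cerr k (j + 2)%N ^+ 2))).
  rewrite /jE !mulr_sumr -!big_split /=; apply: ler_sum => j _.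
  by rewrite addn1 addn2 !addnS addnA; exact: step.
have := sh (fun j => pint l (cerr k.+1 j ^+ 2)) 1 (fun=> pos _).
have := sh (fun j => pint l (cerr k j ^+ 2)) 2 (fun=> pos _).
have := sh (fun j => pint l (jerr j ^+ 2)) (k + k).+2 (fun=> pos _).
rewrite -/(jE _) => h1 h2 h3.
have := H1 (n + 1)%N; have := H0 (n + 2)%N.
have := jE_shift n 1; have := jE_shift n 2; have := jE_shift n (k + k).+2.
rewrite (_ : (k + k).+2%:R = (k + k)%:R + 2); last by rewrite -addn2 natrD.
move=> g1 g2 g3 q1 q2.
have q1' := le_trans h2 q1; have q2' := le_trans h3 q2.
have h1' := le_trans h1 g1.
have E0 := jE_ge0 n; set E := jE n in E0 g2 g3 h1' *.
set K := (k + k)%:R in h1' *.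
have K0 : 0 <= K by rewrite ler0n.
have r1 : C0 * (jE (n + 2) + 1) <= C0 * 7 * (E + 1).
  by rewrite -mulrA ler_wpM2l//; lra.
have r2 : C1 * (jE (n + 1) + 1) <= C1 * 4 * (E + 1).
  by rewrite -mulrA ler_wpM2l//; lra.
have r3 : E + 3 * (K + 2) <= (7 + 3 * K) * (E + 1) by nra.
move: (le_trans q1' r1) (le_trans q2' r2) (le_trans h1' r3).
set A1 := \sum_(j < n) _; set A2 := \sum_(j < n) _; set A3 := \sum_(j < n) _.
rewrite !mulrDl; lra.
Qed.

(** For k > 0 both p_(m+k) and p_(m-k) are orthogonal to p_m, so the integral of T_k p_m^2 is that
    of the error [cerr] against p_m, bounded by the norm of the error. The first k values of m are
    counted as 1 each. *)
Lemma cesaro_cheb k (eps : R) : (0 < k)%N -> 0 < eps ->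
  \forall n \near \oo, `|\sum_(m < n) pint l (cheb k * p m ^+ 2)| <= eps * n%:R.
Proof.
move=> k0 e0; have [C C0 HC] := cerr_sum k.
have e3 : 0 < eps / 4 by lra.
have d0 : 0 < (eps / 4) ^+ 2 / (C + 1) by rewrite divr_gt0 ?exprn_gt0//; lra.
have Hs := jE_small d0.
near=> n.
have E1 : jE n <= (eps / 4) ^+ 2 / (C + 1) * n%:R by near: n; exact: Hs.
have n1 : C / (eps / 4) ^+ 2 <= n%:R by near: n; exact: nbhs_infty_ger.
have n2 : k%:R / (eps / 4) <= n%:R by near: n; exact: nbhs_infty_ger.
have one m : `|pint l (cheb k * p m ^+ 2)| <= 1.
  have e : (m == m :> nat)%:R = 1 :> R by rewrite eqxx.
  rewrite -e -op -expr2; apply: (posfun_norm hl); [exact: cont_poly|exact: cont_poly|move=> x x1].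
  rewrite hornerM horner_exp normrM normrX real_normK ?num_real//.
  by rewrite ler_piMl ?sqr_ge0// cheb_le1.
have bnd j : `|pint l (cheb k * p (j + k)%N ^+ 2)| <= eps / 4 + pint l (cerr k j ^+ 2) / (eps / 4).
  have -> : pint l (cheb k * p (j + k)%N ^+ 2) = pint l (cerr k j * p (j + k)%N).
    rewrite /cerr mulrBl -scalerAl mulrDl (pintB hl) (pintZ hl) (pintD hl) !op.
    have z1 : (j + k + k == j + k)%N = false.
      by rewrite gtn_eqF// -[X in (X < _)%N]addn0 ltn_add2l.
    have z2 : (j == j + k)%N = false.
      by rewrite ltn_eqF// -[X in (X < _)%N]addn0 ltn_add2l.
    by rewrite z1 z2 addr0 mulr0 subr0 -mulrA -expr2.
  have := pint_CS hl (cerr k j) (p (j + k)%N).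
  rewrite [p _ ^+ 2]expr2 op eqxx mulr1.
  set V := pint l (cerr k j ^+ 2); set x := pint l _ => xV.
  have V0 : 0 <= V by exact: pint_sqr_ge0.
  have V1 : 0 <= V / (eps / 4) by rewrite divr_ge0// ltW.
  have [xe|xe] := leP `|x| (eps / 4); first by lra.
  have : `|x| <= V / (eps / 4).
    rewrite ler_pdivlMr//; apply: le_trans xV; rewrite -[x ^+ 2]real_normK ?num_real//.
    by rewrite expr2 ler_wpM2l// ltW.
  by lra.
apply: le_trans (ler_norm_sum _ _ _) _.
have s1 : \sum_(m < n) `|pint l (cheb k * p m ^+ 2)| <=
  k%:R + \sum_(j < n) `|pint l (cheb k * p (j + k)%N ^+ 2)|.
  apply: (@le_trans _ _ (\sum_(m < k + n) `|pint l (cheb k * p m ^+ 2)|)).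
    by rewrite addnC big_split_ord /= lerDl sumr_ge0.
  rewrite big_split_ord /= lerD//.
    apply: (@le_trans _ _ (\sum_(i < k) 1)); first by apply: ler_sum => i _; exact: one.
    by rewrite sumr_const card_ord.
  by apply: ler_sum => i _; rewrite addnC.
apply: le_trans s1 _.
have s2 : \sum_(j < n) `|pint l (cheb k * p (j + k)%N ^+ 2)| <=
    eps / 4 * n%:R + (\sum_(j < n) pint l (cerr k j ^+ 2)) / (eps / 4).
  apply: (@le_trans _ _ (\sum_(j < n) (eps / 4 + pint l (cerr k j ^+ 2) / (eps / 4)))).
    by apply: ler_sum => i _; exact: bnd.
  by rewrite big_split /= sumr_const card_ord -mulr_suml mulr_natr.
have s3 : (\sum_(j < n) pint l (cerr k j ^+ 2)) / (eps / 4) <= eps / 4 * n%:R + eps / 4 * n%:R.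
  rewrite ler_pdivrMr//; apply: le_trans (HC n) _.
  have -> : (eps / 4 * n%:R + eps / 4 * n%:R) * (eps / 4) =
    (eps / 4) ^+ 2 * n%:R + (eps / 4) ^+ 2 * n%:R by ring.
  have q1 : C <= (eps / 4) ^+ 2 * n%:R by rewrite mulrC -ler_pdivrMr ?exprn_gt0.
  have q2 : C * jE n <= (eps / 4) ^+ 2 * n%:R.
    apply: (@le_trans _ _ ((C + 1) * jE n)); first by rewrite ler_wpM2r ?jE_ge0//; lra.
    have C1 : 0 < C + 1 by lra.
    by rewrite mulrC -ler_pdivlMr//; apply: le_trans E1 _; rewrite mulrAC.
  by rewrite mulrDr mulr1 lerD.
have s4 : k%:R <= n%:R * (eps / 4) by rewrite -ler_pdivrMr.
by lra.
Unshelve. all: by end_near. Qed.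

End Cesaro.

(** * Weierstrass approximation and the arcsine measure *)

Section Weierstrass.
Context {R : realType}.
Implicit Types (f : R -> R).

Lemma cont_comp f (g : R -> R) :
  continuous f -> continuous g -> continuous (fun x => g (f x)).
Proof. by move=> cf cg x; apply: (@continuous_comp _ _ _ f g); [exact: cf|exact: cg]. Qed.

Lemma unif_cont_segment f (a b e : R) : continuous f -> 0 < e ->
  exists2 d : R, 0 < d & forall x y, a <= x <= b -> `|y - x| < d -> `|f y - f x| <= e.
Proof.
move=> cf e0.
pose P (d x : R) := forall y, `|y - x| < d -> `|f y - f x| <= e.
have /compact_near_coveringP H := @segment_compact R a b.
have key : forall x, `[a, b]%classic x -> \forall x' \near x & d \near at_right 0, P d x'.
  move=> x0 _; have e2 : 0 < e / 2 by lra.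
  have /cvgrPdist_le /(_ _ e2) := cf x0; rewrite near_nbhs => -[r /= r0 rf].
  have r2 : 0 < r / 2 by lra.
  exists (ball x0 (r / 2), [set d | 0 < d < r / 2]) => /=.
    split; first exact: nbhsx_ballx.
    near=> d; apply/andP; split; near: d; first exact: nbhs_right_gt.
    exact: nbhs_right_lt.
  move=> [x' d] /= [xb /andP[d0 dr]] y yx.
  have h1 : ball x0 r x'.
    by rewrite /ball /=; move: xb; rewrite /ball /= => /lt_trans; apply; lra.
  have h2 : ball x0 r y.
    rewrite /ball /=.
  have -> : x0 - y = (x0 - x') - (y - x') by ring.
    apply: le_lt_trans (ler_normB _ _) _.
    by move: xb; rewrite /ball /=; lra.
  have := rf _ h1; have := rf _ h2 => /= g1 g2.
  have -> : f y - f x' = (f x0 - f x') - (f x0 - f y) by ring.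
  by apply: le_trans (ler_normB _ _) _; lra.
have := H R (at_right 0) P _ key => near_P.
have [d [d0 Pd]] : exists d, 0 < d /\ (`[a, b]%classic `<=` P d).
  have [d] : exists d, 0 < d /\ (`[a, b]%classic `<=` P d).
    apply: (@filter_ex _ (at_right (0 : R))).
    by near=> d; split; near: d; [exact: nbhs_right_gt|exact: near_P].
  by move=> h; exists d.
by exists d => // x y xab yx; apply: (Pd x) => //.
Unshelve. all: by end_near. Qed.

Lemma cont_bounded f (a b : R) : continuous f ->
  exists2 M : R, 0 <= M & forall x, a <= x <= b -> `|f x| <= M.
Proof.
move=> cf; have [ab|ba] := leP a b; last first.
  by exists 0 => // x /andP[ax xb]; have := lt_le_trans ba (le_trans ax xb); rewrite ltxx.
have cn : {within `[a, b], continuous (fun x => `|f x|)}.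
  apply: continuous_subspaceT => x; apply: (@cvg_norm _ R); exact: cf.
have [c _ h] := EVT_max ab cn.
by exists `|f c| => // x xab; apply: h; rewrite in_itv.
Qed.

(* Bernstein polynomials, through the recursion
   B_(n+1) g = 'X * B_n (g (_ + 1)) + (1 - 'X) * B_n g. *)
Fixpoint bern n (g : nat -> R) : {poly R} :=
  if n is m.+1 then 'X * bern m (fun k => g k.+1) + (1 - 'X) * bern m g
  else (g 0%N)%:P.

Lemma bern_le n g h (x : R) : 0 <= x <= 1 ->
  (forall k, (k <= n)%N -> g k <= h k) -> (bern n g).[x] <= (bern n h).[x].
Proof.
move=> x01; elim: n g h => [|n IH] g h gh /=; first by rewrite !hornerC gh.
rewrite !hornerE; apply: lerD.
  by apply: ler_wpM2l; [lra|apply: IH => k kn; exact: gh].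
by apply: ler_wpM2l; [lra|apply: IH => k kn; apply: gh; exact: leqW].
Qed.

Lemma bern_sub n g (c x : R) : (bern n (fun k => g k - c)).[x] = (bern n g).[x] - c.
Proof.
elim: n g => [|n IH] g /=; first by rewrite !hornerC.
by rewrite !hornerE !IH; ring.
Qed.

Lemma bern_opp n g (x : R) : (bern n (fun k => - g k)).[x] = - (bern n g).[x].
Proof.
elim: n g => [|n IH] g /=; first by rewrite !hornerC.
by rewrite !hornerE !IH; ring.
Qed.

(** The second moment of a binomial variable. The centre c is arbitrary because the recursion moves
    it to c - 1. *)
Lemma bern_sqr n (e C c x : R) :
  (bern n (fun k => e + C * (k%:R - c) ^+ 2)).[x] =
  e + C * ((n%:R * x - c) ^+ 2 + n%:R * x * (1 - x)).
Proof.
elim: n c => [|n IH] c /=; first by rewrite hornerC !mul0r addr0.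
have eqb : bern n (fun k => e + C * (k.+1%:R - c) ^+ 2) =
           bern n (fun k => e + C * (k%:R - (c - 1)) ^+ 2).
  by congr bern; apply/funext => k; rewrite -natr1; congr (_ + _ * _ ^+ 2); ring.
by rewrite !hornerE eqb !IH -natr1; ring.
Qed.

Lemma weierstrass01 f (e : R) : continuous f -> 0 < e ->
  exists q : {poly R}, forall x, 0 <= x <= 1 -> `|f x - q.[x]| <= e.
Proof.
move=> cf e0; have e2 : 0 < e / 2 by lra.
have [M M0 fM] := cont_bounded 0 1 cf.
have [d d0 fd] := unif_cont_segment 0 1 cf e2.
set C := 2 * M / d ^+ 2.
have C0 : 0 <= C by apply: divr_ge0; [exact: mulr_ge0|exact: sqr_ge0].
have [n nC] : exists n : nat, C / (e / 2) < n.+1%:R.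
  have [n _ H] := @nbhs_infty_gtr R (C / (e / 2)).
  by exists n; apply: H => /=; exact: leqW.
set N : R := n.+1%:R.
have N0 : 0 < N by rewrite ltr0n.
exists (bern n.+1 (fun k => f (k%:R / N))) => x x01.
(* Near x uniform continuity bounds the increment by e / 2; at distance d or more the quadratic term
   is at least 2 M. *)
have bnd k : (k <= n.+1)%N ->
    `|f (k%:R / N) - f x| <= e / 2 + C / N ^+ 2 * (k%:R - N * x) ^+ 2.
  move=> kn; set y := k%:R / N.
  have y01 : 0 <= y <= 1.
    by rewrite divr_ge0//= ler_pdivrMr// mul1r ler_nat.
  have -> : C / N ^+ 2 * (k%:R - N * x) ^+ 2 = C * (y - x) ^+ 2.
    by rewrite /y; field; rewrite gt_eqF.
  have [yx|yx] := ltP `|y - x| d.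
    by apply: le_trans (fd _ _ x01 yx) _; rewrite lerDl mulr_ge0// sqr_ge0.
  apply: (@le_trans _ _ (2 * M)).
    by apply: le_trans (ler_normB _ _) _; have := fM _ x01; have := fM _ y01; lra.
  have h : d ^+ 2 <= (y - x) ^+ 2.
    by rewrite -[leRHS]real_normK ?num_real// lerXn2r ?nnegrE// ltW.
  have : 2 * M <= C * (y - x) ^+ 2.
    apply: (@le_trans _ _ (C * d ^+ 2)); last by rewrite ler_wpM2l.
    by rewrite /C divfK// gt_eqF// exprn_gt0.
  by lra.
have tot : e / 2 + C / N ^+ 2 * ((N * x - N * x) ^+ 2 + N * x * (1 - x)) <= e.
  rewrite subrr expr0n add0r.
  have -> : C / N ^+ 2 * (N * x * (1 - x)) = C / N * (x * (1 - x)).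
    by field; rewrite gt_eqF.
  have h1 : C / N <= e / 2 by rewrite ler_pdivrMr// -ler_pdivrMl// mulrC ltW.
  have h2 : 0 <= C / N by rewrite divr_ge0// ltW.
  have h3 : 0 <= x * (1 - x) <= 1 by nra.
  have h4 : C / N * (x * (1 - x)) <= C / N by rewrite ler_piMr//; lra.
  by rewrite [leRHS](splitr e) lerD2l; exact: le_trans h4 h1.
rewrite -normrN opprB ler_norml; apply/andP; split.
- rewrite lerNl -(bern_sub n.+1 _ (f x)) -bern_opp; apply: le_trans tot.
  rewrite -bern_sqr; apply: bern_le => // k kn; apply: le_trans (bnd k kn).
  by rewrite -normrN; exact: ler_norm.
- rewrite -(bern_sub n.+1 _ (f x)); apply: le_trans tot.
  rewrite -bern_sqr; apply: bern_le => // k kn; apply: le_trans (bnd k kn).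
  exact: ler_norm.
Qed.

Lemma weierstrass f (a b e : R) : continuous f -> a < b -> 0 < e ->
  exists q : {poly R}, forall x, a <= x <= b -> `|f x - q.[x]| <= e.
Proof.
move=> cf ab e0; pose g (y : R) := f (a + (b - a) * y).
have cg : continuous g.
  move=> y; apply: (@continuous_comp _ _ _ (fun y => a + (b - a) * y) f); last exact: cf.
  by apply: contD; [exact: cont_cst|apply: contZ => z; exact: cvg_id].
have [q hq] := weierstrass01 cg e0.
exists (q \Po ((b - a)^-1 *: ('X - a%:P))) => x xab.
rewrite horner_comp !hornerE.
set y := (b - a)^-1 * (x - a).
have ba : 0 < b - a by lra.
have y01 : 0 <= y <= 1.
  rewrite /y mulr_ge0 ?invr_ge0 ?(ltW ba)//=; last by lra.
  by rewrite mulrC ler_pdivrMr//; lra.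
have -> : x = a + (b - a) * y by rewrite /y mulrA divff ?gt_eqF// mul1r; ring.
exact: hq.
Qed.

End Weierstrass.

Section IntegralFunctional.
Context {R : realType}.
Notation leb := (@lebesgue_measure R).

Lemma integrable_cont_mul (m : {measure set (measurableTypeR R) -> \bar R})
    (D : set (measurableTypeR R)) (X rho f : R -> R) :
  measurable D -> continuous X -> (forall t, D t -> -1 <= X t <= 1) ->
  m.-integrable D (EFin \o rho) -> continuous f ->
  m.-integrable D (EFin \o (fun t => f (X t) * rho t)).
Proof.
move=> mD cX XD irho cf.
have [M M0 fM] := cont_bounded (-1) 1 cf.
have mrho : measurable_fun D rho by case/integrableP : irho => /measurable_EFinP.
have cfX : continuous (fun t => f (X t)).
  by move=> t; apply: (@continuous_comp _ _ _ X f); [exact: cX|exact: cf].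
have := integrableZl mD M irho; apply: le_integrable => //.
  apply/measurable_EFinP; apply: measurable_funM => //.
  by apply: measurable_funS (continuous_measurable_fun cfX).
move=> t Dt /=; rewrite lee_fin !normrM ler_wpM2r//.
by apply: le_trans (fM _ (XD _ Dt)) _; exact: ler_norm.
Qed.

(** X = cos gives the arcsine functional, and X the identity gives integration against a measure on
    (-1, 1). *)
Lemma posfun_int (m : {measure set (measurableTypeR R) -> \bar R})
    (D : set (measurableTypeR R)) (X rho : R -> R) :
  measurable D -> continuous X -> (forall t, D t -> -1 <= X t <= 1) ->
  (forall t, D t -> 0 <= rho t) -> m.-integrable D (EFin \o rho) ->
  posfun (fun f => \int[m]_(t in D) (f (X t) * rho t)).
Proof.
move=> mD cX XD rho0 irho; split.
- move=> a f g cf cg.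
  have h1 := integrable_cont_mul mD cX XD irho cf.
  have h2 := integrable_cont_mul mD cX XD irho cg.
  rewrite -RintegralZl// -RintegralD//; last exact: (integrableZl mD a h1).
  by apply: eq_Rintegral => t _; ring.
- move=> f cf f0; apply: Rintegral_ge0 => t Dt; rewrite mulr_ge0//; last exact: rho0.
  by apply: f0; exact: XD.
Qed.

Lemma int_cos_subst (c h : R) (F : R -> R) : 0 < h -> continuous F ->
  \int[leb]_(x in `[c - h, c + h]) F x =
  \int[leb]_(t in `[0, pi]) (F (c + h * cos t) * (h * sin t)).
Proof.
move=> h0 cF; pose G (t : R) := c + h * cos t.
have dG t : is_derive t (1 : R) G (- (h * sin t)).
  have : is_derive t (1 : R) G (0 + h *: (- sin t)).
    by apply: is_deriveD; exact: is_deriveZ.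
  by rewrite /GRing.scale /= add0r mulrN.
have G'E : G^`()%classic = (fun t => - (h * sin t)).
  by apply/funext => t; rewrite derive1E; exact: derive_val.
have cG' : continuous (fun t : R => - (h * sin t)).
  by apply: contN; apply: contZ => x; exact: continuous_sin.
have cG : continuous G.
  by apply: contD; [exact: cont_cst|apply: contZ => x; exact: continuous_cos].
have G0 : G 0 = c + h by rewrite /G cos0 mulr1.
have Gpi : G pi = c - h by rewrite /G cospi mulrN1.
rewrite -G0 -Gpi /Rintegral; congr fine.
rewrite (@integration_by_substitution_decreasing R G F 0 pi) ?pi_ge0//.
- by apply: eq_integral => t _; rewrite G'E /= opprK.
- move=> x y x0 y0 xy; rewrite /G ltrD2l ltr_pM2l// ltr_cos//.
- by move=> x _; rewrite G'E; exact: cG'.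
- by rewrite G'E; apply/cvg_ex; exists (- (h * sin 0)); apply: cvg_at_right_filter; exact: cG'.
- by rewrite G'E; apply/cvg_ex; exists (- (h * sin pi)); apply: cvg_at_left_filter; exact: cG'.
- split.
  + by move=> x _; apply: ex_derive.
  + by apply: cvg_at_right_filter; exact: cG.
  + by apply: cvg_at_left_filter; exact: cG.
- exact: continuous_subspaceT.
Qed.

End IntegralFunctional.

Section Lambda.
Context {R : realType}.
Notation leb := (@lebesgue_measure R).

(* Integration against the arcsine measure dx / (pi sqrt(1 - x^2)), substituting x = cos t. *)
Definition Lam (f : R -> R) : R := \int[leb]_(t in `[0, pi]) (f (cos t) * pi^-1).

Lemma LamE f : Lam f = \int[leb]_(t in `[0, pi]) (f (cos t) * pi^-1).
Proof. by []. Qed.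

Lemma posfun_Lam : posfun Lam.
Proof.
apply: (posfun_int (X := @cos R) (rho := fun=> pi^-1)) => //.
- exact: continuous_cos.
- by move=> t _; rewrite cos_geN1 cos_le1.
- by move=> t _; rewrite invr_ge0 pi_ge0.
apply/integrableP; split; first exact/measurable_EFinP.
rewrite /= integral_cst//= lebesgue_measure_itv /=.
by case: ifP => _; rewrite ?mule0 ?ltry// -EFinM ltry.
Qed.

Lemma cont_cosn k : continuous (fun t : R => cos (k%:R * t)).
Proof.
apply: (cont_comp (f := fun t => k%:R * t)); last exact: continuous_cos.
by apply: contZ => x; exact: cvg_id.
Qed.

Lemma integral_cos_nat k : (0 < k)%N -> \int[leb]_(t in `[0, pi]) cos (k%:R * t) = 0.
Proof.
move=> k0; pose F (t : R) := sin (k%:R * t) / k%:R.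
have kn0 : k%:R != 0 :> R by rewrite pnatr_eq0 -lt0n.
have dk t : is_derive t (1 : R) (fun t => k%:R * t : R) k%:R.
  have : is_derive t (1 : R) (k%:R \*: (id : R -> R)) (k%:R *: (1 : R)).
    by apply: is_deriveZ; exact: is_derive_id.
  by rewrite /GRing.scale /= mulr1.
have dF t : is_derive t (1 : R) F (cos (k%:R * t)).
  have h1 : is_derive t (1 : R) (fun t => sin (k%:R * t)) (k%:R * cos (k%:R * t)).
    have := is_derive1_comp (f := @sin R) (is_derive_sin (k%:R * t)) (dk t).
    by rewrite mulrC.
  have : is_derive t (1 : R) (k%:R^-1 \*: (fun t => sin (k%:R * t)))
      (k%:R^-1 *: (k%:R * cos (k%:R * t))) by exact: is_deriveZ.
  rewrite /GRing.scale /= mulKf//; congr (is_derive _ _ _ _).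
  by apply/funext => x; rewrite /F mulrC.
have F'E : F^`()%classic = (fun t => cos (k%:R * t)).
  by apply/funext => t; rewrite derive1E; exact: derive_val.
have cc : continuous (fun t : R => cos (k%:R * t)) by exact: cont_cosn.
have cF : continuous F.
  move=> t; apply: differentiable_continuous; apply/derivable1_diffP.
  exact: ex_derive.
rewrite /Rintegral (@continuous_FTC2 _ _ F) ?pi_gt0//.
- rewrite /F mulr0 sin0 mul0r.
  have -> : sin (k%:R * pi) = 0 :> R.
    elim: (k) => [|m IH]; first by rewrite mul0r sin0.
    by rewrite -natr1 mulrDl mul1r sinD IH sinpi mul0r mulr0 addr0.
  by rewrite mul0r subee.
- exact: continuous_subspaceT.
- split.
  + by move=> x _; apply: ex_derive.
  + by apply: cvg_at_right_filter; exact: cF.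
  + by apply: cvg_at_left_filter; exact: cF.
- by move=> x _; rewrite F'E.
Qed.

Lemma Lam_cheb k : pint Lam (cheb k) = (k == 0)%N%:R.
Proof.
rewrite /pint /Lam; under eq_Rintegral do rewrite cheb_cos.
case: k => [|k].
  under eq_Rintegral do rewrite mul0r cos0 mul1r.
  rewrite Rintegral_cst//= lebesgue_measure_itv /= lte_fin pi_gt0 /=.
  by rewrite subr0 mulVf// gt_eqF// pi_gt0.
have ci : leb.-integrable `[0, pi] (EFin \o (fun t => cos (k.+1%:R * t))).
  apply: continuous_compact_integrable; first exact: segment_compact.
  by apply: continuous_subspaceT; exact: cont_cosn.
by rewrite RintegralZr// integral_cos_nat// mul0r.
Qed.

End Lambda.

(** * Derivatives of Chebyshev polynomials away from the end points *)

Section ChebyshevODE.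
Context {R : realType}.
Notation T := (@cheb R).

Lemma deriv_cheb_sin n (t : R) : (T n)^`().[cos t] * sin t = n%:R * sin (n%:R * t).
Proof.
elim/cheb_ind2: n => [||n h0 h1].
- by rewrite /= poly.derivE hornerC !mul0r.
- by rewrite /= poly.derivE hornerC !mul1r.
have -> : (T n.+2)^`().[cos t] * sin t = 2 * (T n.+1).[cos t] * sin t +
    2 * cos t * ((T n.+1)^`().[cos t] * sin t) - (T n)^`().[cos t] * sin t.
  by rewrite chebSS !poly.derivE !hornerE /=; ring.
rewrite h1 h0 cheb_cos.
rewrite (_ : n.+2%:R * t = n.+1%:R * t + t); last by rewrite -!natr1; ring.
rewrite (_ : n%:R * t = n.+1%:R * t - t); last by rewrite -!natr1; ring.
rewrite sinB sinD (_ : n.+2%:R = n%:R + 2); last by rewrite -addn2 natrD.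
by rewrite -[n.+1%:R]natr1; ring.
Qed.

Lemma cheb_derivA n : (1 - 'X ^+ 2) * (T n)^`() = n%:R * ('X * T n - T n.+1).
Proof.
elim/cheb_ind2: n => [||n h0 h1].
- by rewrite /= poly.derivE mulr0 mul0r.
- by rewrite chebSS /= poly.derivE; ring.
have e3 : T n.+3 = 2%:P * 'X * T n.+2 - T n.+1 by [].
have e2 : T n.+2 = 2%:P * 'X * T n.+1 - T n by [].
rewrite e3; have e0 : T n = 2%:P * 'X * T n.+1 - T n.+2 by rewrite e2; ring.
have -> : (T n.+2)^`() = 2%:P * T n.+1 + 2%:P * 'X * (T n.+1)^`() - (T n)^`().
  by rewrite e2 !poly.derivE; ring.
transitivity (2%:P * (1 - 'X ^+ 2) * T n.+1 +
    2%:P * 'X * ((1 - 'X ^+ 2) * (T n.+1)^`()) - (1 - 'X ^+ 2) * (T n)^`()); first by ring.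
rewrite h1 h0 {1}e0 -!natr1; ring.
Qed.

(** The two relations are proved together: the first at n + 1 follows from the second at n, and the
    second at n + 1 from the first at n + 1 and [cheb_derivA]. *)
Lemma cheb_derivBC n :
  n%:R * (T n.+1)^`() = n.+1%:R * (n%:R * T n + 'X * (T n)^`()) /\
  n.+1%:R * (T n)^`() = n%:R * ('X * (T n.+1)^`() - n.+1%:R * T n.+1).
Proof.
elim: n => [|n [hB hC]]; first by rewrite /= !poly.derivE; split; ring.
have e2 : (T n.+2)^`() = 2%:P * T n.+1 + 2%:P * 'X * (T n.+1)^`() - (T n)^`().
  by rewrite chebSS !poly.derivE; ring.
have hB' : n.+1%:R * (T n.+2)^`() = n.+2%:R * (n.+1%:R * T n.+1 + 'X * (T n.+1)^`()).
  rewrite e2.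
  transitivity (n.+1%:R * (2%:P * T n.+1 + 2%:P * 'X * (T n.+1)^`()) - n.+1%:R * (T n)^`()).
    by ring.
  by rewrite hC; ring.
split=> //.
have hA := cheb_derivA n.+1.
transitivity (n.+2%:R * ((1 - 'X ^+ 2) * (T n.+1)^`()) + n.+2%:R * 'X ^+ 2 * (T n.+1)^`()).
  by ring.
rewrite hA.
transitivity ('X * (n.+1%:R * (T n.+2)^`()) - n.+1%:R * n.+2%:R * T n.+2); last by ring.
by rewrite hB'; ring.
Qed.

Lemma cheb_ode0 n : (1 - 'X ^+ 2) * (T n)^`()^`() = 'X * (T n)^`() - n%:R ^+ 2 * T n.
Proof.
have [hB _] := cheb_derivBC n; have := cheb_derivA n; rewrite mulr_natl.
move=> /(congr1 (@deriv R)); rewrite derivMn !poly.derivE => h.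
transitivity ((0 - 'X *+ 2) * (T n)^`() + (1 - 'X ^+ 2) * (T n)^`()^`() + 2%:R * 'X * (T n)^`()).
  by ring.
rewrite [X in X + _](_ : _ = ('X * (T n)^`() + T n - (T n.+1)^`()) *+ n); last first.
  rewrite (_ : 'X * _ + T n - _ = 1 * T n + 'X * (T n)^`() - (T n.+1)^`()); last by ring.
  by rewrite -h.
rewrite -mulr_natl mulrBr hB -!natr1; ring.
Qed.

(** Chebyshev's equation differentiated k times. To leading order in n it says that two derivatives
    multiply T_n by -n^2 / (1 - x^2). *)
Lemma cheb_ode n k : (1 - 'X ^+ 2) * (T n)^`(k.+2) =
  (2 * k%:R + 1) *: ('X * (T n)^`(k.+1)) - (n%:R ^+ 2 - k%:R ^+ 2) *: (T n)^`(k).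
Proof.
elim: k => [|k IH].
  rewrite !derivnS derivn0 cheb_ode0 mulr0 add0r scale1r expr0n subr0.
  by rewrite -mul_polyC rmorphXn /= polyC_natr.
have h : (1 - 'X^2)^`() * (T n)^`(k.+2) + (1 - 'X^2) * (T n)^`(k.+3) =
    (2 * k%:R + 1) *: ((T n)^`(k.+1) + 'X * (T n)^`(k.+2)) -
    (n%:R ^+ 2 - k%:R ^+ 2) *: (T n)^`(k.+1).
  have := congr1 (@deriv R) IH.
  by rewrite derivM [X in _ = X -> _]derivB !derivZ derivM derivX mul1r -!derivnS.
transitivity ((1 - 'X^2)^`() * (T n)^`(k.+2) + (1 - 'X^2) * (T n)^`(k.+3) +
    2%:P * 'X * (T n)^`(k.+2)).
  by rewrite derivB derivXn -polyC1 derivC polyC1; ring.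
rewrite h -natr1 -!mul_polyC.
ring.
Qed.

(** Away from the end points a derivative costs only a factor n, by the recursion [cheb_ode] divided
    by 1 - x^2. The constant C = 4 / s0 satisfies s0 C^2 = 4 C >= 3 C + 1, which closes the
    induction. *)
Lemma cheb_derivn_bound (s0 x : R) n k : 0 < s0 -> s0 <= 1 -> s0 <= 1 - x ^+ 2 ->
  `|(T n)^`(k).[x]| <= (4 / s0 * n%:R) ^+ k.
Proof.
move=> s00 s01 sx; have x1 : -1 <= x <= 1 by nra.
have xn : `|x| <= 1 by rewrite ler_norml; lra.
have C0 : 0 < 4 / s0 by rewrite divr_gt0.
have ode m q (B : R) : (1 - x ^+ 2) * q = m -> `|m| <= s0 * B -> `|q| <= B.
  move=> <-; rewrite normrM (ger0_norm (_ : 0 <= 1 - x ^+ 2)); last by lra.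
  move=> h; rewrite -(ler_pM2l s00); apply: le_trans h.
  by rewrite ler_wpM2r.
elim/cheb_ind2: k => [||k h0 h1].
- by rewrite derivn0 expr0 cheb_le1.
- rewrite derivn1 expr1.
  have := congr1 (horner^~ x) (cheb_derivA n).
  rewrite hornerM hornerD hornerN hornerXn hornerC mulr_natl hornerMn hornerD hornerN hornerM hornerX.
  move=> /ode; apply; rewrite -mulr_natr normrM normr_nat.
  have -> : s0 * (4 / s0 * n%:R) = 4 * n%:R by field; rewrite gt_eqF.
  rewrite ler_wpM2r//.
  apply: le_trans (ler_normB _ _) _; rewrite normrM.
  have := cheb_le1 n x1; have := cheb_le1 n.+1 x1.
  have := normr_ge0 (T n).[x]; have := normr_ge0 x; nra.
have [kn|kn] := leqP k.+2 n; last first.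
  by rewrite derivn_poly0 ?size_cheb// horner0 normr0; apply: exprn_ge0; apply: mulr_ge0 => //; exact: ltW.
have n1 : 1 <= n%:R :> R by rewrite ler1n; apply: leq_trans kn.
have kn' : k%:R <= n%:R :> R by rewrite ler_nat; apply: leq_trans kn; rewrite !leqW.
have := congr1 (horner^~ x) (cheb_ode n k).
rewrite hornerM !(hornerD, hornerN, hornerXn, hornerC, hornerZ, hornerM, hornerX).
move=> /ode; apply.
set C := 4 / s0 in C0 h0 h1 *; set A := (C * n%:R) ^+ k in h0 h1 *.
have A0 : 0 <= A by rewrite exprn_ge0// mulr_ge0// ltW.
have e1 : (C * n%:R) ^+ k.+1 = C * n%:R * A by rewrite exprS.
have e2 : (C * n%:R) ^+ k.+2 = C ^+ 2 * n%:R ^+ 2 * A by rewrite exprS e1; ring.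
rewrite e1 in h1; rewrite e2.
have Cs : s0 * C ^+ 2 = 4 * C by rewrite /C; field; rewrite gt_eqF.
have C4 : 4 <= C by rewrite /C ler_pdivlMr//; nra.
apply: le_trans (ler_normB _ _) _.
have k0 : 0 <= k%:R :> R by [].
set N : R := n%:R in n1 kn' h1 *; set K : R := k%:R in k0 kn' *.
have b1 : `|(2 * K + 1) * (x * (T n)^`(k.+1).[x])| <= 3 * N * (C * N * A).
  rewrite !normrM (ger0_norm (_ : 0 <= 2 * K + 1)); last by lra.
  apply: ler_pM; [by lra|by rewrite mulr_ge0|by lra|].
  by rewrite -[leRHS]mul1r; apply: ler_pM.
have b2 : `|(N ^+ 2 - K ^+ 2) * (T n)^`(k).[x]| <= N ^+ 2 * A.
  rewrite normrM (ger0_norm (_ : 0 <= N ^+ 2 - K ^+ 2)); last by nra.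
  by apply: ler_pM => //; nra.
apply: le_trans (lerD b1 b2) _.
have -> : s0 * (C ^+ 2 * N ^+ 2 * A) = 4 * C * (N ^+ 2 * A) by rewrite -Cs; ring.
have NA : 0 <= N ^+ 2 * A by rewrite mulr_ge0// sqr_ge0.
have -> : 3 * N * (C * N * A) + N ^+ 2 * A = (3 * C + 1) * (N ^+ 2 * A) by ring.
by rewrite ler_wpM2r//; lra.
Qed.

End ChebyshevODE.

Section Sums.
Context {R : realType}.

Lemma itv_of_sqr (s x : R) : 0 < s -> s <= 1 - x ^+ 2 -> -1 <= x <= 1.
Proof.
move=> s0 sx; rewrite -ler_norml -(@expr_le1 _ 2)// real_normK ?num_real//.
by move: (x ^+ 2) sx => y sx; lra.
Qed.

(** Summation by parts. It is applied to u_j = j^k and an oscillating v with bounded partial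
    sums. *)
Lemma abel_sum (u v : nat -> R) (B : R) n : (forall j, 0 <= u j <= u j.+1) ->
  (forall m, `|\sum_(j < m) v j| <= B) -> `|\sum_(j < n) u j * v j| <= 2 * B * u n.
Proof.
move=> hu hv; have B0 : 0 <= B by apply: le_trans (hv 0%N).
have -> : \sum_(j < n) u j * v j =
    u n * (\sum_(j < n) v j) - \sum_(j < n) (u j.+1 - u j) * \sum_(i < j.+1) v i.
  elim: n => [|n IH]; first by rewrite !big_ord0 mulr0 subr0.
  by rewrite !big_ord_recr /= IH; ring.
have u0 : 0 <= u 0%N by have /andP[] := hu 0%N.
have un0 : 0 <= u n by have /andP[] := hu n.
have h1 : `|\sum_(j < n) (u j.+1 - u j) * \sum_(i < j.+1) v i| <= B * u n.
  apply: le_trans (ler_norm_sum _ _ _) _.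
  apply: (@le_trans _ _ (\sum_(j < n) (u j.+1 - u j) * B)).
    apply: ler_sum => j _; have := hu j => /andP[uj0 uj1].
    by rewrite normrM ger0_norm ?subr_ge0// ler_wpM2l// subr_ge0.
  rewrite -mulr_suml mulrC ler_wpM2l//.
  have -> : \sum_(j < n) (u j.+1 - u j) = u n - u 0%N.
    elim: n {un0} => [|n IH]; first by rewrite big_ord0 subrr.
    by rewrite big_ord_recr /= IH; ring.
  by lra.
apply: le_trans (ler_normB _ _) _.
have h2 : `|u n * (\sum_(j < n) v j)| <= B * u n.
  by rewrite normrM (ger0_norm un0) mulrC ler_wpM2r.
by lra.
Qed.

Lemma exprS_diff_bounds (x : R) k : 0 <= x ->
  k.+1%:R * x ^+ k <= (x + 1) ^+ k.+1 - x ^+ k.+1 <= k.+1%:R * (x + 1) ^+ k.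
Proof.
move=> x0; rewrite subrXX addrAC subrr add0r mul1r.
have bnd i : (i < k.+1)%N -> x ^+ k <= (x + 1) ^+ (k.+1.-1 - i) * x ^+ i <= (x + 1) ^+ k.
  move=> ik; rewrite /= -{1 4}(@subnK i k)// !exprD; apply/andP; split.
    by rewrite ler_wpM2r ?exprn_ge0// lerXn2r ?nnegrE//; lra.
  by rewrite ler_wpM2l ?exprn_ge0// ?lerXn2r ?nnegrE//; lra.
have cE (y : R) : k.+1%:R * y = \sum_(i < k.+1) y by rewrite sumr_const card_ord mulr_natl.
by rewrite !cE; apply/andP; split; apply: ler_sum => i _; have /andP[] := bnd i (ltn_ord i).
Qed.

Lemma power_sum n k :
  `|\sum_(j < n) j%:R ^+ k - n%:R ^+ k.+1 / k.+1%:R| <= n%:R ^+ k :> R.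
Proof.
have k0 : 0 < k.+1%:R :> R by rewrite ltr0n.
have h1 : \sum_(j < n) j%:R ^+ k <= n%:R ^+ k.+1 / k.+1%:R :> R.
  rewrite ler_pdivlMr//; elim: n => [|n IH]; first by rewrite big_ord0 mul0r exprn_ge0.
  rewrite big_ord_recr /= mulrDl (_ : n.+1%:R = n%:R + 1 :> R); last by rewrite natr1.
  by have /andP[] := @exprS_diff_bounds n%:R k (ler0n _ _); lra.
have h2 : n%:R ^+ k.+1 / k.+1%:R <= \sum_(j < n) j.+1%:R ^+ k :> R.
  rewrite ler_pdivrMr//; elim: n {h1} => [|n IH]; first by rewrite big_ord0 mul0r expr0n.
  rewrite big_ord_recr /= mulrDl (_ : n.+1%:R = n%:R + 1 :> R); last by rewrite natr1.
  by have /andP[] := @exprS_diff_bounds n%:R k (ler0n _ _); lra.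
have h3 : \sum_(j < n) j.+1%:R ^+ k <= \sum_(j < n) j%:R ^+ k + n%:R ^+ k :> R.
  have -> : \sum_(j < n) j%:R ^+ k + n%:R ^+ k = \sum_(j < n.+1) j%:R ^+ k :> R.
    by rewrite big_ord_recr.
  by rewrite big_ord_recl /= lerDr exprn_ge0.
move: (n%:R ^+ k.+1 / k.+1%:R) h1 h2 => q h1 h2.
by rewrite ler_norml; lra.
Qed.

End Sums.

Section ChebyshevAsymptotics.
Context {R : realType}.
Notation T := (@cheb R).
Context (s0 : R) (s00 : 0 < s0) (s01 : s0 <= 1).

(** Multiplication by 2 sin t makes the sum of cos(2 j t) telescope; away from the end points sin t
    >= s0. *)
Lemma sum_cos_even (x : R) m : s0 <= 1 - x ^+ 2 -> `|\sum_(j < m) (T j.*2).[x]| <= 1 / s0.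
Proof.
move=> sx; have x1 := itv_of_sqr s00 sx.
have xE : cos (acos x) = x by apply: acosK; rewrite in_itv.
set t := acos x in xE.
have sn : s0 <= sin t.
  have sE : sin t ^+ 2 = 1 - x ^+ 2 by rewrite sin2cos2 xE.
  have s0' : 0 <= sin t by apply: sin_ge0_pi; rewrite acos_ge0// acos_lepi.
  by nra.
have key : sin t * (2 * \sum_(j < m) (T j.*2).[x]) = sin t - sin (t - 2 * m%:R * t).
  elim: m => [|m IH]; first by rewrite big_ord0 !mulr0 mul0r subr0 subrr.
  rewrite big_ord_recr /= mulrDr mulrDr IH -{1}xE cheb_cos -mul2n natrM.
  have -> : t - 2 * m.+1%:R * t = - t - 2 * m%:R * t by rewrite -natr1; ring.
  rewrite sinB [in X in _ = X]sinB sinN cosN.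
  by ring.
have : `|sin t * (2 * \sum_(j < m) (T j.*2).[x])| <= 2.
  rewrite key; apply: le_trans (ler_normB _ _) _.
  by have := sin_max t; have := sin_max (t - 2 * m%:R * t); lra.
have sn0 : 0 <= sin t := le_trans (ltW s00) sn.
rewrite normrM normrM (ger0_norm sn0).
rewrite ger0_norm// => h; rewrite ler_pdivlMr//.
have := normr_ge0 (\sum_(j < m) (T j.*2).[x]); nra.
Qed.

Lemma sum_sin_even (x : R) m : s0 <= 1 - x ^+ 2 ->
  `|\sum_(j < m) sin (j.*2%:R * acos x)| <= 1 / s0.
Proof.
move=> sx; have x1 := itv_of_sqr s00 sx.
have xE : cos (acos x) = x by apply: acosK; rewrite in_itv.
set t := acos x in xE *.
have sn : s0 <= sin t.
  have sE : sin t ^+ 2 = 1 - x ^+ 2 by rewrite sin2cos2 xE.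
  have s0' : 0 <= sin t by apply: sin_ge0_pi; rewrite acos_ge0// acos_lepi.
  by nra.
have key : sin t * (2 * \sum_(j < m) sin (j.*2%:R * t)) = cos t - cos (t - 2 * m%:R * t).
  elim: m => [|m IH]; first by rewrite big_ord0 !mulr0 mul0r subr0 subrr.
  rewrite big_ord_recr /= mulrDr mulrDr IH -mul2n natrM.
  have -> : t - 2 * m.+1%:R * t = - t - 2 * m%:R * t by rewrite -natr1; ring.
  rewrite cosB [in X in _ = X]cosB sinN cosN.
  by ring.
have : `|sin t * (2 * \sum_(j < m) sin (j.*2%:R * t))| <= 2.
  rewrite key; apply: le_trans (ler_normB _ _) _.
  by have := cos_max t; have := cos_max (t - 2 * m%:R * t); lra.
have sn0 : 0 <= sin t := le_trans (ltW s00) sn.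
rewrite normrM normrM (ger0_norm sn0).
rewrite ger0_norm// => h; rewrite ler_pdivlMr//.
have := normr_ge0 (\sum_(j < m) sin (j.*2%:R * t)); nra.
Qed.

(** Iterating [cheb_ode] lowers the order of differentiation by 2 at a time, down to 0 or 1
    according to parity; the discarded terms are one order smaller in n. *)
Lemma cheb_derivn_asymp k : exists2 B : R, 0 <= B & forall n x, (0 < n)%N ->
  s0 <= 1 - x ^+ 2 ->
  `|(T n)^`(k).[x] * (1 - x ^+ 2) ^+ k./2 -
    (-1) ^+ k./2 * n%:R ^+ (k./2).*2 * (T n)^`(odd k).[x]| <= B * n%:R ^+ k / n%:R.
Proof.
elim/cheb_ind2: k => [||k [B B0 hB] _].
- by exists 0 => // n x n0 sx; rewrite !mulr1 !mul1r subrr normr0 !mul0r.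
- by exists 0 => // n x n0 sx; rewrite !mulr1 !mul1r subrr normr0 !mul0r.
set C := 4 / s0; have C0 : 0 <= C by rewrite divr_ge0// ltW.
exists (B + (2 * k%:R + 1) * C ^+ k.+1 + k%:R ^+ 2 * C ^+ k).
  apply: addr_ge0; first apply: addr_ge0 => //; apply: mulr_ge0; rewrite ?exprn_ge0//.
move=> n x n0 sx; have x1 := itv_of_sqr s00 sx.
have n1 : 1 <= n%:R :> R by rewrite ler1n.
have nn0 : n%:R != 0 :> R by rewrite pnatr_eq0 -lt0n.
have xn : `|x| <= 1 by rewrite ler_norml; lra.
have := congr1 (horner^~ x) (cheb_ode n k).
rewrite hornerM !(hornerD, hornerN, hornerXn, hornerC, hornerZ, hornerM, hornerX) => ode.
have d1 := @cheb_derivn_bound R s0 x n k.+1 s00 s01 sx.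
have d0 := @cheb_derivn_bound R s0 x n k s00 s01 sx.
have := hB n x n0 sx.
rewrite /= negbK doubleS.
set l := k./2; set q := (T n)^`(_).[x]; set r := (T n)^`(odd k).[x].
set S := 1 - x ^+ 2 in ode *.
have k0 : 0 <= k%:R :> R by [].
have c10 : 0 <= 2 * k%:R + 1 :> R by lra.
move: (2 * k%:R + 1) c10 ode => c1 c10 ode.
rewrite -/C in d0 d1; clearbody C; set N : R := n%:R in n1 nn0 ode d0 d1 *.
set q1 := (T n)^`(k.+1).[x] in d1 ode *; set q2 := (T n)^`(k.+2).[x] in ode *.
rewrite -/q in d0 ode.
move=> h.
have -> : q2 * S ^+ l.+1 - (-1) ^+ l.+1 * N ^+ (l.*2).+2 * r =
   - N ^+ 2 * (q * S ^+ l - (-1) ^+ l * N ^+ l.*2 * r) +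
   S ^+ l * (c1 * (x * q1) + k%:R ^+ 2 * q).
  have -> : q2 * S ^+ l.+1 = S ^+ l * (S * q2) by rewrite exprS; ring.
  by rewrite ode !exprS; ring.
apply: le_trans (ler_normD _ _) _.
rewrite normrM normrN (ger0_norm (sqr_ge0 _)).
have S1 : `|S ^+ l| <= 1.
  rewrite normrX exprn_ile1// ger0_norm ?/S; nra.
have g1 : N ^+ 2 * `|q * S ^+ l - (-1) ^+ l * N ^+ l.*2 * r| <= B * N ^+ k.+2 / N.
  apply: le_trans (ler_wpM2l (sqr_ge0 N) h) _.
  by rewrite !exprS le_eqVlt; apply/orP; left; apply/eqP; field.
have N0 : 0 <= N by lra.
have g2 : `|S ^+ l * (c1 * (x * q1) + k%:R ^+ 2 * q)| <=
    (c1 * C ^+ k.+1 + k%:R ^+ 2 * C ^+ k) * N ^+ k.+2 / N.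
  rewrite normrM -[leRHS]mul1r; apply: ler_pM => //.
  apply: le_trans (ler_normD _ _) _.
  rewrite -mulrA mulrDl; apply: lerD.
    rewrite !normrM (ger0_norm c10).
    rewrite -mulrA ler_wpM2l//.
    have -> : C ^+ k.+1 * (N ^+ k.+2 / N) = 1 * (C * N) ^+ k.+1.
      by rewrite (exprSr N k.+1) mulfK// exprMn mul1r.
    by apply: ler_pM.
  rewrite normrM (ger0_norm (sqr_ge0 _)) -[leRHS]mulrA ler_wpM2l ?sqr_ge0//.
  apply: le_trans d0 _; rewrite exprMn ler_wpM2l ?exprn_ge0//.
  rewrite ler_pdivlMr; last by lra.
  by rewrite -exprSr [leRHS]exprS ler_peMl// exprn_ge0.
by rewrite !mulrDl in g2 *; lra.
Qed.

(** The reciprocal of the integral of T_j^2 against the arcsine measure. *)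
Definition chebw (j : nat) : R := if j == 0%N then 1 else 2.

Definition Lker n x : {poly R} := \sum_(j < n) (chebw j * (T j).[x]) *: T j.

Lemma sin_acos_ge (x : R) : s0 <= 1 - x ^+ 2 -> s0 <= sin (acos x).
Proof.
move=> sx; have x1 := itv_of_sqr s00 sx.
have xE : cos (acos x) = x by apply: acosK; rewrite in_itv.
set t := acos x in xE *.
have sE : sin t ^+ 2 = 1 - x ^+ 2 by rewrite sin2cos2 xE.
have s0' : 0 <= sin t by apply: sin_ge0_pi; rewrite acos_ge0// acos_lepi.
by nra.
Qed.

Lemma cheb_derivn_asymp_le k : exists2 B : R, 0 <= B & forall n j x, (j < n)%N ->
  s0 <= 1 - x ^+ 2 ->
  `|(T j)^`(k).[x] * (1 - x ^+ 2) ^+ k./2 -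
    (-1) ^+ k./2 * j%:R ^+ (k./2).*2 * (T j)^`(odd k).[x]| <= B * n%:R ^+ k / n%:R.
Proof.
have [B B0 hB] := cheb_derivn_asymp k; exists B => // n j x jn sx.
have rhs0 : 0 <= B * n%:R ^+ k / n%:R by rewrite divr_ge0// mulr_ge0// exprn_ge0.
have n0 : 0 < n%:R :> R by rewrite ltr0n; apply: leq_ltn_trans jn.
case: k hB rhs0 => [|k] hB rhs0.
  by rewrite (_ : _ - _ = 0) ?normr0//= ?derivn0 ?expr0; ring.
case: j jn => [|j] jn; last first.
  apply: le_trans (hB j.+1 x _ sx) _ => //.
  have e2 (y : R) : y != 0 -> B * y ^+ k.+1 / y = B * y ^+ k.
    by move=> y0; rewrite exprSr mulrA mulfK.
  have j0 : j.+1%:R != 0 :> R by rewrite pnatr_eq0.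
  have nn0 : n%:R != 0 :> R by rewrite gt_eqF.
  rewrite (e2 _ j0) (e2 _ nn0) ler_wpM2l//.
  by rewrite lerXn2r ?nnegrE// ler_nat ltnW.
have z (m : nat) : (T 0)^`(m.+1) = 0 by rewrite derivn_poly0// size_cheb.
rewrite z horner0 mul0r sub0r normrN.
case: (boolP (odd k.+1)) => ok; first by rewrite z horner0 mulr0 normr0.
by rewrite even_halfK// expr0n /= mulr0 mul0r normr0.
Qed.

(** For even k, 2 T_j^2 = 1 + T_(2j) leaves a power sum, which gives the main term, plus an
    oscillating sum. For odd k, T_j T_j' is a multiple of sin(2 j t) and only oscillation remains.
    [abel_sum] bounds the oscillating sums by O(n^k). *)
Lemma Lker_derivn k : exists2 B : R, 0 <= B & forall n x, (0 < n)%N ->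
  s0 <= 1 - x ^+ 2 ->
  `|(Lker n x)^`(k).[x] * (1 - x ^+ 2) ^+ k./2 -
   (if odd k then 0 else (-1) ^+ k./2 * n%:R ^+ k.+1 / k.+1%:R)| <= B * n%:R ^+ k.
Proof.
have [B B0 hB] := cheb_derivn_asymp_le k.
have i0 : 0 <= 1 / s0 by rewrite divr_ge0// ltW.
exists (2 * B + (2 + 2 * (1 / s0) * (1 / s0) + 2 * (1 / s0))).
  by move: i0; move: (1 / s0) => s1 s10; nra.
move=> n x n0 sx; have x1 := itv_of_sqr s00 sx.
have nR : 0 < n%:R :> R by rewrite ltr0n.
set l := k./2; set S := 1 - x ^+ 2.
have w2 j : 0 <= chebw j <= 2 by rewrite /chebw; case: ifP => _; lra.
pose e j := (T j)^`(k).[x] * S ^+ l - (-1) ^+ l * j%:R ^+ l.*2 * (T j)^`(odd k).[x].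
have LE : (Lker n x)^`(k).[x] * S ^+ l =
   (-1) ^+ l * (\sum_(j < n) chebw j * (T j).[x] * (j%:R ^+ l.*2 * (T j)^`(odd k).[x])) +
   \sum_(j < n) chebw j * (T j).[x] * e j.
  rewrite /Lker linear_sum horner_sum mulr_suml mulr_sumr -big_split /=.
  by apply: eq_bigr => j _; rewrite linearZ hornerZ /e; ring.
have nk0 : 0 <= n%:R ^+ k :> R by rewrite exprn_ge0.
have eB : `|\sum_(j < n) chebw j * (T j).[x] * e j| <= 2 * B * n%:R ^+ k.
  apply: le_trans (ler_norm_sum _ _ _) _.
  apply: (@le_trans _ _ (\sum_(j < n) 2 * (B * n%:R ^+ k / n%:R))).
    apply: ler_sum => j _; rewrite 2!normrM; apply: ler_pM; [by rewrite mulr_ge0|by []| |exact: hB].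
    rewrite -[leRHS]mulr1; apply: ler_pM => //; last exact: cheb_le1.
    by have /andP[w0 ww] := w2 j; rewrite ger0_norm.
  rewrite sumr_const card_ord -mulr_natr le_eqVlt; apply/orP; left; apply/eqP.
  by field; rewrite gt_eqF.
set Z := \sum_(j < n) _ in LE.
have ZB : `|Z - (if odd k then 0 else n%:R ^+ k.+1 / k.+1%:R)| <=
    (2 + 2 * (1 / s0) * (1 / s0) + 2 * (1 / s0)) * n%:R ^+ k.
  have mono j : (0 : R) <= (j%:R : R) ^+ k <= (j.+1%:R : R) ^+ k.
    by rewrite exprn_ge0//= lerXn2r ?nnegrE// ler_nat.
  case: (boolP (odd k)) => ok; last first.
    have kE : l.*2 = k by rewrite /l even_halfK.
    (* The last sum corrects the term j = 0, whose weight is 1 instead of 2. *)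
    have ZE : Z = \sum_(j < n) j%:R ^+ k + \sum_(j < n) j%:R ^+ k * (T j.*2).[x] -
        \sum_(j < n) (if (j == 0 :> nat)%N then j%:R ^+ k else 0).
      rewrite -big_split /= -sumrB; apply: eq_bigr => j _.
      have tt : 2 * ((T j).[x] * (T j).[x]) = (T j.*2).[x] + 1.
        have := congr1 (horner^~ x) (@chebM R j j (leqnn j)).
        by rewrite subnn addnn !hornerM hornerD !hornerC.
      rewrite kE (negbTE ok) derivn0 /chebw; case: (altP (nat_of_ord j =P 0%N)) => [-> |_].
        by rewrite double0 !hornerC; ring.
      by rewrite subr0; transitivity (j%:R ^+ k * (2 * ((T j).[x] * (T j).[x]))); [ring|rewrite tt; ring].
    have h0 : `|\sum_(j < n) (if (j == 0 :> nat)%N then j%:R ^+ k else 0)| <= n%:R ^+ k :> R.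
      rewrite -(prednK n0) big_ord_recl /= big1 ?addr0//.
      by rewrite ger0_norm ?exprn_ge0// lerXn2r ?nnegrE// ler_nat.
    have h1 := @power_sum R n k.
    have h2 := @abel_sum R (fun j => j%:R ^+ k) (fun j => (T j.*2).[x]) _ n mono
        (fun m => sum_cos_even m sx).
    rewrite ZE.
    set P := \sum_(_ < _) _ in h1 *; set Q := \sum_(_ < _) _ in h2 *.
    set W := \sum_(_ < _) _ in h0 *; set V := n%:R ^+ k.+1 / _ in h1 *.
    have -> : P + Q - W - V = (P - V) + Q - W by ring.
    apply: le_trans (ler_normB _ _) _; apply: le_trans (lerD (ler_normD _ _) h0) _.
    have := mulr_ge0 (mulr_ge0 i0 i0) nk0.
    by move: h1 h2; rewrite !mulrDl; move: (1 / s0) => s1; lra.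
  have kE : (l.*2).+1 = k by rewrite /l -[in RHS](odd_double_half k) ok.
  have tE : cos (acos x) = x by apply: acosK; rewrite in_itv.
  have sn := sin_acos_ge sx; set t := acos x in tE sn.
  have sn0 : 0 < sin t := lt_le_trans s00 sn.
  have ZE : Z = (\sum_(j < n) j%:R ^+ k * sin (j.*2%:R * t)) / sin t.
    rewrite mulr_suml; apply: eq_bigr => j _.
    rewrite ok derivn1 -{1 2}tE -kE.
    have ds := deriv_cheb_sin j t.
    have -> : (T j)^`().[cos t] = j%:R * sin (j%:R * t) / sin t.
      by rewrite -ds mulfK// gt_eqF.
    rewrite cheb_cos.
    have -> : j.*2%:R * t = j%:R * t + j%:R * t by rewrite -addnn natrD mulrDl.
    rewrite sinD exprS /chebw; case: (altP (nat_of_ord j =P 0%N)) => [->|_].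
      by rewrite !(mulr0, mul0r).
    by field; rewrite gt_eqF.
  have h2 := @abel_sum R (fun j => j%:R ^+ k) (fun j => sin (j.*2%:R * t)) _ n mono
        (fun m => sum_sin_even m sx).
  rewrite subr0 ZE normrM normfV (ger0_norm (ltW sn0)).
  have si : (sin t)^-1 <= 1 / s0 by rewrite div1r lef_pV2 ?posrE.
  have si0 : 0 <= (sin t)^-1 by rewrite invr_ge0 ltW.
  apply: le_trans (ler_pM _ si0 h2 si) _ => //.
  have := mulr_ge0 i0 nk0; move: nk0; move: (1 / s0) (n%:R ^+ k : R) => s1 y y0 sy.
  by lra.
rewrite LE.
have -> : (if odd k then 0 else (-1) ^+ l * n%:R ^+ k.+1 / k.+1%:R) =
    (-1) ^+ l * (if odd k then 0 else n%:R ^+ k.+1 / k.+1%:R) :> R.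
  by case: ifP => _; rewrite ?mulr0// mulrA.
rewrite addrAC -mulrBr; apply: le_trans (ler_normD _ _) _.
have -> (D : R) : `|(-1) ^+ l * D| = `|D| by rewrite normrM normrX normrN1 expr1n mul1r.
by rewrite [leRHS]mulrDl addrC; exact: lerD.
Qed.

End ChebyshevAsymptotics.

Lemma sumr_cst_ord {R : realType} n (c : R) : \sum_(i < n) c = c * n%:R.
Proof. by rewrite sumr_const card_ord mulr_natr. Qed.

(** * The Chebyshev kernel *)

Section ChebyshevKernel.
Context {R : realType}.
Notation T := (@cheb R).
Notation Lam := (@Lam R).
Notation cw := (@chebw R).
Let hL := @posfun_Lam R.

Definition chebn j : {poly R} := Num.sqrt (cw j) *: T j.

Lemma chebw_ge0 j : 0 <= cw j.
Proof. by rewrite /chebw; case: ifP. Qed.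

Lemma chebw_le2 j : cw j <= 2.
Proof. by rewrite /chebw; case: ifP => _ //; rewrite ler1n. Qed.

Lemma sqrt_chebw j : Num.sqrt (cw j) * Num.sqrt (cw j) = cw j.
Proof. by rewrite -expr2 sqr_sqrtr// chebw_ge0. Qed.

Lemma Lam_chebM_lt i j : (i < j)%N -> pint Lam (T i * T j) = 0.
Proof.
move=> ij; have : pint Lam (2%:P * (T i * T j)) = 0.
  rewrite chebM ?(ltnW ij)// (pintD hL) !Lam_cheb.
  by rewrite !gtn_eqF ?addr0// ?subn_gt0// addn_gt0 (leq_ltn_trans _ ij).
by rewrite mul_polyC (pintZ hL) => /eqP; rewrite mulf_eq0 pnatr_eq0 /= => /eqP.
Qed.

Lemma Lam_cheb_sqr j : cw j * pint Lam (T j * T j) = 1.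
Proof.
have : pint Lam (2%:P * (T j * T j)) = (j == 0)%N%:R + 1.
  by rewrite chebM// (pintD hL) !Lam_cheb subnn addnn double_eq0.
rewrite mul_polyC (pintZ hL) /chebw; case: (j == 0)%N => /=; last by rewrite add0r.
by rewrite mul1r; lra.
Qed.

Lemma on_chebn : onpolys Lam chebn.
Proof.
split=> [n|n m].
  rewrite size_scale ?size_cheb// sqrtr_eq0 -ltNge /chebw.
  by case: ifP.
rewrite -scalerAl -scalerAr !(pintZ hL); case: (ltngtP n m) => [nm|mn|->].
- by rewrite Lam_chebM_lt// !mulr0.
- by rewrite mulrC [T n * _]mulrC Lam_chebM_lt// !(mulr0, mul0r).
- by rewrite mulrA sqrt_chebw Lam_cheb_sqr.
Qed.

Lemma LkerE n x : Lker n x = kpoly chebn n x.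
Proof.
apply: eq_bigr => j _; rewrite /chebn hornerZ scalerA; congr (_ *: _).
by rewrite mulrAC sqrt_chebw.
Qed.

Lemma size_Lker n (x : R) : (size (Lker n x) <= n)%N.
Proof. by rewrite LkerE (size_kpoly on_chebn). Qed.

Lemma Lker_hornerE n (x t : R) : (Lker n x).[t] = \sum_(j < n) cw j * (T j).[x] * (T j).[t].
Proof. by rewrite horner_sum; apply: eq_bigr => j _; rewrite hornerZ. Qed.

Lemma LkerC n (x t : R) : (Lker n x).[t] = (Lker n t).[x].
Proof. by rewrite !LkerE (kpolyC). Qed.

Lemma Lker_repr n (q : {poly R}) (x : R) : (size q <= n)%N -> pint Lam (q * Lker n x) = q.[x].
Proof. by move=> sq; rewrite LkerE (reproducing hL on_chebn). Qed.

Lemma Lker_diag_le n (x : R) : -1 <= x <= 1 -> 0 <= (Lker n x).[x] <= 2 * n%:R.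
Proof.
move=> x1; rewrite Lker_hornerE; apply/andP; split.
  apply: sumr_ge0 => j _; rewrite -mulrA -expr2 mulr_ge0 ?chebw_ge0//; exact: sqr_ge0.
apply: (@le_trans _ _ (\sum_(j < n) 2)).
  apply: ler_sum => j _; rewrite -mulrA -expr2 -[leRHS]mulr1.
  apply: ler_pM; [exact: chebw_ge0|exact: sqr_ge0|exact: chebw_le2|].
  by rewrite -real_normK ?num_real// expr_le1// cheb_le1.
by rewrite sumr_const card_ord mulr_natr.
Qed.

Lemma Lker_sqr n (x : R) : pint Lam (Lker n x ^+ 2) = (Lker n x).[x].
Proof. by rewrite expr2 Lker_repr// size_Lker. Qed.

(** The integral is T_i(t) for i < n and 0 otherwise. *)
Lemma Lam_cheb_Lker n i (t : R) : -1 <= t <= 1 -> `|pint Lam (T i * Lker n t)| <= 1.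
Proof.
move=> t1; have [ni|ni] := leqP n i; last first.
  by rewrite Lker_repr ?size_cheb// cheb_le1.
rewrite /Lker mulr_sumr (pint_sum hL) big1 ?normr0// => j _.
rewrite -scalerAr (pintZ hL) mulrC [T i * _]mulrC Lam_chebM_lt ?mul0r//.
exact: leq_trans ni.
Qed.

Lemma Lam_chebM_Lker n i j (t : R) : -1 <= t <= 1 -> `|pint Lam (T i * T j * Lker n t)| <= 1.
Proof.
move=> t1; wlog ij : i j / (i <= j)%N.
  by move=> H; have [|/ltnW] := leqP i j; [exact: H|rewrite [T i * _]mulrC; exact: H].
have : 2 * pint Lam (T i * T j * Lker n t) =
    pint Lam (T (j + i)%N * Lker n t) + pint Lam (T (j - i)%N * Lker n t).
  by rewrite -(pintZ hL) -mul_polyC mulrA chebM// mulrDl (pintD hL).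
have := Lam_cheb_Lker n (j + i) t1; have := Lam_cheb_Lker n (j - i) t1.
rewrite !ler_norml; lra.
Qed.

(** One factor L_n is expanded in the T_j. The other reproduces T_k T_j as soon as j + k < n, so at
    most k indices contribute, each at most 2 from the weight times 2 from two values bounded by
    1. *)
Lemma cheb_Lker_sqr n k (t : R) : -1 <= t <= 1 ->
  `|pint Lam (T k * Lker n t ^+ 2) - (T k).[t] * (Lker n t).[t]| <= 4 * k%:R.
Proof.
move=> t1.
have -> : pint Lam (T k * Lker n t ^+ 2) =
    \sum_(j < n) cw j * (T j).[t] * pint Lam (T k * T j * Lker n t).
  rewrite expr2 mulrA mulrC {1}/Lker mulr_suml (pint_sum hL).
  apply: eq_bigr => j _; rewrite -scalerAl (pintZ hL); congr (_ * pint _ _).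
  by rewrite mulrA [T j * _]mulrC.
rewrite Lker_hornerE mulr_sumr -sumrB.
apply: le_trans (ler_norm_sum _ _ _) _.
apply: (@le_trans _ _ (\sum_(j < n) (if (n <= j + k)%N then 4 else 0))).
  apply: ler_sum => j _.
  have -> : cw j * (T j).[t] * pint Lam (T k * T j * Lker n t) -
      (T k).[t] * (cw j * (T j).[t] * (T j).[t]) =
      (cw j * (T j).[t]) * (pint Lam (T k * T j * Lker n t) - (T k * T j).[t]).
    by rewrite hornerM; ring.
  case: leqP => jk; last first.
    rewrite Lker_repr ?subrr ?mulr0 ?normr0//.
    apply: leq_trans (size_polyMleq _ _) _.
    by rewrite !size_cheb addSn addnS /= addnC.
  rewrite normrM (_ : 4 = 2 * 2); last by ring.
  apply: ler_pM => //.
    rewrite normrM (ger0_norm (chebw_ge0 j)) -[leRHS]mulr1; apply: ler_pM => //.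
    - exact: chebw_ge0.
    - exact: chebw_le2.
    - exact: cheb_le1.
  apply: le_trans (ler_normB _ _) _; rewrite (_ : 2 = 1 + 1); last by ring.
  apply: lerD; first exact: Lam_chebM_Lker.
  rewrite hornerM normrM -[leRHS]mul1r.
  by apply: ler_pM => //; exact: cheb_le1.
have [kn|nk] := leqP k n; last first.
  apply: (@le_trans _ _ (\sum_(j < n) 4)).
    by apply: ler_sum => j _; case: ifP.
  by rewrite sumr_cst_ord ler_wpM2l// ler_nat ltnW.
have [m nE] : exists m, n = (m + k)%N by exists (n - k)%N; rewrite subnK.
rewrite nE big_split_ord /= big1 ?add0r; last first.
  by move=> i _; rewrite leq_add2r leqNgt ltn_ord.
apply: (@le_trans _ _ (\sum_(j < k) 4)).
  by apply: ler_sum => j _; case: ifP.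
by rewrite sumr_cst_ord.
Qed.

End ChebyshevKernel.

(** * Approximate identity, and weak convergence to the arcsine measure *)

Section FejerMeans.
Context {R : realType}.
Notation T := (@cheb R).
Notation Lam := (@Lam R).
Let hL := @posfun_Lam R.

Lemma poly_Lker_sqr (q : {poly R}) : exists2 C : R, 0 <= C & forall n t, -1 <= t <= 1 ->
  `|pint Lam (q * Lker n t ^+ 2) - q.[t] * (Lker n t).[t]| <= C.
Proof.
have qE := on_expand hL (@on_chebn R) (leqnn (size q)).
pose a i := pint Lam (q * chebn i) * Num.sqrt (chebw i).
have qE' : q = \sum_(i < size q) a i *: T i.
  by rewrite {1}qE; apply: eq_bigr => i _; rewrite scalerA.
exists (\sum_(i < size q) `|a i| * (4 * i%:R)).
  by apply: sumr_ge0 => i _; rewrite !mulr_ge0.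
move=> n t t1; rewrite {1 2}qE' mulr_suml (pint_sum hL) horner_sum mulr_suml -sumrB.
apply: le_trans (ler_norm_sum _ _ _) _; apply: ler_sum => i _.
rewrite -scalerAl (pintZ hL) hornerZ -mulrA -mulrBr normrM ler_wpM2l//.
exact: cheb_Lker_sqr.
Qed.

(** For polynomials the error is O(1 / n) by [poly_Lker_sqr]. The squared kernel is nonnegative with
    total integral L_n(t, t) <= 2 n, so uniform approximation extends this to continuous v. *)
Lemma fejer_mean (v : R -> R) (e : R) : continuous v -> 0 < e ->
  \forall n \near \oo, forall t, -1 <= t <= 1 ->
  `|Lam (fun x => v x * (Lker n t).[x] ^+ 2) / n%:R - v t * ((Lker n t).[t] / n%:R)| <= e.
Proof.
move=> cv e0; have e8 : 0 < e / 8 by lra.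
have n11 : (-1 : R) < 1 by lra.
have [q hq] := weierstrass cv n11 e8.
have [C C0 hC] := poly_Lker_sqr q.
near=> n => t t1.
have n0 : (0 < n)%N by near: n; exact: nbhs_infty_gt.
have nR : 0 < n%:R :> R by rewrite ltr0n.
have Cn : C / (e / 8) <= n%:R by near: n; exact: nbhs_infty_ger.
have cL : continuous (fun x => (Lker n t).[x] ^+ 2).
  by under eq_fun do rewrite -horner_exp; exact: cont_poly.
have /andP[L0 L1] := Lker_diag_le n t1.
set L := (Lker n t).[t] in L0 L1 *.
have h1 : `|Lam (fun x => v x * (Lker n t).[x] ^+ 2) - pint Lam (q * Lker n t ^+ 2)| <= e / 8 * L.
  have -> : pint Lam (q * Lker n t ^+ 2) = Lam (fun x => q.[x] * (Lker n t).[x] ^+ 2).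
    by rewrite /pint; congr Lam; apply/funext => x; rewrite hornerM horner_exp.
  have cq : continuous (fun x => q.[x] * (Lker n t).[x] ^+ 2).
    by apply: contM => //; exact: cont_poly.
  rewrite -(posfunB hL (contM cv cL) cq).
  rewrite /L -Lker_sqr -(pintZ hL).
  apply: (posfun_norm hL).
  - by apply: contB; apply: contM => //; exact: cont_poly.
  - exact: cont_poly.
  move=> x x1; rewrite -mulrBl normrM hornerZ horner_exp (ger0_norm (sqr_ge0 _)).
  by rewrite ler_wpM2r ?sqr_ge0// hq.
have h2 := hC n t t1; rewrite -/L in h2.
have h3 : `|q.[t] * L - v t * L| <= e / 8 * L.
  by rewrite -mulrBl normrM (ger0_norm L0) ler_wpM2r// distrC hq.
have -> : Lam (fun x => v x * (Lker n t).[x] ^+ 2) / n%:R - v t * (L / n%:R) =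
   ((Lam (fun x => v x * (Lker n t).[x] ^+ 2) - pint Lam (q * Lker n t ^+ 2)) +
   (pint Lam (q * Lker n t ^+ 2) - q.[t] * L) + (q.[t] * L - v t * L)) / n%:R.
  by field; rewrite gt_eqF.
rewrite normrM normfV (ger0_norm (ltW nR)) ler_pdivrMr//.
apply: le_trans (ler_normD _ _) _; apply: le_trans (lerD (ler_normD _ _) (lexx _)) _.
have C8 : C <= n%:R * (e / 8) by rewrite -ler_pdivrMr.
have eL : e / 8 * L <= e / 8 * (2 * n%:R) by rewrite ler_wpM2l// ltW.
by lra.
Unshelve. all: by end_near. Qed.

Lemma Lker_diag_cvg (s0 e : R) : 0 < s0 -> s0 <= 1 -> 0 < e ->
  \forall n \near \oo, forall x, s0 <= 1 - x ^+ 2 -> `|(Lker n x).[x] / n%:R - 1| <= e.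
Proof.
move=> s00 s01 e0; have [B B0 hB] := Lker_derivn s00 s01 0.
near=> n => x sx.
have n0 : (0 < n)%N by near: n; exact: nbhs_infty_gt.
have nR : 0 < n%:R :> R by rewrite ltr0n.
have Bn : B / e <= n%:R by near: n; exact: nbhs_infty_ger.
have := hB n x n0 sx; rewrite /= !expr0 !mulr1 mul1r expr1 divr1 => h.
have -> : (Lker n x).[x] / n%:R - 1 = ((Lker n x).[x] - n%:R) / n%:R.
  by field; rewrite gt_eqF.
rewrite normrM normfV (ger0_norm (ltW nR)) ler_pdivrMr//.
by apply: le_trans h _; rewrite mulrC -ler_pdivrMr.
Unshelve. all: by end_near. Qed.

End FejerMeans.

Section CesaroContinuous.
Context {R : realType} (l : (R -> R) -> R) (hl : posfun l).
Context (p : nat -> {poly R}) (hp : onpolys l p).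
Context (lp : forall n, 0 < lead_coef (p n)).
Context (hreg : forall d : R, 0 < d ->
  \forall n \near \oo, lead_coef (p n) <= (2 + d) ^+ n).
Notation Lam := (@Lam R).
Let hL := @posfun_Lam R.
Let op : forall n m, pint l (p n * p m) = (n == m)%:R := hp.2.

Lemma cesaro_poly (q : {poly R}) (e : R) : 0 < e ->
  \forall n \near \oo, `|\sum_(m < n) pint l (q * p m ^+ 2) - pint Lam q * n%:R| <= e * n%:R.
Proof.
move=> e0; have qE := on_expand hL (@on_chebn R) (leqnn (size q)).
pose a i := pint Lam (q * chebn i) * Num.sqrt (chebw i).
have qE' : q = \sum_(i < size q) a i *: cheb i.
  by rewrite {1}qE; apply: eq_bigr => i _; rewrite scalerA.
set A := \sum_(i < size q) `|a i|.
have A0 : 0 <= A by apply: sumr_ge0.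
have d0 : 0 < e / (A + 1) by rewrite divr_gt0//; lra.
have H : forall N, \forall n \near \oo, forall i, (i < N)%N ->
   `|\sum_(m < n) pint l (cheb i * p m ^+ 2) - (i == 0)%N%:R * n%:R| <= e / (A + 1) * n%:R.
  elim=> [|N IH]; first by near=> n.
  have [N0|N0] := posnP N.
    near=> n => i; rewrite N0 ltnS leqn0 => /eqP ->.
    rewrite (eq_bigr (fun=> 1)); last by move=> j _; rewrite mul1r expr2 op eqxx.
    by rewrite sumr_const card_ord mul1r subrr normr0 mulr_ge0// ltW.
  have HN := cesaro_cheb hl hp lp hreg N0 d0.
  near=> n => i; rewrite ltnS leq_eqVlt => /predU1P[->|iN].
    by rewrite gtn_eqF// mul0r subr0; near: n; exact: HN.
  have : forall i, (i < N)%N ->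
   `|\sum_(m < n) pint l (cheb i * p m ^+ 2) - (i == 0)%N%:R * n%:R| <= e / (A + 1) * n%:R.
    by near: n; exact: IH.
  exact.
have Hs := H (size q).
near=> n.
have h : forall i, (i < size q)%N ->
   `|\sum_(m < n) pint l (cheb i * p m ^+ 2) - (i == 0)%N%:R * n%:R| <= e / (A + 1) * n%:R.
  by near: n; exact: Hs.
have -> : \sum_(m < n) pint l (q * p m ^+ 2) =
    \sum_(i < size q) a i * \sum_(m < n) pint l (cheb i * p m ^+ 2).
  under [RHS]eq_bigr do rewrite mulr_sumr.
  rewrite exchange_big /=; apply: eq_bigr => m _.
  rewrite {1}qE' mulr_suml (pint_sum hl); apply: eq_bigr => i _.
  by rewrite -scalerAl (pintZ hl).
have -> : pint Lam q = \sum_(i < size q) a i * (i == 0 :> nat)%:R.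
  rewrite {1}qE' (pint_sum hL); apply: eq_bigr => i _.
  by rewrite (pintZ hL) Lam_cheb.
rewrite mulr_suml -sumrB; apply: le_trans (ler_norm_sum _ _ _) _.
apply: (@le_trans _ _ (\sum_(i < size q) `|a i| * (e / (A + 1) * n%:R))).
  apply: ler_sum => i _; rewrite -mulrA -mulrBr normrM ler_wpM2l//.
  exact: h.
rewrite -mulr_suml -/A mulrA ler_wpM2r// mulrA ler_pdivrMr; last by lra.
by rewrite mulrC ler_pM2l//; lra.
Unshelve. all: by end_near. Qed.

(** Polynomials suffice by uniform approximation, since K_n(x, x) dmu / n has total mass 1. *)
Lemma cesaro_cont (f : R -> R) (e : R) : continuous f -> 0 < e ->
  \forall n \near \oo,
  `|l (fun x => f x * (kpoly p n x).[x]) / n%:R - Lam f| <= e.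
Proof.
move=> cf e0; have e4 : 0 < e / 4 by lra.
have n11 : (-1 : R) < 1 by lra.
have [q hq] := weierstrass cf n11 e4.
have Hq := cesaro_poly q e4.
near=> n.
have n0 : (0 < n)%N by near: n; exact: nbhs_infty_gt.
have nR : 0 < n%:R :> R by rewrite ltr0n.
have hn : `|\sum_(m < n) pint l (q * p m ^+ 2) - pint Lam q * n%:R| <= e / 4 * n%:R.
  by near: n; exact: Hq.
have cpp m : continuous (fun x => (p m).[x] ^+ 2).
  by under eq_fun do rewrite -horner_exp; exact: cont_poly.
have -> : l (fun x => f x * (kpoly p n x).[x]) = \sum_(m < n) l (fun x => f x * (p m).[x] ^+ 2).
  rewrite -(posfun_sum hl); last by move=> m _; exact: contM.
  congr l; apply/funext => x; rewrite kpolyE mulr_sumr.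
  by apply: eq_bigr => m _; rewrite expr2.
have h1 : `|\sum_(m < n) l (fun x => f x * (p m).[x] ^+ 2) - \sum_(m < n) pint l (q * p m ^+ 2)|
    <= e / 4 * n%:R.
  rewrite -sumrB; apply: le_trans (ler_norm_sum _ _ _) _.
  apply: (@le_trans _ _ (\sum_(m < n) e / 4)); last first.
    by rewrite sumr_cst_ord.
  apply: ler_sum => m _.
  have -> : pint l (q * p m ^+ 2) = l (fun x => q.[x] * (p m).[x] ^+ 2).
    by rewrite /pint; congr l; apply/funext => x; rewrite hornerM horner_exp.
  have cq : continuous (fun x => q.[x] * (p m).[x] ^+ 2).
    by apply: contM => //; exact: cont_poly.
  rewrite -(posfunB hl (contM cf (cpp m)) cq).
  have -> : e / 4 = pint l ((e / 4) *: p m ^+ 2) by rewrite (pintZ hl) expr2 op eqxx mulr1.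
  apply: (posfun_norm hl).
  - by apply: contB; apply: contM => //; exact: cont_poly.
  - exact: cont_poly.
  move=> x x1; rewrite -mulrBl normrM hornerZ horner_exp (ger0_norm (sqr_ge0 _)).
  by rewrite ler_wpM2r ?sqr_ge0// hq.
have h2 : `|pint Lam q - Lam f| <= e / 4.
  rewrite /pint -(posfunB hL)//; last exact: cont_poly.
  have -> : e / 4 = Lam (fun x => e / 4 * (cheb 0).[x]).
    have := @Lam_cheb R 0; rewrite /pint => L1.
    by rewrite (posfunZ hL _ (@cont_poly R (cheb 0))) L1 mulr1.
  apply: (posfun_norm hL).
  - by apply: contB => //; exact: cont_poly.
  - by apply: contZ; exact: cont_poly.
  by move=> x x1; rewrite hornerC mulr1 distrC hq.
set A := \sum_(m < n) _ in h1 *; set B := \sum_(m < n) _ in h1 hn.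
have -> : A / n%:R - Lam f = ((A - B) + (B - pint Lam q * n%:R)) / n%:R + (pint Lam q - Lam f).
  by field; rewrite gt_eqF.
apply: le_trans (ler_normD _ _) _.
rewrite normrM normfV (ger0_norm (ltW nR)).
have : `|(A - B) + (B - pint Lam q * n%:R)| / n%:R <= e / 2.
  rewrite ler_pdivrMr//; apply: le_trans (ler_normD _ _) _; lra.
by lra.
Unshelve. all: by end_near. Qed.

End CesaroContinuous.

(** * Bernstein type inequalities *)

Section SecondKind.
Context {R : realType}.
Notation T := (@cheb R).
Notation Lam := (@Lam R).
Notation leb := (@lebesgue_measure R).
Let hL := @posfun_Lam R.

(* Integration against (2 / pi) sqrt(1 - x^2) dx. *)
Definition ellU (f : R -> R) : R := Lam (fun x => 2 * (1 - x ^+ 2) * f x).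

Lemma cont_wU : continuous (fun x : R => 2 * (1 - x ^+ 2)).
Proof.
have -> : (fun x : R => 2 * (1 - x ^+ 2)) = (fun x => (2 *: (1 - 'X ^+ 2)).[x]).
  by apply/funext => x; rewrite hornerZ hornerD hornerN hornerXn hornerC.
exact: cont_poly.
Qed.

Lemma posfun_ellU : posfun ellU.
Proof.
split=> [a f g cf cg|f cf f0].
  have c1 := contM cont_wU cf; have c2 := contM cont_wU cg.
  rewrite /ellU -(posfunP hL a c1 c2).
  by congr Lam; apply/funext => x; ring.
apply: (posfun_ge0 hL); first by apply: contM => //; exact: cont_wU.
by move=> x x1; rewrite mulr_ge0 ?f0// mulr_ge0//; nra.
Qed.

(** The Chebyshev polynomial of the second kind, sin((j+1) t) / sin t at x = cos t. Defined through
    T', it inherits derivative bounds from [cheb_derivn_bound]. *)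
Definition chebU j : {poly R} := j.+1%:R^-1 *: (T j.+1)^`().

Lemma chebU_sin j (t : R) : (chebU j).[cos t] * sin t = sin (j.+1%:R * t).
Proof. by rewrite hornerZ -mulrA deriv_cheb_sin mulKf// pnatr_eq0. Qed.

Lemma chebU_mul i j (x : R) : (j <= i)%N -> -1 <= x <= 1 ->
  2 * (1 - x ^+ 2) * ((chebU i).[x] * (chebU j).[x]) = (T (i - j)).[x] - (T (i + j).+2).[x].
Proof.
move=> ji x1; have <- : cos (acos x) = x by apply: acosK; rewrite in_itv.
set t := acos x; rewrite !cheb_cos -sin2cos2.
transitivity (2 * (((chebU i).[cos t] * sin t) * ((chebU j).[cos t] * sin t))); first by ring.
rewrite !chebU_sin natrB//.
have -> : (i%:R - j%:R) * t = i.+1%:R * t - j.+1%:R * t by rewrite -!natr1; ring.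
have -> : (i + j).+2%:R * t = i.+1%:R * t + j.+1%:R * t.
  by rewrite -addnS -addSn natrD mulrDl.
by rewrite cosB cosD; ring.
Qed.

Lemma ellU_chebU i j : (j <= i)%N -> pint ellU (chebU i * chebU j) = (i == j)%:R.
Proof.
move=> ji; rewrite /pint /ellU.
have -> : Lam (fun x => 2 * (1 - x ^+ 2) * (chebU i * chebU j).[x]) =
          pint Lam (T (i - j) - T (i + j).+2).
  apply: (posfun_eq hL).
  - by apply: contM; [exact: cont_wU|exact: cont_poly].
  - exact: cont_poly.
  by move=> x x1; rewrite hornerM chebU_mul// hornerD hornerN.
by rewrite (pintB hL) !Lam_cheb subr0 subn_eq0 eqn_leq ji andbT.
Qed.

Lemma size_chebU n : size (chebU n) = n.+1.
Proof.
rewrite size_scale ?invr_eq0 ?pnatr_eq0//; apply/eqP; rewrite eqn_leq; apply/andP; split.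
  by rewrite -ltnS -[X in (_ < X)%N](@size_cheb R n.+1) lt_size_deriv// -size_poly_eq0 size_cheb.
rewrite ltnNge; apply/negP => h.
have : (T n.+1)^`()`_n = 0 by rewrite nth_default.
rewrite coef_deriv => /eqP; rewrite mulrn_eq0 /=; apply/negP.
have : lead_coef (T n.+1) != 0 by rewrite lead_coef_eq0 -size_poly_eq0 size_cheb.
by rewrite lead_coefE size_cheb.
Qed.

Lemma on_chebU : onpolys ellU chebU.
Proof.
split=> [|i j]; first exact: size_chebU.
have [ij|/ltnW ji] := leqP i j; last exact: ellU_chebU.
by rewrite mulrC eq_sym ellU_chebU.
Qed.

Lemma chebU_derivn_bound (s0 x : R) n k j : 0 < s0 -> s0 <= 1 -> s0 <= 1 - x ^+ 2 ->
  (j < n)%N -> `|(chebU j)^`(k).[x]| <= 4 / s0 * (4 / s0 * n%:R) ^+ k.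
Proof.
move=> s00 s01 sx jn; have C0 : 0 <= 4 / s0 by rewrite divr_ge0// ltW.
rewrite /chebU linearZ hornerZ /= -derivSn normrM normfV normr_nat.
have h := @cheb_derivn_bound R s0 x j.+1 k.+1 s00 s01 sx.
have j0 : 0 < j.+1%:R :> R by rewrite ltr0n.
rewrite mulrC ler_pdivrMr//; apply: le_trans h _.
move: C0; move: (4 / s0) => C C0.
rewrite exprS (_ : C * (C * n%:R) ^+ k * j.+1%:R = C * j.+1%:R * (C * n%:R) ^+ k); last by ring.
apply: ler_wpM2l; first by rewrite mulr_ge0.
by apply: lerXn2r; rewrite ?nnegrE ?mulr_ge0// ler_wpM2l// ler_nat.
Qed.

Lemma poly_derivn_bound1 (s0 x : R) (P : {poly R}) n k : 0 < s0 -> s0 <= 1 ->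
  s0 <= 1 - x ^+ 2 -> (size P <= n)%N ->
  P^`(k).[x] ^+ 2 <= pint ellU (P ^+ 2) * ((4 / s0) ^+ (k.*2).+2 * n%:R ^+ (k.*2).+1).
Proof.
move=> s00 s01 sx sP; apply: le_trans (on_eval_sqr posfun_ellU on_chebU x k sP) _.
rewrite ler_wpM2l ?(pint_sqr_ge0 posfun_ellU)//.
have C0 : 0 <= 4 / s0 by rewrite divr_ge0// ltW.
apply: (@le_trans _ _ (\sum_(j < n) (4 / s0 * (4 / s0 * n%:R) ^+ k) ^+ 2)).
  apply: ler_sum => j _; rewrite -real_normK ?num_real// lerXn2r ?nnegrE//.
    by apply: (mulr_ge0 C0); apply: exprn_ge0; exact: mulr_ge0.
  exact: chebU_derivn_bound.
rewrite sumr_cst_ord le_eqVlt; apply/orP; left; apply/eqP.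
rewrite !exprS expr0 -muln2 !exprM !exprMn; move: (4 / s0) (n%:R : R) => a N; ring.
Qed.

Lemma derivn_comp_aff (P : {poly R}) (m h : R) k :
  (P \Po (h *: 'X + m%:P))^`(k) = h ^+ k *: (P^`(k) \Po (h *: 'X + m%:P)).
Proof.
elim: k => [|k IH]; first by rewrite expr0 scale1r.
rewrite derivnS IH derivZ deriv_comp -derivnS derivD derivZ derivX derivC addr0.
by rewrite -scalerAr scalerA mulr1 exprSr.
Qed.

(* The weight of [ellU], transplanted to [c, d], is bounded by a constant: this converts bounds in terms of
   [ellU] into bounds in terms of Lebesgue measure on [c, d]. *)
Lemma ellU_comp_le (P : {poly R}) (c d : R) : c < d ->
  pint ellU ((P \Po (((d - c) / 2) *: 'X + ((c + d) / 2)%:P)) ^+ 2) <=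
  4 / (pi * (d - c)) * \int[leb]_(x in `[c, d]) (P ^+ 2).[x].
Proof.
move=> cd; set m := (c + d) / 2; set h := (d - c) / 2.
have h0 : 0 < h by rewrite /h; lra.
have := @int_cos_subst R m h (fun x => (P ^+ 2).[x]) h0 (@cont_poly R _).
have -> : m - h = c by rewrite /m /h; lra.
have -> : m + h = d by rewrite /m /h; lra.
move=> ->.
rewrite /pint /ellU LamE.
have ci (f : R -> R) : continuous f -> leb.-integrable `[0, pi] (EFin \o f).
  move=> cf; apply: continuous_compact_integrable; first exact: segment_compact.
  exact: continuous_subspaceT.
have p0 := @pi_gt0 R.
have cG : continuous (fun t : R => (P ^+ 2).[m + h * cos t] * (h * sin t)).
  apply: contM.
    apply: (cont_comp (f := fun t : R => m + h * cos t)); last exact: cont_poly.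
    by apply: contD; [exact: cont_cst|apply: contZ => x; exact: continuous_cos].
  by apply: contZ => x; exact: continuous_sin.
rewrite -RintegralZl//; last exact: ci.
apply: le_Rintegral => //.
- apply: (ci (fun x => 2 * (1 - cos x ^+ 2) * ((P \Po (h *: 'X + m%:P)) ^+ 2).[cos x] * pi^-1)).
  apply: contM; last exact: cont_cst.
  apply: (cont_comp (f := @cos R) (g := fun x => 2 * (1 - x ^+ 2) * _.[x])).
    by move=> x; exact: continuous_cos.
  by apply: contM; [exact: cont_wU|exact: cont_poly].
- by apply: (ci (fun x => 4 / (pi * (d - c)) * _)); exact: contZ.
move=> t /=; rewrite in_itv /= => t01.
have s0 : 0 <= sin t by exact: sin_ge0_pi.
have s1 : sin t ^+ 2 <= sin t by rewrite expr2 ler_piMr// sin_le1.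
rewrite -sin2cos2 !horner_exp horner_comp hornerD hornerZ hornerX hornerC addrC.
set q := P.[_] ^+ 2; have q0 : 0 <= q by exact: sqr_ge0.
have -> : 4 / (pi * (d - c)) * (q * (h * sin t)) = 2 * sin t * q * pi^-1.
  by rewrite /h; field; rewrite !gt_eqF//; lra.
rewrite ler_wpM2r//; first by rewrite invr_ge0 ltW.
by rewrite ler_wpM2r// ler_wpM2l.
Qed.

(** An L^2 Bernstein inequality inside the interval: each derivative costs C n, and passing from the
    L^2 norm to a point value costs the square root of n. *)
Lemma poly_derivn_bound (c d c1 d1 : R) : c < c1 -> c1 <= d1 -> d1 < d ->
  exists A C : R, [/\ 0 < A, 0 < C & forall (P : {poly R}) n k x, (size P <= n)%N ->
    c1 <= x <= d1 ->
    P^`(k).[x] ^+ 2 <= A * C ^+ k.*2 * n%:R ^+ (k.*2).+1 * \int[leb]_(x in `[c, d]) (P ^+ 2).[x]].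
Proof.
move=> cc1 cd1 dd1; have cd : c < d by lra.
set m := (c + d) / 2; set h := (d - c) / 2.
have h0 : 0 < h by rewrite /h; lra.
(* The distance of [c1, d1] from the end points once [c, d] is rescaled to [-1, 1]; |y| <= 1 - e
   gives 1 - y^2 >= e. *)
pose e := Num.min ((c1 - c) / h) ((d - d1) / h).
have e0 : 0 < e by rewrite lt_min !divr_gt0//; lra.
pose s0 := Num.min 1 e.
have s00 : 0 < s0 by rewrite lt_min ltr01.
have s01 : s0 <= 1 by rewrite ge_min lexx.
have p0 := @pi_gt0 R.
have C0 : 0 < 4 / s0 by rewrite divr_gt0.
exists (4 / (pi * (d - c)) * (4 / s0) ^+ 2), (4 / s0 / h); split.
- by rewrite mulr_gt0 ?exprn_gt0// divr_gt0// mulr_gt0//; lra.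
- by rewrite divr_gt0.
move=> P n k x sP xcd; set y := (x - m) / h.
have xE : x = h * y + m by rewrite /y; field; rewrite gt_eqF.
have sy : s0 <= 1 - y ^+ 2.
  have e1 : e * h <= c1 - c by rewrite -ler_pdivlMr// ge_min lexx.
  have e2 : e * h <= d - d1 by rewrite -ler_pdivlMr// ge_min lexx orbT.
  have y1 : -1 + e <= y by rewrite ler_pdivlMr// mulrDl mulN1r /m /h in e1 e2 *; lra.
  have y2 : y <= 1 - e by rewrite ler_pdivrMr// mulrBl mul1r /m /h in e1 e2 *; lra.
  have se : s0 <= e by rewrite ge_min lexx orbT.
  have e3 : e <= 1 by lra.
  apply: le_trans se _; move: y1 y2 e0 e3; clearbody e; clear; move=> y1 y2 e0 e3; nra.
set Q := P \Po (h *: 'X + m%:P).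
have sh : size (h *: 'X + m%:P) = 2.
  by rewrite size_addl size_scale ?gt_eqF// ?size_polyX// size_polyC; case: (m != 0).
have sQ : (size Q <= n)%N by rewrite /Q size_comp_poly2.
have := poly_derivn_bound1 k s00 s01 sy sQ.
rewrite /Q derivn_comp_aff hornerZ horner_comp hornerD hornerZ hornerX hornerC -xE exprMn => H.
have hk : 0 < (h ^+ k) ^+ 2 by rewrite !exprn_gt0.
rewrite -(ler_pM2l hk); apply: le_trans H _.
apply: (@le_trans _ _ (4 / (pi * (d - c)) * \int[leb]_(x in `[c, d]) (P ^+ 2).[x] *
   ((4 / s0) ^+ (k.*2).+2 * n%:R ^+ (k.*2).+1))).
  apply: ler_wpM2r; first by rewrite mulr_ge0// exprn_ge0// ltW.
  exact: ellU_comp_le.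
rewrite le_eqVlt; apply/orP; left; apply/eqP.
have hz : h != 0 by rewrite gt_eqF.
have hkz : h ^+ k.*2 != 0 by rewrite expf_neq0.
rewrite -exprM muln2 (exprMn k.*2 (4 / s0)) exprVn 2!(exprS (4 / s0)) (expr2 (4 / s0)).
move: (4 / s0) (Rintegral _ _ _) (n%:R ^+ _) (4 / (pi * (d - c))) => a I N b.
move: (a ^+ k.*2) hkz; move: (h ^+ k.*2) => u v uz; by field.
Qed.

End SecondKind.

(** Used pointwise under the integral, with t small and fixed, to turn L^2 bounds into L^1
    bounds. *)
Lemma ler_addXdiv (R : realFieldType) (t z : R) : 0 < t -> z <= t + z ^+ 2 / t.
Proof.
move=> t0; rewrite -(ler_pM2r t0) mulrDl divfK ?gt_eqF//.
by have := sqr_ge0 (z - t); have := sqr_ge0 z; have := sqr_ge0 t; nra.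
Qed.

(** Here y is the length of an interval, possibly 0; the 1 in the denominator avoids a case
    distinction. *)
Lemma ler_frac1D (R : realFieldType) (e k y : R) : 0 <= e -> 0 < k -> 0 <= y ->
  e / (k * (1 + y)) * y <= e / k.
Proof.
move=> e0 k0 y0; have y1 : 0 < 1 + y by lra.
rewrite invfM mulrA -mulrA ler_piMr ?divr_ge0 ?(ltW k0)// mulrC ler_pdivrMr//.
by rewrite mul1r lerDr.
Qed.

(** * Integrals over segments *)

Section SegmentIntegral.
Context {R : realType}.
Notation leb := (@lebesgue_measure R).
Implicit Types (a b : R) (f g : R -> R).

Definition intg a b f := leb.-integrable `[a, b] (EFin \o f).

Definition sint a b f : R := \int[leb]_(x in `[a, b]) f x.

Lemma intg_cont a b f : continuous f -> intg a b f.
Proof.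
move=> cf; apply: continuous_compact_integrable; first exact: segment_compact.
exact: continuous_subspaceT.
Qed.

Lemma intgD a b f g : intg a b f -> intg a b g -> intg a b (fun x => f x + g x).
Proof. by move=> If Ig; exact: (integrableD _ If Ig). Qed.

Lemma intgZ a b k f : intg a b f -> intg a b (fun x => k * f x).
Proof. by move=> If; exact: (integrableZl _ k If). Qed.

Lemma intgB a b f g : intg a b f -> intg a b g -> intg a b (fun x => f x - g x).
Proof. by move=> If Ig; exact: (integrableB _ If Ig). Qed.

Lemma intg_norm a b f : intg a b f -> intg a b (fun x => `|f x|).
Proof. by move=> If; exact: (integrable_norm If). Qed.

Lemma intgM a b f (h : R -> R) (M : R) : measurable_fun setT h ->
  (forall x, a <= x <= b -> `|h x| <= M) -> intg a b f -> intg a b (fun x => f x * h x).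
Proof.
move=> mh hM If; apply: (integrableMl _ If) => //.
  exact: measurable_funS mh.
exists M; split; first exact: num_real.
move=> N MN x /=; rewrite in_itv /= => xab.
exact: le_trans (hM _ xab) (ltW MN).
Qed.

Lemma intg_bounded a b (h : R -> R) (M : R) : measurable_fun setT h ->
  (forall x, a <= x <= b -> `|h x| <= M) -> intg a b h.
Proof.
move=> mh hM; have := intgM mh hM (intg_cont a b (cont_cst 1)).
by congr (_.-integrable _ _); apply/funext => x /=; rewrite mul1r.
Qed.

Lemma intgM_cont a b f h : continuous h -> intg a b f -> intg a b (fun x => f x * h x).
Proof.
move=> ch; have [M _ hM] := cont_bounded a b ch.
exact: (intgM (continuous_measurable_fun ch) hM).
Qed.

Lemma intgS a b a' b' f : a <= a' -> b' <= b -> intg a b f -> intg a' b' f.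
Proof.
move=> aa bb; apply: integrableS => //; apply/subitvP.
by rewrite subitvE /Order.le /= aa bb.
Qed.

Lemma sintD a b f g : intg a b f -> intg a b g ->
  sint a b (fun x => f x + g x) = sint a b f + sint a b g.
Proof. by move=> If Ig; rewrite /sint RintegralD. Qed.

Lemma sintB a b f g : intg a b f -> intg a b g ->
  sint a b (fun x => f x - g x) = sint a b f - sint a b g.
Proof. by move=> If Ig; rewrite /sint RintegralB. Qed.

Lemma sintZ a b k f : intg a b f -> sint a b (fun x => k * f x) = k * sint a b f.
Proof. by move=> If; rewrite /sint RintegralZl. Qed.

Lemma sint_cst a b k : a <= b -> sint a b (fun=> k) = k * (b - a).
Proof.
move=> ab; rewrite /sint Rintegral_cst//= lebesgue_measure_itv /= lte_fin.
by move: ab; rewrite le_eqVlt => /predU1P[->|->]; rewrite ?ltxx ?subrr.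
Qed.

Lemma sint_le a b f g : intg a b f -> intg a b g ->
  (forall x, a <= x <= b -> f x <= g x) -> sint a b f <= sint a b g.
Proof.
move=> If Ig fg; apply: le_Rintegral => // x /=; rewrite in_itv /=; exact: fg.
Qed.

Lemma sint_eq a b f g : (forall x, a <= x <= b -> f x = g x) -> sint a b f = sint a b g.
Proof. by move=> fg; apply: eq_Rintegral => x; rewrite inE /= in_itv /=; exact: fg. Qed.

Lemma sint_sub a b a' b' f : a <= a' -> b' <= b -> intg a b f ->
  (forall x, a <= x <= b -> 0 <= f x) -> sint a' b' f <= sint a b f.
Proof.
move=> aa bb If f0; have If' := intgS aa bb If.
apply: fine_le; [exact: integrable_fin_num|exact: integrable_fin_num|].
apply: ge0_subset_integral => //.
- by case/integrableP: If.
by apply/subitvP; rewrite subitvE /Order.le /= aa bb.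
Qed.

Lemma intg_sum a b (I : Type) (r : seq I) (F : I -> R -> R) :
  (forall i, intg a b (F i)) -> intg a b (fun x => \sum_(i <- r) F i x).
Proof.
move=> IF; elim: r => [|i r IH].
  by under [X in intg _ _ X]eq_fun do rewrite big_nil; exact: (intg_cont _ _ (cont_cst 0)).
by under [X in intg _ _ X]eq_fun do rewrite big_cons; exact: intgD.
Qed.

Lemma sint_sum a b (I : Type) (r : seq I) (F : I -> R -> R) :
  (forall i, intg a b (F i)) ->
  sint a b (fun x => \sum_(i <- r) F i x) = \sum_(i <- r) sint a b (F i).
Proof.
move=> IF; elim: r => [|i r IH].
  rewrite big_nil; under [X in sint _ _ X]eq_fun do rewrite big_nil.
  by rewrite /sint /Rintegral integral0.
rewrite big_cons -IH; under [X in sint _ _ X]eq_fun do rewrite big_cons.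
by rewrite sintD//; exact: intg_sum.
Qed.

End SegmentIntegral.

Section ArcWeight.
Context {R : realType}.
Notation Lam := (@Lam R).

Definition arcw (x : R) : R := Num.sqrt (1 - x ^+ 2).

Lemma cont_arcw : continuous arcw.
Proof.
have c1 : continuous (fun x : R => 1 - x ^+ 2).
  have -> : (fun x : R => 1 - x ^+ 2) = (fun x => (1 - 'X ^+ 2).[x]).
    by apply/funext => x; rewrite hornerD hornerN hornerXn hornerC.
  exact: cont_poly.
exact: (cont_comp c1 (@sqrt_continuous R)).
Qed.

Lemma arcw_ge0 x : 0 <= arcw x.
Proof. exact: sqrtr_ge0. Qed.

Lemma arcw_le1 x : arcw x <= 1.
Proof. by rewrite -[leRHS](@sqrtr1 R) ler_wsqrtr// lerBlDr lerDl sqr_ge0. Qed.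

Lemma arcw_sqr x : -1 <= x <= 1 -> arcw x ^+ 2 = 1 - x ^+ 2.
Proof. by move=> x1; rewrite sqr_sqrtr// subr_ge0; nra. Qed.

Lemma Lam_arcw (f : R -> R) : continuous f ->
  Lam (fun x => pi * arcw x * f x) = sint (-1) 1 f.
Proof.
move=> cf; have := @int_cos_subst R 0 1 f ltr01 cf.
rewrite sub0r add0r -/(sint (-1) 1 f) => ->.
apply: eq_Rintegral => t; rewrite inE /= in_itv /= => t01.
rewrite /arcw -sin2cos2 sqrtr_sqr ger0_norm ?sin_ge0_pi//.
have p0 : (pi : R) != 0 by rewrite gt_eqF ?pi_gt0.
by rewrite mulrC !mulrA mulVf// add0r !mul1r mulr1 mulrC.
Qed.

Lemma Lam_arcw_supp (f : R -> R) (c d : R) : -1 < c -> c <= d -> d < 1 -> continuous f ->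
  (forall x, ~~ (c <= x <= d) -> f x = 0) ->
  Lam (fun x => pi * arcw x * f x) = sint c d f.
Proof.
move=> c1 cd d1 cf f0; rewrite Lam_arcw// /sint /Rintegral; congr fine.
rewrite [RHS]integral_mkcond [LHS]integral_mkcond; apply: eq_integral => x _.
rewrite /patch !mem_setE !in_itv /=; case: (boolP (c <= x <= d)) => [xcd|nx]; last by rewrite (f0 x nx) if_same.
by rewrite ifT//; move/andP: xcd => [? ?]; apply/andP; split; lra.
Qed.

End ArcWeight.

(** * Comparison of the kernels in mean square *)

Section KernelDiagonals.
Context {R : realType}.
Notation T := (@cheb R).
Notation cw := (@chebw R).
Notation Lam := (@Lam R).
Implicit Types (l : (R -> R) -> R) (p : nat -> {poly R}).

Definition kdiag p n (x : R) : R := (kpoly p n x).[x] / n%:R.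
Definition ldiag n (x : R) : R := (Lker n x).[x] / n%:R.
Definition lnorm l n (x : R) : R := pint l (Lker n x ^+ 2) / n%:R.

Lemma cont_kdiag p n : continuous (kdiag p n).
Proof.
apply: contM; last exact: cont_cst.
have -> : (fun x => (kpoly p n x).[x]) = (fun x => \sum_(i < n) (p i).[x] * (p i).[x]).
  by apply/funext => x; rewrite kpolyE.
by apply: cont_sum => i _; apply: contM; exact: cont_poly.
Qed.

Lemma kdiag_ge0 p n x : 0 <= kdiag p n x.
Proof. by rewrite /kdiag kpolyE divr_ge0// sumr_ge0// => i _; rewrite -expr2 sqr_ge0. Qed.

Lemma cont_ldiag n : continuous (ldiag n).
Proof.
have -> : ldiag n = kdiag (@chebn R) n by apply/funext => x; rewrite /ldiag LkerE.
exact: cont_kdiag.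
Qed.

(** L_n(x, t)^2 is the sum over pairs of lf(x) lh(t), a kernel of finite rank as [posfun_swap]
    requires. *)
Definition lf n (ij : 'I_n * 'I_n) (x : R) : R :=
  cw ij.1 * cw ij.2 * ((T ij.1).[x] * (T ij.2).[x]).
Definition lh n (ij : 'I_n * 'I_n) (t : R) : R := (T ij.1).[t] * (T ij.2).[t].

Lemma cont_lf n (ij : 'I_n * 'I_n) : continuous (lf ij).
Proof. by apply: contZ; apply: contM; exact: cont_poly. Qed.

Lemma cont_lh n (ij : 'I_n * 'I_n) : continuous (lh ij).
Proof. by apply: contM; exact: cont_poly. Qed.

Lemma Lker_sqr_sum n (x t : R) :
  (Lker n x ^+ 2).[t] = \sum_(ij <- index_enum ('I_n * 'I_n)%type) lf ij x * lh ij t.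
Proof.
rewrite horner_exp Lker_hornerE expr2 big_distrlr /= pair_bigA /=.
by apply: eq_bigr => -[i j] _; rewrite /lf /lh /=; ring.
Qed.

Lemma pint_Lker_sqr_sum l n (x : R) : posfun l -> pint l (Lker n x ^+ 2) =
  \sum_(ij <- index_enum ('I_n * 'I_n)%type) lf ij x * l (lh ij).
Proof.
move=> hl; rewrite /pint; under [X in l X]eq_fun do rewrite Lker_sqr_sum.
rewrite (posfun_sum hl) => [|ij _]; last by apply: contZ; exact: cont_lh.
by apply: eq_bigr => ij _; rewrite (posfunZ hl)//; exact: cont_lh.
Qed.

Lemma cont_lnorm l n : posfun l -> continuous (lnorm l n).
Proof.
move=> hl; apply: contM; last exact: cont_cst.
under eq_fun do rewrite (pint_Lker_sqr_sum _ _ hl).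
by apply: cont_sum => ij _; apply: contM; [exact: cont_lf|exact: cont_cst].
Qed.

(** Exchanging the order lets L_n^2 / n act as an approximate identity in x against the continuous
    v, whatever the functional l' in t is. *)
Lemma lnorm_swap l l' n (v : R -> R) : posfun l -> posfun l' -> continuous v ->
  l (fun x => v x * lnorm l' n x) =
  l' (fun t => l (fun x => v x * (Lker n t).[x] ^+ 2) / n%:R).
Proof.
move=> hl hl' cv.
pose F (ij : 'I_n * 'I_n) (x : R) := n%:R^-1 * (v x * lf ij x).
have cF ij : continuous (F ij) by apply: contZ; apply: contM => //; exact: cont_lf.
have := posfun_swap (index_enum ('I_n * 'I_n)%type) hl hl' cF (@cont_lh n).
have -> : (fun x => l' (fun t => \sum_(ij <- index_enum ('I_n * 'I_n)%type) F ij x * lh ij t)) =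
          (fun x => v x * lnorm l' n x).
  apply/funext => x; rewrite (posfun_sum hl') => [|ij _]; last by apply: contZ; exact: cont_lh.
  rewrite /lnorm (pint_Lker_sqr_sum _ _ hl') mulrA mulrC mulr_sumr mulr_sumr.
  by apply: eq_bigr => ij _; rewrite (posfunZ hl') /F; [ring|exact: cont_lh].
move=> ->; congr l'; apply/funext => t.
rewrite mulrC -(posfunZ hl); last first.
  by apply: contM => //; under eq_fun do rewrite -horner_exp; exact: cont_poly.
congr l; apply/funext => x; rewrite LkerC -horner_exp Lker_sqr_sum mulr_sumr mulr_sumr.
by apply: eq_bigr => ij _; rewrite /F; ring.
Qed.

Lemma cont_Lker_mean l n (v : R -> R) : posfun l -> continuous v ->
  continuous (fun t => l (fun x => v x * (Lker n t).[x] ^+ 2) / n%:R).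
Proof.
move=> hl cv; apply: contM; last exact: cont_cst.
have -> : (fun t => l (fun x => v x * (Lker n t).[x] ^+ 2)) =
  (fun t => \sum_(ij <- index_enum ('I_n * 'I_n)%type) lf ij t * l (fun x => v x * lh ij x)).
  apply/funext => t.
  have cvh ij : continuous (fun x => v x * @lh n ij x) by apply: contM => //; exact: cont_lh.
  have -> : (fun x => v x * (Lker n t).[x] ^+ 2) =
     (fun x => \sum_(ij <- index_enum ('I_n * 'I_n)%type) lf ij t * (v x * lh ij x)).
    apply/funext => x; rewrite -horner_exp Lker_sqr_sum mulr_sumr.
    by apply: eq_bigr => ij _; ring.
  rewrite (posfun_sum hl) => [|ij _]; last exact: contZ.
  by apply: eq_bigr => ij _; rewrite (posfunZ hl).
by apply: cont_sum => ij _; apply: contM; [exact: cont_lf|exact: cont_cst].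
Qed.

Lemma lnorm_ge0 l n x : posfun l -> 0 <= lnorm l n x.
Proof. by move=> hl; rewrite /lnorm divr_ge0// (pint_sqr_ge0 hl). Qed.

End KernelDiagonals.

(** Here v = pi s, g = 1 / (v w), y is the cutoff, u the continuous density and q = u / w, while k,
    L, N, Ns are kernel diagonals divided by n. Multiplying by v w cancels one g and leaves the
    first term plus y (g N - 2 L); as g N <= L + 2 b + g0 (e + Ns) when L is multiplied by q <= 1 +
    b, and L is within e of 1, this is about -y. *)
Lemma comparison_pointwise (R : realFieldType) (g k L N Ns v y w u q b e g0 : R) :
  N <= v * u * L + e + Ns -> q <= 1 + b -> g * (v * u) = q -> g * (v * w) = 1 ->
  0 < g -> g <= g0 -> 0 <= b -> 0 <= Ns -> 0 <= y -> y <= 1 ->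
  - e <= L - 1 -> L - 1 <= e -> 0 <= L -> L <= 2 -> 0 < e ->
  y * (v * w) * (k - 2 * g * L + g ^+ 2 * N) <=
    w * (v * y * k) + ((e * (1 + g0) - y) + 2 * b + g0 * (y * Ns)).
Proof.
move=> hN hq gv gG gp gl b0 Ns0 y0 y1 L1 L2 L3 L4 e0.
have -> : y * (v * w) * (k - 2 * g * L + g ^+ 2 * N) =
  w * (v * y * k) + (g * (v * w)) * (- 2 * (y * L) + y * (g * N)) by ring.
rewrite gG mul1r lerD2l.
have h1 : g * N <= q * L + g0 * e + g0 * Ns.
  apply: (@le_trans _ _ (g * (v * u * L + e + Ns))); first by rewrite ler_wpM2l// ltW.
  rewrite !mulrDr mulrA gv; rewrite -!addrA lerD2l.
  by apply: lerD; apply: ler_wpM2r => //; exact: ltW.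
have h2 : q * L <= L + 2 * b.
  apply: (@le_trans _ _ ((1 + b) * L)); first by rewrite ler_wpM2r.
  by rewrite mulrDl mul1r lerD2l [2 * b]mulrC ler_wpM2l.
have h3 : y * (g * N) <= y * (L + 2 * b + g0 * e + g0 * Ns).
  by rewrite ler_wpM2l//; apply: le_trans h1 _; rewrite !lerD2r.
have h4 : y * (2 * b) <= 2 * b by rewrite ler_piMl//; lra.
have g00 : 0 <= g0 by exact: le_trans (ltW gp) gl.
have h5 : y * (g0 * e) <= g0 * e by rewrite ler_piMl// mulr_ge0// ltW.
have h6 : y * (1 - L) <= e.
  apply: (@le_trans _ _ (y * e)); first by rewrite ler_wpM2l//; lra.
  by rewrite ler_piMl// ltW.
lra.
Qed.

Section Core.
Context {R : realType} (l : (R -> R) -> R) (hl : posfun l).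
Context (p : nat -> {poly R}) (hp : onpolys l p).
Context (lp : forall n, 0 < lead_coef (p n)).
Context (hreg : forall d : R, 0 < d ->
  \forall n \near \oo, lead_coef (p n) <= (2 + d) ^+ n).
(* [w1] is the density of mu on [c, d], made at least [m] everywhere by changing it on a null set. *)
Context (c d : R) (c_1 : -1 < c) (cd : c < d) (d_1 : d < 1).
Context (m : R) (m0 : 0 < m) (w1 : R -> R) (mw : measurable_fun setT w1).
Context (wm : forall x, m <= w1 x) (iw : intg c d w1).
Context (hI : forall f : R -> R, continuous f -> (forall x, 0 <= f x) ->
  sint c d (fun x => w1 x * f x) <= l f).
Notation Lam := (@Lam R).
Let hL : posfun Lam. Proof. exact: posfun_Lam. Qed.
Let p0 : 0 < (pi : R). Proof. exact: pi_gt0. Qed.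

Definition gfun (x : R) : R := (pi * arcw x * w1 x)^-1.

Definition Efun n x : R :=
  kdiag p n x - 2 * gfun x * ldiag n x + gfun x ^+ 2 * lnorm l n x.

Lemma w1_gt0 x : 0 < w1 x.
Proof. exact: lt_le_trans (wm x). Qed.

Lemma seg_in (x : R) : c <= x <= d -> -1 <= x <= 1.
Proof. by have := (c_1, d_1) => -[? ?] /andP[? ?]; apply/andP; split; lra. Qed.

Lemma arc_lower : exists s0 : R, [/\ 0 < s0, s0 <= 1 &
  forall x : R, c <= x <= d -> s0 <= 1 - x ^+ 2 /\ s0 <= arcw x].
Proof.
have [hc hd hcd] := And3 c_1 d_1 cd.
pose s0 : R := Num.min (1 - c ^+ 2) (1 - d ^+ 2); exists s0.
have s00 : 0 < s0 by rewrite lt_min; apply/andP; split; nra.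
have s01 : s0 <= 1 by rewrite ge_min lerBlDr lerDl sqr_ge0.
split=> // x /andP[cx xd].
have sx : s0 <= 1 - x ^+ 2.
  have [x0|x0] := leP 0 x; rewrite ge_min; apply/orP; [right|left]; nra.
split=> //; have {1}-> : s0 = Num.sqrt (s0 ^+ 2) by rewrite sqrtr_sqr ger0_norm// ltW.
rewrite /arcw ler_wsqrtr//.
by apply: le_trans sx; rewrite expr2 ler_piMr// ltW.
Qed.

Lemma measurable_gfun : measurable_fun setT gfun.
Proof.
have -> : gfun = (fun y => y `^ (-1)) \o (fun x => pi * arcw x * w1 x).
  apply/funext => x /=; rewrite powR_inv1// mulr_ge0 ?(ltW (w1_gt0 _))//.
  by rewrite mulr_ge0 ?arcw_ge0// ltW.
apply: measurableT_comp; first exact: measurable_powR.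
apply: measurable_funM => //; apply: continuous_measurable_fun.
by apply: contZ; exact: cont_arcw.
Qed.

Lemma gfun_bound : exists2 g0 : R, 0 < g0 & forall x, c <= x <= d ->
  [/\ 0 < gfun x, gfun x <= g0 & gfun x * (pi * arcw x * w1 x) = 1].
Proof.
have [s0 [s00 _ hs]] := arc_lower; exists (pi * s0 * m)^-1.
  by rewrite invr_gt0 !mulr_gt0.
move=> x /hs[_ sx]; have G0 : 0 < pi * arcw x * w1 x.
  by rewrite !mulr_gt0 ?w1_gt0//; exact: lt_le_trans sx.
split; rewrite /gfun ?invr_gt0 ?mulVf ?gt_eqF//.
have h1 : 0 <= pi * s0 by rewrite mulr_ge0 ?ltW.
rewrite lef_pV2 ?posrE//; last by rewrite !mulr_gt0.
apply: ler_pM => //; first exact: ltW.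
by rewrite ler_wpM2l// ltW.
Qed.

Lemma sint_sqr_le (P : {poly R}) : m * sint c d (fun x => (P ^+ 2).[x]) <= pint l (P ^+ 2).
Proof.
have cP := @cont_poly R (P ^+ 2); have P0 x : 0 <= (P ^+ 2).[x] by rewrite horner_exp sqr_ge0.
apply: le_trans (hI cP P0); rewrite -sintZ; last exact: intg_cont.
apply: sint_le; [by apply: intgZ; exact: intg_cont|exact: intgM_cont|] => x _.
by rewrite ler_wpM2r.
Qed.

Lemma poly_derivn_pint (c1 d1 : R) : c < c1 -> c1 <= d1 -> d1 < d ->
  exists A C : R, [/\ 0 < A, 0 < C & forall (P : {poly R}) n k x, (size P <= n)%N ->
    c1 <= x <= d1 ->
    P^`(k).[x] ^+ 2 <= A * C ^+ k.*2 * n%:R ^+ (k.*2).+1 * pint l (P ^+ 2)].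
Proof.
move=> cc1 cd1 dd1; have [A [C [A0 C0 h]]] := poly_derivn_bound cc1 cd1 dd1.
exists (A / m), C; split=> //; first exact: divr_gt0.
move=> P n k x sP xcd; apply: le_trans (h P n k x sP xcd) _.
have -> : A / m * C ^+ k.*2 * n%:R ^+ (k.*2).+1 * pint l (P ^+ 2) =
   A * C ^+ k.*2 * n%:R ^+ (k.*2).+1 * (pint l (P ^+ 2) / m).
  by move: (pint _ _) (n%:R ^+ _) (C ^+ _) => x1 x2 x3; field; rewrite gt_eqF.
apply: ler_wpM2l; first by rewrite !mulr_ge0// ?exprn_ge0// ltW.
by rewrite ler_pdivlMr// mulrC; exact: sint_sqr_le.
Qed.

Lemma Efun_pint n x :
  Efun n x = pint l ((kpoly p n x - gfun x *: Lker n x) ^+ 2) / n%:R.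
Proof.
have rep (q : {poly R}) : (size q <= n)%N -> pint l (q * kpoly p n x) = q.[x] by exact: (reproducing hl hp).
rewrite (_ : _ ^+ 2 = (kpoly p n x - gfun x *: Lker n x) * kpoly p n x -
   (gfun x *: (Lker n x * kpoly p n x) - gfun x ^+ 2 *: Lker n x ^+ 2)); last first.
  by rewrite -!mul_polyC polyCM; ring.
rewrite !(pintB hl) !(pintZ hl) !rep ?size_Lker//; last first.
  rewrite (leq_trans (size_polyD _ _))// geq_max (size_kpoly hp) size_polyN.
  by rewrite (leq_trans (size_scale_leq _ _))// size_Lker.
by rewrite hornerD hornerN hornerZ /Efun /kdiag /ldiag /lnorm; ring.
Qed.

Lemma Efun_ge0 n x : 0 <= Efun n x.
Proof. by rewrite Efun_pint divr_ge0// (pint_sqr_ge0 hl). Qed.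

Lemma intg_G f : intg c d f -> intg c d (fun x => f x * gfun x).
Proof.
have [g0 _ hg] := gfun_bound.
apply: (intgM (M := g0)); first exact: measurable_gfun.
by move=> x /hg[gp gl _]; rewrite ger0_norm// ltW.
Qed.

Lemma intg_Efun n (h : R -> R) : continuous h ->
  intg c d (fun x => h x * (pi * arcw x * w1 x) * Efun n x).
Proof.
move=> ch; have cs := cont_arcw; have [g0 _ hg] := gfun_bound.
have ck : continuous (fun x => (h x * (pi * arcw x)) * kdiag p n x).
  by apply: contM; [apply: contM => //; exact: contZ|exact: cont_kdiag].
have cl : continuous (fun x => - 2 * (h x * ldiag n x)).
  by apply: contZ; apply: contM => //; exact: cont_ldiag.
have cn : continuous (fun x => h x * lnorm l n x) by apply: contM => //; exact: cont_lnorm.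
have := intgD (intgM_cont ck iw) (intgD (intg_cont c d cl) (intg_G (intg_cont c d cn))).
apply: eq_integrable => // x; rewrite inE /= in_itv /= => xcd.
have [_ _ gG] := hg x xcd; congr EFin; rewrite /Efun.
move: gG; move: (gfun x) (kdiag p n x) (ldiag n x) (lnorm l n x) (pi * arcw x) (h x) (w1 x).
move=> g k L N v y w gG.
have -> : y * (v * w) * (k - 2 * g * L + g ^+ 2 * N) =
  w * (y * v * k) + (g * (v * w)) * (- 2 * (y * L) + y * N * g) by ring.
by rewrite gG; ring.
Qed.

(* The three terms of [Efun] contribute at most 1, -2 and 1 times the integral of [psi], up to O(e). *)
Lemma Efun_small (M0 : R) : 0 <= M0 ->
  exists2 C1 : R, 0 <= C1 & forall (e : R) (psi wt : R -> R) (ls : (R -> R) -> R),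
  0 < e -> e <= 1 -> continuous psi -> (forall x, 0 <= psi x <= 1) ->
  (forall x, ~~ (c <= x <= d) -> psi x = 0) ->
  continuous wt -> (forall x, 0 <= wt x) -> sint c d (fun x => `|wt x - w1 x|) <= e ->
  posfun ls -> ls psi <= e -> ls (fun=> 1) <= M0 ->
  (forall f : R -> R, continuous f -> (forall x, 0 <= f x) ->
     l f <= Lam (fun x => pi * arcw x * wt x * f x) + ls f) ->
  \forall n \near \oo,
    sint c d (fun x => psi x * (pi * arcw x * w1 x) * Efun n x) <= C1 * e.
Proof.
move=> M00; have [hc hd hcd] := And3 c_1 d_1 cd; have hm := m0; have hp0 := p0.
have [s0 [s00 s01 hs]] := arc_lower; have [g0 g00 hg] := gfun_bound.
(* 1 comes from the limit of the K_n term, (d - c) (1 + g0) from the two approximations involving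
   L_n, 2 / m from the L^1 error of [wt], and g0 (2 pi + M0) from [ls]. *)
exists (1 + (d - c) * (1 + g0) + 2 / m + g0 * (2 * pi + M0)).
  rewrite !addr_ge0//; first by apply: mulr_ge0; lra.
    by rewrite divr_ge0// ltW.
  by apply: mulr_ge0; [exact: ltW|lra].
move=> e psi wt ls e0 e1 cpsi hpsi psi0 cwt wt0 hwt hls lspsi ls1 hlw.
have cs := @cont_arcw R; have cps : continuous (fun x => pi * arcw x * psi x).
  by apply: contM => //; exact: contZ.
have cvw : continuous (fun x => pi * arcw x * wt x) by apply: contM => //; exact: contZ.
near=> n.
have n0 : (0 < n)%N by near: n; exact: nbhs_infty_gt.
have nR : 0 < n%:R :> R by rewrite ltr0n.
have H1 : `|l (fun x => pi * arcw x * psi x * (kpoly p n x).[x]) / n%:R -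
            Lam (fun x => pi * arcw x * psi x)| <= e.
  by near: n; exact: (cesaro_cont hl hp lp hreg cps e0).
have H2 : forall x : R, s0 <= 1 - x ^+ 2 -> `|ldiag n x - 1| <= e.
  by near: n; exact: Lker_diag_cvg.
have H3 : forall t : R, -1 <= t <= 1 ->
  `|Lam (fun x => pi * arcw x * wt x * (Lker n t).[x] ^+ 2) / n%:R -
    pi * arcw t * wt t * ldiag n t| <= e by near: n; exact: (fejer_mean cvw e0).
have H4 : forall t : R, -1 <= t <= 1 ->
  `|Lam (fun x => pi * arcw x * psi x * (Lker n t).[x] ^+ 2) / n%:R -
    pi * arcw t * psi t * ldiag n t| <= e by near: n; exact: (fejer_mean cps e0).
have hdiag (t : R) : -1 <= t <= 1 -> 0 <= ldiag n t <= 2.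
  move=> /(Lker_diag_le n)/andP[h1 h2]; rewrite /ldiag ler_pdivrMr// h2 andbT.
  by rewrite divr_ge0.
have iabs : intg c d (fun x => `|wt x - w1 x|).
  by apply: intg_norm; apply: intgB => //; exact: intg_cont.
(* [FA] holds the K_n term, [FB] what remains of the two L_n terms plus the error of [wt], and [FC]
   the contribution of [ls]. *)
pose FA x := w1 x * (pi * arcw x * psi x * kdiag p n x).
pose FB x := (e * (1 + g0) - psi x) + 2 / m * `|wt x - w1 x|.
pose FC x := g0 * (psi x * lnorm ls n x).
have cFA : continuous (fun x => pi * arcw x * psi x * kdiag p n x).
  by apply: contM => //; exact: cont_kdiag.
have cFC : continuous (fun x => psi x * lnorm ls n x).
  by apply: contM => //; exact: cont_lnorm.
have cB1 : continuous (fun x => e * (1 + g0) - psi x) by apply: contB => //; exact: cont_cst.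
have iA : intg c d FA by exact: intgM_cont.
have iB : intg c d FB by apply: intgD; [exact: intg_cont|exact: intgZ].
have iC : intg c d FC by apply: intgZ; exact: intg_cont.
have pw x : c <= x <= d ->
    psi x * (pi * arcw x * w1 x) * Efun n x <= FA x + (FB x + FC x).
  move=> xcd; have [gp gl gG] := hg x xcd; have xin := seg_in xcd; have [sx _] := hs x xcd.
  have cL : continuous (fun t => (Lker n x ^+ 2).[t]) by exact: cont_poly.
  have hN : lnorm l n x <= pi * arcw x * wt x * ldiag n x + e + lnorm ls n x.
    have h1 : lnorm l n x <= Lam (fun t => pi * arcw t * wt t * (Lker n x).[t] ^+ 2) / n%:R
      + lnorm ls n x.
      rewrite /lnorm -mulrDl; apply: ler_wpM2r; first by rewrite invr_ge0.
      under [X in Lam X]eq_fun do rewrite -horner_exp.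
      by apply: hlw => // t; rewrite horner_exp sqr_ge0.
    apply: le_trans h1 _; rewrite lerD2r.
    by have := le_trans (ler_norm _) (H3 x xin); rewrite lerBlDl.
  have := hdiag x xin; have := H2 x sx; have := hpsi x; have w0 := w1_gt0 x.
  have hwt1 : wt x / w1 x <= 1 + `|wt x - w1 x| / m.
    rewrite ler_pdivrMr// mulrDl mul1r.
    have h1 : wt x - w1 x <= `|wt x - w1 x| by exact: ler_norm.
    have h2 : `|wt x - w1 x| <= `|wt x - w1 x| / m * w1 x.
      by rewrite mulrAC ler_pdivlMr// ler_wpM2l.
    lra.
  have gv : gfun x * (pi * arcw x * wt x) = wt x / w1 x.
    have wz : w1 x != 0 by rewrite gt_eqF.
    by apply: (mulIf wz); rewrite divfK// -[RHS]mul1r -gG; ring.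
  have := lnorm_ge0 n x hls; have := ler_norm (wt x - w1 x).
  have : 0 <= `|wt x - w1 x| / m by rewrite divr_ge0// ltW.
  rewrite /FA /FB /FC /Efun; move: hN hwt1 gv gG gp gl.
  have -> : 2 / m * `|wt x - w1 x| = 2 * (`|wt x - w1 x| / m) by rewrite mulrAC mulrA.
  move: (`|wt x - w1 x| / m : R) (wt x / w1 x : R) => b q.
  move: (gfun x) (kdiag p n x) (ldiag n x) (lnorm l n x) (lnorm ls n x) (pi * arcw x) (psi x) (w1 x) (wt x).
  move=> g k L N Ns v y w u hN hq gv gG gp gl b0 _ Ns0 /andP[y0 y1].
  rewrite ler_norml => /andP[L1 L2] /andP[L3 L4].
  exact: comparison_pointwise hN hq gv gG gp gl b0 Ns0 y0 y1 L1 L2 L3 L4 e0.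
apply: le_trans (sint_le (intg_Efun n cpsi) (intgD iA (intgD iB iC)) pw) _.
rewrite sintD//; last exact: intgD.
rewrite sintD//.
have hA : sint c d FA <= sint c d psi + e.
  rewrite -(Lam_arcw_supp hc (ltW cd) hd cpsi psi0).
  apply: (@le_trans _ _ (l (fun x => pi * arcw x * psi x * kdiag p n x))).
    apply: hI => // x; rewrite mulr_ge0 ?kdiag_ge0// mulr_ge0//; last by case/andP: (hpsi x).
    by rewrite mulr_ge0 ?arcw_ge0// ltW.
  have -> : l (fun x => pi * arcw x * psi x * kdiag p n x) =
      l (fun x => pi * arcw x * psi x * (kpoly p n x).[x]) / n%:R.
    rewrite mulrC -(posfunZ hl); first by congr l; apply/funext => x; rewrite /kdiag; ring.
    apply: contM => //; have ck := @cont_kdiag R p n.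
    have -> : (fun x => (kpoly p n x).[x]) = (fun x => n%:R * kdiag p n x).
      by apply/funext => x; rewrite /kdiag mulrC divfK// gt_eqF.
    exact: contZ.
  by have := le_trans (ler_norm _) H1; rewrite lerBlDl.
have hB : sint c d FB <= e * (1 + g0) * (d - c) - sint c d psi + 2 / m * e.
  rewrite /FB sintD; [|exact: intg_cont|exact: intgZ].
  rewrite sintB; [|exact: (intg_cont _ _ (cont_cst _))|exact: intg_cont].
  rewrite (sintZ _ iabs) (sint_cst _ (ltW hcd)) lerD2l.
  by apply: ler_wpM2l => //; rewrite divr_ge0// ltW.
have hC : sint c d FC <= g0 * (2 * pi * e + e * M0).
  rewrite /FC sintZ; last exact: intg_cont.
  apply: ler_wpM2l; first exact: ltW.
  have sup0 x : ~~ (c <= x <= d) -> psi x * lnorm ls n x = 0 by move/psi0->; rewrite mul0r.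
  rewrite -(Lam_arcw_supp hc (ltW cd) hd cFC sup0).
  under [X in Lam X]eq_fun do rewrite mulrA.
  (* After the exchange the inner mean at t is within e of pi s(t) psi(t) L_n(t, t) / n, hence at
     most 2 pi psi(t) + e; [ls] is small on psi and bounded on constants. *)
  rewrite (lnorm_swap n hL hls cps).
  apply: (@le_trans _ _ (ls (fun t => 2 * pi * psi t + e * 1))); last first.
    rewrite (posfunD hls) ?(posfunZ hls)//; [|exact: cont_cst|exact: contZ|].
      by rewrite lerD// ler_wpM2l//; [lra|exact: ltW].
    by apply: contZ; exact: cont_cst.
  apply: (posfun_le hls); first exact: cont_Lker_mean.
    by apply: contD; [exact: contZ|apply: contZ; exact: cont_cst].
  move=> t t1; have := le_trans (ler_norm _) (H4 t t1); rewrite lerBlDl mulr1 => h.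
  apply: le_trans h _; rewrite lerD2r.
  have /andP[L0 L2] := hdiag t t1; have /andP[y0 _] := hpsi t.
  rewrite mulrC -[2 * pi * _]mulrA; apply: ler_pM => //.
    by rewrite mulr_ge0// mulr_ge0 ?arcw_ge0// ltW.
  by rewrite ler_wpM2r// ler_piMr ?arcw_le1// ltW.
move: hA hB hC; move: (2 / m) (sint c d psi) (sint c d FA) (sint c d FB) (sint c d FC).
move=> y S a b f hA hB hC; lra.
Unshelve. all: by end_near.
Qed.

End Core.

(** * Derivatives of the kernel on the diagonal *)

Section Kappa.
Context {R : realType}.
Implicit Types (p : nat -> {poly R}).

(* The diagonal values of d_x^j d_y^k K_n(x, y). *)
Definition kap p n j k : {poly R} := \sum_(i < n) (p i)^`(j) * (p i)^`(k).

Lemma derivn_sum (I : Type) (r : seq I) (P : pred I) (F : I -> {poly R}) k :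
  (\sum_(i <- r | P i) F i)^`(k) = \sum_(i <- r | P i) (F i)^`(k).
Proof. exact: (linear_sum (derivn k)). Qed.

Lemma kapE p n j k x : (kap p n j k).[x] = \sum_(i < n) (p i)^`(j).[x] * (p i)^`(k).[x].
Proof. by rewrite horner_sum; apply: eq_bigr => i _; rewrite hornerM. Qed.

Lemma kpoly_derivn p n k x : (kpoly p n x)^`(k).[x] = (kap p n 0 k).[x].
Proof.
rewrite kapE /kpoly derivn_sum horner_sum; apply: eq_bigr => i _.
by rewrite derivnZ hornerZ.
Qed.

Lemma kap_deriv p n j k : (kap p n j k)^`() = kap p n j.+1 k + kap p n j k.+1.
Proof.
rewrite /kap (linear_sum (@deriv R)) -big_split /=; apply: eq_bigr => i _.
by rewrite derivM -!derivnS.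
Qed.

Lemma kap_CS p n j k x : (kap p n j k).[x] ^+ 2 <= (kap p n j j).[x] * (kap p n k k).[x].
Proof.
rewrite !kapE; apply: le_trans (CS_sum _ _ _) _.
by under [X in X * _]eq_bigr do rewrite expr2; under [X in _ * X]eq_bigr do rewrite expr2.
Qed.

(* sin (pi (a - b)) / (pi (a - b)) = \sum_(j, k) (pi a)^j (pi b)^k / (j! k!) cjk j k *)
Definition cjk j k : R := if odd (j + k) then 0 else
  (-1) ^+ (j + (j + k)./2) / (j + k).+1%:R.

Lemma cjkS j k : cjk j.+1 k = - cjk j k.+1.
Proof.
rewrite /cjk addSnnS; case: ifP => _; first by rewrite oppr0.
by rewrite addSn exprS mulN1r mulNr.
Qed.

Lemma cjk_le1 j k : `|cjk j k| <= 1.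
Proof.
rewrite /cjk; case: ifP => _; first by rewrite normr0.
rewrite normrM normrX normrN1 expr1n mul1r normfV normr_nat invf_le1 ?ltr0n//.
by rewrite ler1n.
Qed.

End Kappa.

Section DerivativeLimit.
Context {R : realType}.

Lemma sint_deriv_poly (a b : R) (F : {poly R}) : a <= b ->
  sint a b (fun x => F^`().[x]) = F.[b] - F.[a].
Proof.
rewrite le_eqVlt => /predU1P[->|ab].
  by rewrite /sint set_itv1 Rintegral_set1 subrr.
rewrite /sint /Rintegral (@continuous_FTC2 _ _ (fun x => F.[x]))//.
- exact/continuous_subspaceT/cont_poly.
- split=> [x _||].
  + exact: ex_derive.
  + exact/cvg_at_right_filter/cont_poly.
  + exact/cvg_at_left_filter/cont_poly.
- by move=> x _; rewrite -derivE.
Qed.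

Lemma poly_deriv_bound (a b : R) (P : {poly R}) :
  exists2 M : R, 0 <= M & forall x, a <= x <= b -> `|P.[x]| <= M.
Proof. exact: cont_bounded (@cont_poly R P). Qed.

Lemma poly_L1_approx (a b : R) (f : R -> R) (e : R) : a < b -> intg a b f -> 0 < e ->
  exists P : {poly R}, sint a b (fun x => `|f x - P.[x]|) <= e.
Proof.
move=> ab If e0.
have ml : (lebesgue_measure `[a, b]%classic < +oo :> \bar R)%E.
  by rewrite lebesgue_measure_itv /= lte_fin ab ltry.
have [g [cg ig gf]] := @approximation_continuous_integrable R `[a, b]%classic f
  (measurable_itv _) ml If.
have e2 : 0 < e / 2 by rewrite divr_gt0.
have : \forall n \near \oo, (\int[lebesgue_measure]_(z in `[a, b]) `|(f z - g n z)%:E| < (e / 2)%:E)%E.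
  have hn : nbhs (0 : \bar R)%E [set y | (y < (e / 2)%:E)%E].
    by apply: open_nbhs_nbhs; split; [exact: open_ereal_lt_ereal|rewrite /= lte_fin].
  exact: (gf _ hn).
case=> N _ /(_ N (leqnn N)) /= hN.
have e3 : 0 < e / (2 * (b - a)) by rewrite divr_gt0// mulr_gt0// subr_gt0.
have [P hP] := weierstrass (cg N) ab e3; exists P.
have i1 : intg a b (fun x => `|f x - g N x|).
  by apply: intg_norm; apply: intgB => //; exact: intg_cont.
have iP : intg a b (fun x => P.[x]) by exact: intg_cont (@cont_poly R P).
have ic : intg a b (fun=> e / (2 * (b - a))) by exact: intg_cont (cont_cst _).
apply: le_trans (sint_le (intg_norm (intgB If iP)) (intgD i1 ic) _) _ => [x xab|].
  have -> : f x - P.[x] = (f x - g N x) + (g N x - P.[x]) by rewrite addrA subrK.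
  by apply: le_trans (ler_normD _ _) _; rewrite lerD2l; exact: hP.
rewrite sintD// (sint_cst _ (ltW ab)).
have -> : e / (2 * (b - a)) * (b - a) = e / 2.
  by field; rewrite gt_eqF ?subr_gt0.
have : sint a b (fun x => `|f x - g N x|) <= e / 2.
  rewrite -lee_fin /sint /Rintegral fineK; first exact: ltW.
  exact: integrable_fin_num.
lra.
Qed.

(* Let R = Q_n - P with P a polynomial close to f in L^1. With X = (x - a) (b - x) vanishing at the end points,
   integration by parts gives \int X R'^2 = - \int R (X' R' + X R''), which is O(n^2) \int |R|. *)
Lemma deriv_L1_small (a b a1 b1 C : R) (f : R -> R) (Q : nat -> {poly R}) (e : R) :
  a < a1 -> a1 <= b1 -> b1 < b -> 0 <= C -> intg a b f ->
  (forall n x, (0 < n)%N -> a <= x <= b -> `|(Q n)^`().[x]| <= C * n%:R) ->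
  (forall n x, (0 < n)%N -> a <= x <= b -> `|(Q n)^`()^`().[x]| <= C * n%:R ^+ 2) ->
  (forall e, 0 < e -> \forall n \near \oo, sint a b (fun x => `|(Q n).[x] - f x|) <= e) ->
  0 < e -> \forall n \near \oo, sint a1 b1 (fun x => `|(Q n)^`().[x] / n%:R|) <= e.
Proof.
move=> aa1 ab1 bb1 C0 If hQ1 hQ2 hQ e0.
have ab : a < b by lra.
pose L := b - a; have L0 : 0 < L by rewrite subr_gt0.
pose th := e / (4 * (1 + (b1 - a1))).
have th0 : 0 < th by rewrite divr_gt0//; lra.
(* A lower bound for (x - a) (b - x) on [a1, b1]. *)
pose x0 := (a1 - a) * (b - b1); have x00 : 0 < x0 by rewrite mulr_gt0// subr_gt0.
pose B := 2 * (C + 1) * (L + L ^+ 2).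
have B0 : 0 < B by rewrite mulr_gt0//; nra.
(* Chosen so that the bound 2 B eta n^2 on the weighted integral of S'^2, divided by x0 th n^2,
   equals e / 4. *)
pose eta := e * (x0 * th) / (8 * B).
have eta0 : 0 < eta by apply: divr_gt0; apply: mulr_gt0 => //; exact: mulr_gt0.
have [P hP] := poly_L1_approx ab If eta0.
have [P1 P10 hP1] := poly_deriv_bound a b P^`().
have [P2 P20 hP2] := poly_deriv_bound a b P^`()^`().
near=> n.
have n1 : 1 <= n%:R :> R by rewrite ler1n; near: n; exact: nbhs_infty_gt.
have n0 : (0 < n)%N by near: n; exact: nbhs_infty_gt.
have nP1 : P1 <= n%:R by near: n; exact: nbhs_infty_ger.
have nP2 : P2 <= n%:R by near: n; exact: nbhs_infty_ger.
have nP3 : 4 * (P1 * (1 + (b1 - a1))) / e <= n%:R by near: n; exact: nbhs_infty_ger.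
have hQn : sint a b (fun x => `|(Q n).[x] - f x|) <= eta by near: n; exact: hQ.
pose S := Q n - P; pose X := ('X - a%:P) * (b%:P - 'X) : {poly R}.
have XE x : X.[x] = (x - a) * (b - x) by rewrite hornerM !hornerD !hornerN !hornerC !hornerX.
have X'E x : X^`().[x] = a + b - 2 * x.
  rewrite derivM !derivB derivX !derivC !hornerE; ring.
have SE : (Q n)^`() = S^`() + P^`() by rewrite derivB subrK.
clearbody X; have ic (q : {poly R}) : intg a b (fun x => q.[x]) by exact: intg_cont (@cont_poly R q).
have iS : sint a b (fun x => `|S.[x]|) <= 2 * eta.
  have i1 : intg a b (fun x => `|(Q n).[x] - f x|) by apply: intg_norm; exact: intgB.
  have i2 : intg a b (fun x => `|f x - P.[x]|) by apply: intg_norm; exact: intgB.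
  apply: le_trans (sint_le (intg_norm (ic S)) (intgD i1 i2) _) _ => [x _|].
    rewrite hornerD hornerN; apply: le_trans (ler_normD _ _).
    by rewrite addrA subrK.
  by rewrite sintD//; lra.
have S1 x : a <= x <= b -> `|S^`().[x]| <= (C + 1) * n%:R.
  move=> xab; rewrite derivB hornerD hornerN mulrDl mul1r.
  apply: le_trans (ler_normB _ _) _; apply: lerD; first exact: hQ1.
  exact: le_trans (hP1 x xab) _.
have S2 x : a <= x <= b -> `|S^`()^`().[x]| <= (C + 1) * n%:R ^+ 2.
  move=> xab; rewrite !derivB hornerD hornerN mulrDl mul1r.
  apply: le_trans (ler_normB _ _) _; apply: lerD; first exact: hQ2.
  by apply: le_trans (hP2 x xab) _; apply: le_trans nP2 _; rewrite ler_eXnr.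
clearbody S; have key : sint a b (fun x => (X * S^`() ^+ 2).[x]) <= B * n%:R ^+ 2 * (2 * eta).
  have := sint_deriv_poly (X * S * S^`()) (ltW ab).
  rewrite !hornerM !XE !subrr !(mulr0, mul0r) subr0 => h0.
  have -> : sint a b (fun x => (X * S^`() ^+ 2).[x]) =
      sint a b (fun x => - (S * (X^`() * S^`() + X * S^`()^`())).[x]).
    rewrite -[RHS]addr0 -h0 -sintD//; last first.
      have -> : (fun x => - (S * (X^`() * S^`() + X * S^`()^`())).[x]) =
                (fun x => (- (S * (X^`() * S^`() + X * S^`()^`()))).[x]).
        by apply/funext => x; rewrite hornerN.
      exact: ic.
    by apply: sint_eq => x _; rewrite -hornerN -hornerD; congr (_.[x]); rewrite !derivM; ring.
  apply: (@le_trans _ _ (sint a b (fun x => B * n%:R ^+ 2 * `|S.[x]|))); last first.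
    rewrite sintZ; last exact: intg_norm.
    by apply: ler_wpM2l => //; rewrite mulr_ge0 ?exprn_ge0// ltW.
  apply: sint_le => [||x xab].
  - have -> : (fun x => - (S * (X^`() * S^`() + X * S^`()^`())).[x]) =
                (fun x => (- (S * (X^`() * S^`() + X * S^`()^`()))).[x]).
      by apply/funext => x; rewrite hornerN.
    exact: ic.
  - by apply: intgZ; exact: intg_norm.
  apply: le_trans (ler_norm _) _; rewrite normrN hornerM normrM mulrC.
  apply: ler_wpM2r => //; rewrite hornerD !hornerM X'E XE.
  have [xa xb] := andP xab; apply: le_trans (ler_normD _ _) _; rewrite !normrM.
  have hX' : `|a + b - 2 * x| <= L by rewrite ler_norml /L; lra.
  have hX : `|x - a| * `|b - x| <= L ^+ 2.
    by rewrite expr2 /L; apply: ler_pM; rewrite ?normr_ge0// ger0_norm ?subr_ge0// lerB.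
  have h1 : `|a + b - 2 * x| * `|S^`().[x]| <= L * ((C + 1) * n%:R ^+ 2).
    apply: ler_pM => //; apply: le_trans (S1 x xab) _.
    by rewrite ler_wpM2l ?addr_ge0// ler_eXnr.
  have h2 : `|x - a| * `|b - x| * `|S^`()^`().[x]| <= L ^+ 2 * ((C + 1) * n%:R ^+ 2).
    by apply: ler_pM => //; exact: S2.
  apply: le_trans (lerD h1 h2) _.
  have -> : L * ((C + 1) * n%:R ^+ 2) + L ^+ 2 * ((C + 1) * n%:R ^+ 2) =
    (C + 1) * (L + L ^+ 2) * n%:R ^+ 2 by ring.
  apply: ler_wpM2r; first exact: exprn_ge0.
  have : 0 <= (C + 1) * (L + L ^+ 2).
    by apply: mulr_ge0; [exact: addr_ge0|rewrite addr_ge0 ?exprn_ge0// ltW].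
  by rewrite /B -mulrA; move: ((C + 1) * _) => y y0; lra.
have nz : 0 < n%:R :> R by rewrite ltr0n.
pose k := (x0 * th * n%:R ^+ 2)^-1.
have k0 : 0 < k.
  by rewrite invr_gt0; apply: mulr_gt0; [exact: mulr_gt0|exact: exprn_gt0].
have i1 : intg a1 b1 (fun x => k * (X * S^`() ^+ 2).[x]).
  by apply: intgZ; exact: intg_cont (@cont_poly R _).
have i2 : intg a1 b1 (fun=> th + P1 / n%:R) by exact: intg_cont (cont_cst _).
apply: (@le_trans _ _ (sint a1 b1 (fun x => (th + P1 / n%:R) + k * (X * S^`() ^+ 2).[x]))).
  apply: sint_le => [||x xab1].
  - apply: intg_norm; apply: intg_cont; apply: contM; last exact: cont_cst.
    exact: cont_poly.
  - exact: intgD.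
  have [xa1 xb1] := andP xab1.
  have xab : a <= x <= b by rewrite (le_trans (ltW aa1) xa1) (le_trans xb1 (ltW bb1)).
  have -> : (Q n)^`().[x] = S^`().[x] + P^`().[x] by rewrite SE hornerD.
  rewrite mulrDl; apply: le_trans (ler_normD _ _) _.
  rewrite [leRHS]addrAC; apply: lerD; last first.
    by rewrite normrM normfV (ger0_norm (ltW nz)) ler_wpM2r ?invr_ge0 ?(ltW nz)//; exact: hP1.
  rewrite hornerM XE horner_exp; set y := S^`().[x].
  have hx : x0 <= (x - a) * (b - x) by apply: ler_pM; rewrite ?lerB// subr_ge0 ltW.
  apply: (@le_trans _ _ (th + k * (x0 * y ^+ 2))); last first.
    by rewrite lerD2l; apply: ler_wpM2l; [exact: ltW|rewrite ler_wpM2r ?sqr_ge0].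
  have -> : k * (x0 * y ^+ 2) = `|y / n%:R| ^+ 2 / th.
    by rewrite real_normK ?num_real// /k; field; rewrite !gt_eqF.
  exact: ler_addXdiv.
rewrite sintD// sint_cst// sintZ; last exact: intg_cont (@cont_poly R _).
have hsub : sint a1 b1 (fun x => (X * S^`() ^+ 2).[x]) <= sint a b (fun x => (X * S^`() ^+ 2).[x]).
  apply: sint_sub; [exact: ltW|exact: ltW|exact: ic|] => x /andP[xa xb].
  by rewrite hornerM XE horner_exp mulr_ge0 ?sqr_ge0// mulr_ge0// subr_ge0.
have hk : k * sint a1 b1 (fun x => (X * S^`() ^+ 2).[x]) <= e / 4.
  apply: (@le_trans _ _ (k * (B * n%:R ^+ 2 * (2 * eta)))).
    by apply: ler_wpM2l; [exact: ltW|exact: le_trans key].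
  rewrite le_eqVlt; apply/orP; left; apply/eqP; rewrite /k /eta.
  have aux (N x1 t1 B1 : R) : 0 < N -> 0 < x1 -> 0 < t1 -> 0 < B1 ->
      (x1 * t1 * N ^+ 2)^-1 * (B1 * N ^+ 2 * (2 * (e * (x1 * t1) / (8 * B1)))) = e / 4.
    by move=> N0 x10 t10 B10; field; rewrite !gt_eqF.
  exact: aux.
have l0 : 0 <= b1 - a1 by rewrite subr_ge0.
have ht : th * (b1 - a1) <= e / 4.
  by apply: ler_frac1D => //; exact: ltW.
have hp : P1 / n%:R * (b1 - a1) <= e / 4.
  rewrite mulrAC ler_pdivrMr//; move: nP3; rewrite ler_pdivrMr// => nP3.
  have : P1 * (b1 - a1) <= P1 * (1 + (b1 - a1)) by rewrite ler_wpM2l// lerDr.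
  by lra.
by rewrite mulrDl; lra.
Unshelve. all: by end_near.
Qed.

End DerivativeLimit.

Section KappaLimit.
Context {R : realType} (l : (R -> R) -> R) (hl : posfun l).
Context (p : nat -> {poly R}) (hp : onpolys l p).
Context (lp : forall n, 0 < lead_coef (p n)).
Context (hreg : forall d : R, 0 < d ->
  \forall n \near \oo, lead_coef (p n) <= (2 + d) ^+ n).
Context (c d : R) (c_1 : -1 < c) (cd : c < d) (d_1 : d < 1).
Context (m : R) (m0 : 0 < m) (w1 : R -> R) (mw : measurable_fun setT w1).
Context (wm : forall x, m <= w1 x) (iw : intg c d w1).
Context (hI : forall f : R -> R, continuous f -> (forall x, 0 <= f x) ->
  sint c d (fun x => w1 x * f x) <= l f).
Notation Lam := (@Lam R).
(* [psi] is nearly 1 inside (c, d) but nearly invisible for the singular part of mu, [wt] is a continuous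
   approximation of the density, and [ls] collects the singular part and the approximation error. *)
Context (M0 : R) (M00 : 0 <= M0).
Context (happ : forall e c1 d1 : R, 0 < e -> c < c1 -> c1 <= d1 -> d1 < d ->
  exists (psi wt : R -> R) (ls : (R -> R) -> R),
  [/\ continuous psi, forall x, 0 <= psi x <= 1,
     forall x, ~~ (c <= x <= d) -> psi x = 0,
     sint c1 d1 (fun x => 1 - psi x) <= e &
  [/\ continuous wt, forall x, 0 <= wt x & sint c d (fun x => `|wt x - w1 x|) <= e] /\
  [/\ posfun ls, ls psi <= e, ls (fun=> 1) <= M0 &
   forall f : R -> R, continuous f -> (forall x, 0 <= f x) ->
     l f <= Lam (fun x => pi * arcw x * wt x * f x) + ls f]]).
Let p0 : 0 < (pi : R). Proof. exact: pi_gt0. Qed.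
Notation g := (gfun w1).

Section Interior.
Context (c1 d1 : R) (cc1 : c < c1) (cd1 : c1 <= d1) (dd1 : d1 < d).

Lemma interior_sub (x : R) : c1 <= x <= d1 -> c <= x <= d.
Proof. by have [? ?] := (cc1, dd1) => /andP[? ?]; apply/andP; split; lra. Qed.

(** For j = k let P be the sum of p_q^(j)(x) p_q, which represents the functional taking the j-th
    derivative at x. Both P^(j)(x) and the squared norm of P equal S = kap(j, j)(x), so the
    Bernstein inequality for P bounds S^2 by a multiple of S. The case j <> k follows by
    Cauchy-Schwarz. *)
Lemma kap_bound : exists A C : R, [/\ 0 < A, 0 < C & forall n j k x,
  c1 <= x <= d1 -> `|(kap p n j k).[x]| <= A * C ^+ (j + k) * n%:R ^+ (j + k).+1].
Proof.
have [A [C [A0 C0 h]]] := poly_derivn_pint m0 wm iw hI cc1 cd1 dd1.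
exists A, C; split=> // n j k x xcd.
have diag i : 0 <= (kap p n i i).[x] <= A * C ^+ i.*2 * n%:R ^+ (i.*2).+1.
  have S0 : 0 <= (kap p n i i).[x].
    by rewrite kapE sumr_ge0// => q _; rewrite -expr2 sqr_ge0.
  rewrite S0 /=; have [<-|Sn] := eqVneq 0 (kap p n i i).[x].
    by rewrite !mulr_ge0// ?exprn_ge0// ltW.
  have {Sn} Sp : 0 < (kap p n i i).[x] by rewrite lt_def eq_sym Sn.
  pose P := \sum_(q < n) (p q)^`(i).[x] *: p q.
  have sP : (size P <= n)%N.
    rewrite (leq_trans (size_sum _ _ _))//; apply/bigmax_leqP => q _.
    by rewrite (leq_trans (size_scale_leq _ _))// hp.1.
  have Px : P^`(i).[x] = (kap p n i i).[x].
    rewrite kapE /P derivn_sum horner_sum; apply: eq_bigr => q _.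
    by rewrite derivnZ hornerZ.
  have Pl : pint l (P ^+ 2) = (kap p n i i).[x].
    rewrite expr2 (on_parseval hl hp P sP) kapE.
    have co (q : 'I_n) : pint l (P * p q) = (p q)^`(i).[x].
      rewrite /P mulr_suml (pint_sum hl) (bigD1 q)//= big1 => [|r rq].
        by rewrite -scalerAl (pintZ hl) hp.2 eqxx mulr1 addr0.
      rewrite -scalerAl (pintZ hl) hp.2; move: rq; rewrite -val_eqE /= => /negbTE ->.
      by rewrite mulr0.
    by apply: eq_bigr => q _; rewrite co.
  have := h P n i x sP xcd; rewrite Px Pl expr2.
  by rewrite ler_pM2r.
have := kap_CS p n j k x.
have /andP[j0 hj] := diag j; have /andP[k0 hk] := diag k => H.
have N0 : 0 <= n%:R :> R by [].
rewrite -(@ler_pXn2r _ 2)// ?nnegrE//; last first.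
  by rewrite !mulr_ge0// ?exprn_ge0// ltW.
rewrite real_normK ?num_real//; apply: le_trans H _; apply: le_trans (ler_pM j0 k0 hj hk) _.
rewrite le_eqVlt; apply/orP; left; apply/eqP.
rewrite -!muln2 !exprS !exprM !exprD; move: (n%:R : R) => N; ring.
Qed.

Lemma Lker_derivn_le k : exists2 B : R, 0 <= B & forall n x, (0 < n)%N -> c <= x <= d ->
  `|(Lker n x)^`(k).[x] / n%:R ^+ k.+1| <= B.
Proof.
have [s0 [s00 s01 hs]] := arc_lower c_1 cd d_1.
have [B B0 h] := Lker_derivn s00 s01 k.
exists ((1 + B) / s0 ^+ k./2); first by rewrite divr_ge0 ?addr_ge0// exprn_ge0// ltW.
move=> n x n0 /hs[sx _]; have := h n x n0 sx.
set c0 := if _ then _ else _; set L := (Lker n x)^`(k).[x] => H.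
have n1 : 1 <= n%:R :> R by rewrite ler1n.
have nk : 0 < n%:R ^+ k.+1 :> R by rewrite exprn_gt0// ltr0n.
have c0n : `|c0| <= n%:R ^+ k.+1.
  rewrite /c0; case: ifP => _; first by rewrite normr0 ltW.
  rewrite !normrM normrX normrN1 expr1n mul1r normfV normr_nat normrX normr_nat.
  by rewrite ler_pdivrMr ?ltr0n// ler_peMr ?ler1n// ltW.
rewrite normrM normfV (ger0_norm (ltW nk)) ler_pdivrMr//.
rewrite mulrAC ler_pdivlMr ?exprn_gt0//.
apply: (@le_trans _ _ (`|L * (1 - x ^+ 2) ^+ k./2|)).
  rewrite normrM ler_wpM2l// ger0_norm ?exprn_ge0//; last by rewrite (le_trans _ sx)// ltW.
  by apply: lerXn2r => //; rewrite nnegrE ?(le_trans _ sx)// ltW.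
rewrite -[X in `|X|](subrK c0); apply: le_trans (ler_normD _ _) _.
rewrite mulrDl mul1r addrC lerD//; apply: le_trans H _.
by rewrite ler_wpM2l// exprS ler_peMl// exprn_ge0.
Qed.

Lemma intg_gfun (f : R -> R) : continuous f -> intg c d (fun x => f x * g x).
Proof. by move=> cf; apply: (intg_G c_1 cd d_1 m0 mw wm); exact: intg_cont. Qed.

Lemma cont_Lker_derivn n k : continuous (fun x : R => (Lker n x)^`(k).[x]).
Proof.
have -> : (fun x : R => (Lker n x)^`(k).[x]) = (fun x => (kap (@chebn R) n 0 k).[x]).
  by apply/funext => x; rewrite LkerE kpoly_derivn.
exact: cont_poly.
Qed.

(** The Bernstein inequality in t, applied to K_n(x, t) - g(x) L_n(x, t) and evaluated at t = x,
    bounds D(x)^2 by a multiple of E_n(x). The part of |D| weighted by psi is then small by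
    [Efun_small]; on the part weighted by 1 - psi, D is only bounded, but the weight has small
    integral. *)
Lemma kappa0_gap k (e : R) : 0 < e -> \forall n \near \oo,
  sint c1 d1 (fun x => `|((kap p n 0 k).[x] - g x * (Lker n x)^`(k).[x]) / n%:R ^+ k.+1|) <= e.
Proof.
move=> e0; have [hc hd hcd] := And3 c_1 d_1 cd; have [hc1 hd1 hcd1] := And3 cc1 dd1 cd1.
have hm := m0; have hp0 := p0; have hM := M00.
have [A [C [A0 C0 hAC]]] := poly_derivn_pint m0 wm iw hI cc1 cd1 dd1.
have [A' [C' [A'0 C'0 hK]]] := kap_bound.
have [B B0 hB] := Lker_derivn_le k.
have [g0 g00 hg] := gfun_bound c_1 cd d_1 m0 wm.
have [C1 C10 hE] := Efun_small hl hp lp hreg c_1 cd d_1 m0 mw wm iw hI M00.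
pose b := A * C ^+ k.*2; have b0 : 0 < b by rewrite mulr_gt0// exprn_gt0.
pose B2 := A' * C' ^+ k + g0 * B.
have B20 : 0 <= B2 by rewrite addr_ge0// mulr_ge0// ?exprn_ge0// ltW.
pose eta := e / (2 * (1 + (d1 - c1))).
have eta0 : 0 < eta by rewrite divr_gt0// mulr_gt0//; lra.
(* The total coefficient of e1 in the final bound: the first summand from the part weighted by psi,
   [B2] from the part weighted by 1 - psi. *)
pose Q := b * g0 / eta * C1 + B2.
have bg0 : 0 <= b * g0 / eta.
  by apply: divr_ge0; [apply: mulr_ge0; exact: ltW|exact: ltW].
have Q0 : 0 <= Q by apply: addr_ge0 => //; exact: mulr_ge0.
pose e1 := Num.min 1 (e / (2 * (Q + 1))).
have e10 : 0 < e1 by rewrite lt_min ltr01 divr_gt0// mulr_gt0//; lra.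
have e11 : e1 <= 1 by rewrite ge_min lexx.
have Qe : Q * e1 <= e / 2.
  apply: (@le_trans _ _ ((Q + 1) * (e / (2 * (Q + 1))))).
    by apply: ler_pM => //; [exact: ltW|rewrite lerDl|rewrite ge_min lexx orbT].
  have Q1 : Q + 1 != 0 by rewrite gt_eqF//; lra.
  by rewrite le_eqVlt; apply/orP; left; apply/eqP; field.
have [psi [wt [ls [cpsi hpsi psi0 ipsi [[cwt wt0 hwt] [hls lspsi ls1 hlw]]]]]] :=
  happ e10 cc1 cd1 dd1.
have {hE} hE := hE _ _ _ _ e10 e11 cpsi hpsi psi0 cwt wt0 hwt hls lspsi ls1 hlw.
near=> n.
have n0 : (0 < n)%N by near: n; exact: nbhs_infty_gt.
have nz : 0 < n%:R :> R by rewrite ltr0n.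
have hEn : sint c d (fun x => psi x * (pi * arcw x * w1 x) * Efun l p w1 n x) <= C1 * e1.
  by near: n.
pose D x := ((kap p n 0 k).[x] - g x * (Lker n x)^`(k).[x]) / n%:R ^+ k.+1.
have iD : intg c d D.
  have : intg c d (fun x => (n%:R ^+ k.+1)^-1 * ((kap p n 0 k).[x] - (Lker n x)^`(k).[x] * g x)).
    apply: intgZ; apply: intgB; first exact: intg_cont (@cont_poly R _).
    exact: (intg_gfun (@cont_Lker_derivn n k)).
  by congr (intg c d _); apply/funext => x; rewrite /D mulrC [g x * _]mulrC.
have D2 x : c1 <= x <= d1 -> D x ^+ 2 <= b * Efun l p w1 n x.
  move=> xcd; rewrite (Efun_pint hl hp).
  set P := kpoly p n x - _ *: _.
  have sP : (size P <= n)%N.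
    rewrite (leq_trans (size_polyD _ _))// geq_max (size_kpoly hp) size_polyN.
    by rewrite (leq_trans (size_scale_leq _ _))// size_Lker.
  have -> : D x = P^`(k).[x] / n%:R ^+ k.+1.
    by rewrite /P derivnB derivnZ hornerD hornerN hornerZ kpoly_derivn.
  rewrite exprMn exprVn ler_pdivrMr ?exprn_gt0//.
  apply: le_trans (hAC P n k x sP xcd) _; rewrite le_eqVlt; apply/orP; left; apply/eqP.
  have n2 : n%:R ^+ k.+1 ^+ 2 = n%:R ^+ (k.*2).+1 * n%:R :> R.
    by rewrite -exprM -exprSr muln2 doubleS.
  by rewrite n2 /b; move: (n%:R : R) nz (pint l _) (n%:R ^+ _) => N N0 *; field; rewrite gt_eqF.
have DB x : c1 <= x <= d1 -> `|D x| <= B2.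
  move=> xcd; have xin := interior_sub xcd; have [gp gl _] := hg x xin.
  rewrite /D mulrBl; apply: le_trans (ler_normB _ _) _; apply: lerD.
    rewrite normrM normfV (ger0_norm (exprn_ge0 _ (ltW nz))) ler_pdivrMr ?exprn_gt0//.
    exact: hK.
  rewrite -mulrA normrM; apply: ler_pM => //; last exact: hB.
  by rewrite ger0_norm// ltW.
pose FE x := psi x * (pi * arcw x * w1 x) * Efun l p w1 n x.
have iE : intg c d FE by exact: (intg_Efun hl p c_1 cd d_1 m0 mw wm iw).
have iE1 : intg c1 d1 FE by exact: (intgS (ltW cc1) (ltW dd1)).
have cq : continuous (fun x => eta + B2 * (1 - psi x)).
  by apply: contD; [exact: cont_cst|apply: contZ; apply: contB => //; exact: cont_cst].
apply: (@le_trans _ _ (sint c1 d1 (fun x => (eta + B2 * (1 - psi x)) + b * g0 / eta * FE x))).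
  apply: sint_le => [||x xcd].
  - by apply: intg_norm; exact: (intgS (ltW cc1) (ltW dd1)).
  - by apply: intgD; [exact: intg_cont|exact: intgZ].
  have xin := interior_sub xcd; have [gp gl gG] := hg x xin.
  have /andP[y0 y1] := hpsi x.
  have h1 : `|D x| <= eta + b / eta * Efun l p w1 n x.
    apply: le_trans (ler_addXdiv _ eta0) _; rewrite lerD2l [leRHS]mulrAC.
    apply: ler_wpM2r; first by rewrite invr_ge0 ltW.
    by rewrite real_normK ?num_real//; exact: D2.
  have h2 : psi x * Efun l p w1 n x <= g0 * FE x.
    have E0 := Efun_ge0 hl hp w1 n x.
    have GE0 : 0 <= pi * arcw x * w1 x.
      by rewrite !mulr_ge0 ?arcw_ge0// ltW// (w1_gt0 m0 wm).
    rewrite /FE; move: GE0 gG E0; move: (pi * arcw x * w1 x) (Efun l p w1 n x) => G E GE0 gG E0.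
    have -> : psi x * E = g x * (psi x * G * E) by rewrite -[LHS]mul1r -gG; ring.
    by apply: ler_wpM2r => //; rewrite !mulr_ge0.
  rewrite -/(D x).
  have h3 : psi x * `|D x| <= eta + b * g0 / eta * FE x.
    apply: (@le_trans _ _ (psi x * (eta + b / eta * Efun l p w1 n x))); first by rewrite ler_wpM2l.
    rewrite mulrDr; apply: lerD; first by rewrite ler_piMl// ltW.
    have -> : b * g0 / eta * FE x = b / eta * (g0 * FE x) by ring.
    by rewrite mulrCA ler_wpM2l// divr_ge0// ltW.
  have h4 : (1 - psi x) * `|D x| <= B2 * (1 - psi x).
    by rewrite mulrC ler_wpM2r ?subr_ge0//; exact: DB.
  have -> : `|D x| = psi x * `|D x| + (1 - psi x) * `|D x| by ring.
  by rewrite [leRHS]addrAC; exact: lerD.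
rewrite sintD; [|exact: intg_cont|exact: intgZ].
rewrite sintD; [|exact: intg_cont (cont_cst _)|]; last first.
  by apply: intg_cont; apply: contZ; apply: contB => //; exact: cont_cst.
rewrite (sint_cst _ cd1) sintZ; last by apply: intg_cont; apply: contB => //; exact: cont_cst.
rewrite sintZ//.
have h5 : sint c1 d1 FE <= C1 * e1.
  apply: le_trans hEn; apply: sint_sub; [exact: ltW|exact: ltW|exact: iE|] => x _.
  rewrite /FE mulr_ge0 ?(Efun_ge0 hl hp)//; have /andP[? _] := hpsi x.
  by rewrite !mulr_ge0 ?arcw_ge0// ltW// (w1_gt0 m0 wm).
have h6 : b * g0 / eta * sint c1 d1 FE <= b * g0 / eta * C1 * e1.
  rewrite -[leRHS]mulrA; exact: ler_wpM2l.
have h7 : B2 * sint c1 d1 (fun x => 1 - psi x) <= B2 * e1 by rewrite ler_wpM2l.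
have h8 : eta * (d1 - c1) <= e / 2.
  by apply: ler_frac1D; rewrite ?subr_ge0// ltW.
by move: Qe; rewrite /Q mulrDl; lra.
Unshelve. all: by end_near.
Qed.

Lemma Lker_derivn_lim k (e : R) : 0 < e -> \forall n \near \oo, forall x : R, c <= x <= d ->
  `|(Lker n x)^`(k).[x] / n%:R ^+ k.+1 - cjk 0 k / arcw x ^+ k| <= e.
Proof.
move=> e0; have [s0 [s00 s01 hs]] := arc_lower c_1 cd d_1.
have [B B0 h] := Lker_derivn s00 s01 k.
near=> n => x xcd; have [sx ax] := hs x xcd.
have n0 : (0 < n)%N by near: n; exact: nbhs_infty_gt.
have nz : 0 < n%:R :> R by rewrite ltr0n.
have nB : B / (s0 ^+ k./2 * e) <= n%:R by near: n; exact: nbhs_infty_ger.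
have x0 : 0 < 1 - x ^+ 2 by exact: lt_le_trans sx.
set S := (1 - x ^+ 2) ^+ k./2; have S0 : 0 < S by exact: exprn_gt0.
have SE : cjk 0 k / arcw x ^+ k = cjk 0 k / S :> R.
  rewrite /cjk add0n; case: ifP => ok; first by rewrite !mul0r.
  rewrite /S -(@arcw_sqr R x); last by apply/andP; split; nra.
  by rewrite -exprM mul2n halfK ok subn0.
have := h n x n0 sx; rewrite SE -/S.
have -> : (if odd k then 0 else (-1) ^+ k./2 * n%:R ^+ k.+1 / k.+1%:R) =
  cjk 0 k * n%:R ^+ k.+1 :> R.
  by rewrite /cjk !add0n; case: ifP => _; rewrite ?mul0r// mulrAC.
move: ((Lker n x)^`(k).[x]) (cjk 0 k : R) => L q H.
have nk : 0 < n%:R ^+ k.+1 :> R by exact: exprn_gt0.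
have -> : L / n%:R ^+ k.+1 - q / S = (L * S - q * n%:R ^+ k.+1) / (S * n%:R ^+ k.+1).
  by field; rewrite !gt_eqF.
rewrite normrM normfV (ger0_norm (mulr_ge0 (ltW S0) (ltW nk))) ler_pdivrMr ?mulr_gt0//.
apply: le_trans H _; rewrite exprS mulrA mulrA ler_wpM2r ?exprn_ge0//.
move: nB; rewrite ler_pdivrMr ?mulr_gt0 ?exprn_gt0// => nB.
apply: le_trans nB _; rewrite mulrC; apply: ler_wpM2r => //.
rewrite mulrC; apply: ler_wpM2l; first exact: ltW.
by apply: lerXn2r => //; rewrite nnegrE ltW.
Unshelve. all: by end_near.
Qed.

End Interior.

(* The L^1 limit of kap p n j k / n^(j+k+1). *)
Definition kst j k (x : R) : R := cjk j k * (g x / arcw x ^+ (j + k)).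

Lemma kstS j k x : kst j.+1 k x = - kst j k.+1 x.
Proof. by rewrite /kst cjkS mulNr addSnnS. Qed.

Lemma intg_kst j k : intg c d (kst j k).
Proof.
have [s0 [s00 s01 hs]] := arc_lower c_1 cd d_1; have [g0 g00 hg] := gfun_bound c_1 cd d_1 m0 wm.
apply: intgZ.
have mi : measurable_fun setT (fun x : R => (arcw x ^+ (j + k))^-1).
  have -> : (fun x : R => (arcw x ^+ (j + k))^-1) = (fun y => y `^ (-1)) \o (fun x => arcw x ^+ (j + k)).
    by apply/funext => x /=; rewrite powR_inv1// exprn_ge0// arcw_ge0.
  apply: measurableT_comp; first exact: measurable_powR.
  by apply: measurable_funX; apply: continuous_measurable_fun; exact: cont_arcw.
apply: (intgM mi (M := (s0 ^+ (j + k))^-1)).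
  move=> x /hs[_ ax]; rewrite ger0_norm ?invr_ge0 ?exprn_ge0 ?arcw_ge0//.
  rewrite lef_pV2 ?posrE ?exprn_gt0//; last exact: lt_le_trans ax.
  by apply: lerXn2r => //; rewrite nnegrE ?arcw_ge0 ?ltW.
have := intg_gfun (cont_cst 1); congr (intg c d _); apply/funext => x; exact: mul1r.
Qed.

Lemma kappa0_lim k (c1 d1 e : R) : c < c1 -> c1 <= d1 -> d1 < d -> 0 < e ->
  \forall n \near \oo,
    sint c1 d1 (fun x => `|(kap p n 0 k).[x] / n%:R ^+ k.+1 - kst 0 k x|) <= e.
Proof.
move=> cc1 cd1 dd1 e0; have [g0 g00 hg] := gfun_bound c_1 cd d_1 m0 wm.
have l0 : 0 <= d1 - c1 by rewrite subr_ge0.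
pose e1 := e / (2 * (g0 * (1 + (d1 - c1)))).
have e10 : 0 < e1 by rewrite divr_gt0// !mulr_gt0//; lra.
have e20 : 0 < e / 2 by rewrite divr_gt0.
near=> n.
have H1 : sint c1 d1 (fun x => `|((kap p n 0 k).[x] - g x * (Lker n x)^`(k).[x]) / n%:R ^+ k.+1|)
  <= e / 2 by near: n; exact: kappa0_gap.
have H2 : forall x : R, c <= x <= d ->
    `|(Lker n x)^`(k).[x] / n%:R ^+ k.+1 - cjk 0 k / arcw x ^+ k| <= e1.
  by near: n; exact: Lker_derivn_lim.
have ik : intg c1 d1 (fun x => (kap p n 0 k).[x] / n%:R ^+ k.+1).
  by apply: intg_cont; apply: contM; [exact: cont_poly|exact: cont_cst].
have is0 j k' : intg c1 d1 (kst j k') by exact: (intgS (ltW cc1) (ltW dd1) (intg_kst j k')).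
have iD : intg c1 d1 (fun x => ((kap p n 0 k).[x] - g x * (Lker n x)^`(k).[x]) / n%:R ^+ k.+1).
  have : intg c d (fun x => (n%:R ^+ k.+1)^-1 * ((kap p n 0 k).[x] - (Lker n x)^`(k).[x] * g x)).
    apply: intgZ; apply: intgB; first exact: intg_cont (@cont_poly R _).
    exact: (intg_gfun (@cont_Lker_derivn n k)).
  move=> /(intgS (ltW cc1) (ltW dd1)).
  by congr (intg c1 d1 _); apply/funext => x; rewrite mulrC [g x * _]mulrC.
have ic : intg c1 d1 (fun=> g0 * e1) by exact: intg_cont (cont_cst _).
apply: (@le_trans _ _ (sint c1 d1 (fun x =>
    `|((kap p n 0 k).[x] - g x * (Lker n x)^`(k).[x]) / n%:R ^+ k.+1| + g0 * e1))).
  apply: sint_le => [||x xcd].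
  - by apply: intg_norm; exact: intgB.
  - by apply: intgD => //; exact: intg_norm.
  have xin := interior_sub cc1 dd1 xcd; have [gp gl _] := hg x xin.
  have -> : (kap p n 0 k).[x] / n%:R ^+ k.+1 - kst 0 k x =
    ((kap p n 0 k).[x] - g x * (Lker n x)^`(k).[x]) / n%:R ^+ k.+1 +
     g x * ((Lker n x)^`(k).[x] / n%:R ^+ k.+1 - cjk 0 k / arcw x ^+ k).
    by rewrite /kst add0n; ring.
  apply: le_trans (ler_normD _ _) _; rewrite lerD2l normrM; apply: ler_pM => //; last exact: H2.
  by rewrite ger0_norm// ltW.
rewrite sintD//; last exact: intg_norm.
rewrite (sint_cst _ cd1).
have : g0 * e1 * (d1 - c1) <= e / 2.
  have -> : g0 * e1 = e / (2 * (1 + (d1 - c1))).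
    rewrite /e1; move: (d1 - c1) l0 => y y0; field.
    by rewrite !gt_eqF//; lra.
  by apply: ler_frac1D => //; exact: ltW.
lra.
Unshelve. all: by end_near.
Qed.

Lemma kappa_lim j k (c1 d1 e : R) : c < c1 -> c1 <= d1 -> d1 < d -> 0 < e ->
  \forall n \near \oo,
    sint c1 d1 (fun x => `|(kap p n j k).[x] / n%:R ^+ (j + k).+1 - kst j k x|) <= e.
Proof.
elim: j k c1 d1 e => [|j IH] k c1 d1 e cc1 cd1 dd1 e0; first exact: kappa0_lim.
have hcd : c < d by exact: cd.
(* The induction hypothesis is used on [a, b], strictly between the two intervals, because
   [deriv_L1_small] loses a margin. *)
pose a := (c + c1) / 2; pose b := (d1 + d) / 2.
have ca : c < a by rewrite /a; lra.
have ac : a < c1 by rewrite /a; lra.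
have db : d1 < b by rewrite /b; lra.
have bd : b < d by rewrite /b; lra.
have ab : a <= b by lra.
have [A [C [A0 C0 hK]]] := kap_bound ca ab bd.
pose q n : {poly R} := (n%:R ^+ (j + k).+1)^-1 *: kap p n j k.
(* One differentiation of [kap] produces two terms and two produce four; the sum serves both
   bounds. *)
pose B := 2 * (A * C ^+ (j + k).+1) + 4 * (A * C ^+ (j + k).+2).
have CA i : 0 <= A * C ^+ i by rewrite mulr_ge0 ?exprn_ge0// ltW.
have B0 : 0 <= B by apply: addr_ge0; apply: mulr_ge0.
have q0 n i : 0 <= (n%:R ^+ i)^-1 :> R by rewrite invr_ge0 exprn_ge0.
have q1 n x : (0 < n)%N -> a <= x <= b -> `|(q n)^`().[x]| <= B * n%:R.
  move=> n0 xab; have nz : 0 < n%:R :> R by rewrite ltr0n.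
  rewrite /q derivZ kap_deriv hornerZ normrM (ger0_norm (q0 _ _)) ler_pdivrMl ?exprn_gt0//.
  rewrite hornerD; apply: le_trans (ler_normD _ _) _.
  have h1 := hK n j.+1 k x xab; have h2 := hK n j k.+1 x xab.
  rewrite addSn in h1; rewrite addnS in h2; apply: le_trans (lerD h1 h2) _.
  rewrite -subr_ge0 (exprSr _ (j + k).+1) /B.
  have := CA (j + k).+2; move: (A * C ^+ (j + k).+1) (A * C ^+ (j + k).+2) => X Y Y0.
  have N0 : 0 <= n%:R ^+ (j + k).+1 * n%:R :> R by rewrite mulr_ge0 ?exprn_ge0.
  move: (n%:R : R) N0 => M; move: (M ^+ (j + k).+1) => N N0.
  rewrite (_ : _ - _ = 4 * Y * (N * M)); last by ring.
  by rewrite mulr_ge0// mulr_ge0.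
have q2 n x : (0 < n)%N -> a <= x <= b -> `|(q n)^`()^`().[x]| <= B * n%:R ^+ 2.
  move=> n0 xab; have nz : 0 < n%:R :> R by rewrite ltr0n.
  rewrite /q !derivZ kap_deriv derivD !kap_deriv hornerZ normrM (ger0_norm (q0 _ _)).
  rewrite ler_pdivrMl ?exprn_gt0// !hornerD.
  apply: le_trans (ler_normD _ _) _.
  apply: le_trans (lerD (ler_normD _ _) (ler_normD _ _)) _.
  have h1 := hK n j.+2 k x xab; have h2 := hK n j.+1 k.+1 x xab; have h3 := hK n j k.+2 x xab.
  rewrite !addSn in h1; rewrite addSn addnS in h2; rewrite !addnS in h3.
  apply: le_trans (lerD (lerD h1 h2) (lerD h2 h3)) _.
  rewrite -subr_ge0 (exprSr (n%:R : R) (j + k).+2) (exprSr (n%:R : R) (j + k).+1) /B.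
  have := CA (j + k).+1; move: (A * C ^+ (j + k).+1) (A * C ^+ (j + k).+2) => X Y X0.
  have N0 : 0 <= n%:R ^+ (j + k).+1 * (n%:R * n%:R) :> R by rewrite !mulr_ge0 ?exprn_ge0.
  move: (n%:R : R) N0 => M; move: (M ^+ (j + k).+1) => N N0.
  rewrite (_ : _ - _ = 2 * X * (N * (M * M))); last by ring.
  by rewrite mulr_ge0// mulr_ge0.
have iab : intg a b (kst j k) by exact: (intgS (ltW ca) (ltW bd) (intg_kst j k)).
have hq e' : 0 < e' -> \forall n \near \oo, sint a b (fun x => `|(q n).[x] - kst j k x|) <= e'.
  move=> e'0; have := IH k a b e' ca ab bd e'0; apply: filterS => n.
  by congr (sint a b _ <= e'); apply/funext => x; rewrite /q hornerZ mulrC.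
have e2 : 0 < e / 2 by rewrite divr_gt0.
near=> n.
have n0 : (0 < n)%N by near: n; exact: nbhs_infty_gt.
have H1 : sint c1 d1 (fun x => `|(q n)^`().[x] / n%:R|) <= e / 2.
  by near: n; exact: (deriv_L1_small ac cd1 db B0 iab q1 q2 hq e2).
have H2 : sint c1 d1 (fun x => `|(kap p n j k.+1).[x] / n%:R ^+ (j + k.+1).+1 - kst j k.+1 x|)
  <= e / 2 by near: n; exact: IH.
have is0 j' k' : intg c1 d1 (kst j' k') by exact: (intgS (ltW cc1) (ltW dd1) (intg_kst j' k')).
have ip (P : {poly R}) (r : R) : intg c1 d1 (fun x => P.[x] / r).
  by apply: intg_cont; apply: contM; [exact: cont_poly|exact: cont_cst].
apply: (@le_trans _ _ (sint c1 d1 (fun x => `|(q n)^`().[x] / n%:R| +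
   `|(kap p n j k.+1).[x] / n%:R ^+ (j + k.+1).+1 - kst j k.+1 x|))); last first.
  by rewrite sintD; [lra|exact: intg_norm|apply: intg_norm; exact: intgB].
apply: sint_le => [||x _].
- by apply: intg_norm; exact: intgB.
- by apply: intgD; apply: intg_norm => //; exact: intgB.
have -> : (kap p n j.+1 k).[x] / n%:R ^+ (j.+1 + k).+1 - kst j.+1 k x =
   (q n)^`().[x] / n%:R - ((kap p n j k.+1).[x] / n%:R ^+ (j + k.+1).+1 - kst j k.+1 x).
  rewrite kstS /q derivZ kap_deriv hornerZ hornerD addSn addnS (exprSr _ (j + k).+1).
  have nz : (n%:R : R) != 0 by rewrite pnatr_eq0 -lt0n.
  have nkz : (n%:R ^+ (j + k).+1 : R) != 0 by rewrite expf_neq0.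
  move: nkz; move: (n%:R ^+ (j + k).+1 : R) (n%:R : R) nz => N M Mz Nz; field.
  by rewrite Nz Mz.
exact: ler_normB.
Unshelve. all: by end_near.
Qed.

End KappaLimit.

(** * Lebesgue decomposition *)

Section DensityMeasure.
Context {R : realType}.
Notation leb := (@lebesgue_measure R).
Context (w : measurableTypeR R -> R) (mw : measurable_fun setT w) (w0 : forall x, 0 <= w x).

(** The two proofs are arguments so that the measure structure can be attached to this constant. *)
Definition wmeas (_ : measurable_fun setT w) (_ : forall x, 0 <= w x)
    (A : set (measurableTypeR R)) : \bar R := (\int[leb]_(x in A) (w x)%:E)%E.

Let wmeas_set0 : wmeas mw w0 set0 = 0%E.
Proof. by rewrite /wmeas integral_set0. Qed.

Let wmeas_ge0 A : (0 <= wmeas mw w0 A)%E.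
Proof. by apply: integral_ge0 => x _; rewrite lee_fin. Qed.

Let wmeas_sigma_additive : semi_sigma_additive (wmeas mw w0).
Proof.
move=> /= F mF tF mUF; rewrite /wmeas; apply: cvg_toP.
  apply: ereal_nondecreasing_is_cvgn => m n mn.
  by apply: lee_sum_nneg_natr => // k _ _; exact: wmeas_ge0.
rewrite ge0_integral_bigcup//=.
- by apply: measurable_funTS; apply: measurableT_comp.
- by move=> x _; rewrite lee_fin.
Qed.

HB.instance Definition _ := isMeasure.Build _ _ _ (wmeas mw w0)
  wmeas_set0 wmeas_ge0 wmeas_sigma_additive.

Context (iw : leb.-integrable setT (EFin \o w)).

Lemma wmeas_fin : fin_num_fun (wmeas mw w0).
Proof.
apply: (lty_fin_num_fun (mu := wmeas mw w0)); rewrite /= /wmeas.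
by rewrite -ge0_fin_numE ?integrable_fin_num//; exact: wmeas_ge0.
Qed.

HB.instance Definition _ := Measure_isFinite.Build _ _ _ (wmeas mw w0) wmeas_fin.

Let wmeas_dom : wmeas mw w0 `<< leb.
Proof.
apply/null_content_dominatesP => A mA lA0.
apply: null_set_integral => //; apply: measurable_funTS.
exact: measurableT_comp.
Qed.

Let wmeas_density : ae_eq leb setT
  (Radon_Nikodym (charge_of_finite_measure (wmeas mw w0)) leb) (EFin \o w).
Proof.
apply: integral_ae_eq => //.
- exact: Radon_Nikodym_integrable.
- exact: measurableT_comp.
by move=> A _ mA; rewrite -Radon_Nikodym_integral.
Qed.

(** w is almost everywhere the Radon-Nikodym derivative of w dx, whose change of variables formula
    covers f of any sign. *)
Lemma integral_wmeas (D : set (measurableTypeR R)) (f : measurableTypeR R -> \bar R) :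
  measurable D -> (wmeas mw w0).-integrable D f ->
  (\int[wmeas mw w0]_(x in D) f x = \int[leb]_(x in D) (f x * (w x)%:E))%E.
Proof.
move=> mD iF; rewrite -(Radon_Nikodym_change_of_variables wmeas_dom mD iF).
have mf : measurable_fun D f by exact: measurable_int iF.
apply: ae_eq_integral => //.
- apply: emeasurable_funM => //; apply: measurable_funTS.
  by apply: measurable_int; exact: Radon_Nikodym_integrable.
- by apply: emeasurable_funM => //; apply: measurable_funTS; exact: measurableT_comp.
- by apply: ae_eqe_mul2l; exact: (ae_eq_subset _ wmeas_density).
Qed.

End DensityMeasure.

Section LebesgueDecomposition.
Context {R : realType}.
Notation leb := (@lebesgue_measure R).
Context (mu : {finite_measure set (measurableTypeR R) -> \bar R}).
Context (w : measurableTypeR R -> R) (mw : measurable_fun setT w) (w0 : forall x, 0 <= w x).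
Context (nu : {measure set (measurableTypeR R) -> \bar R}).
Context (munu : forall A : set (measurableTypeR R), measurable A ->
  mu A = (nu A + \int[leb]_(x in A) (w x)%:E)%E).

Lemma nu_fin (A : set (measurableTypeR R)) : measurable A -> (nu A < +oo)%E.
Proof.
move=> mA; apply: (@le_lt_trans _ _ (mu A)).
  by rewrite munu// leeDl// integral_ge0// => x _; rewrite lee_fin.
by rewrite -ge0_fin_numE// fin_num_measure.
Qed.

Lemma density_integrable : leb.-integrable setT (EFin \o w).
Proof.
apply/integrableP; split; first exact: measurableT_comp.
apply: (@le_lt_trans _ _ (mu setT)).
  rewrite munu// -[leLHS]add0e leeD//.
  rewrite le_eqVlt; apply/orP; left; apply/eqP; apply: eq_integral => x _.
  by rewrite /= ger0_norm.
by rewrite -ge0_fin_numE// fin_num_measure.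
Qed.

Lemma cont_integrable (m : {measure set (measurableTypeR R) -> \bar R})
    (D : set (measurableTypeR R)) (f : R -> R) : measurable D -> (m D < +oo)%E ->
  (forall t, D t -> -1 <= t <= 1) -> continuous f -> m.-integrable D (EFin \o f).
Proof.
move=> mD mfin D1 cf; apply: measurable_bounded_integrable => //.
  by apply: measurable_funTS; exact: continuous_measurable_fun.
have [M _ hM] := cont_bounded (-1) 1 cf; exists M; split; first exact: num_real.
by move=> N MN x /= /D1/hM h; exact: le_trans h (ltW MN).
Qed.

Lemma Rintegral_decomposition (D : set (measurableTypeR R)) (f : R -> R) : measurable D ->
  (forall t, D t -> -1 <= t <= 1) -> continuous f ->
  \int[mu]_(x in D) f x = \int[nu]_(x in D) f x + \int[leb]_(x in D) (f x * w x).
Proof.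
move=> mD D1 cf; have iw := density_integrable.
have imu : mu.-integrable D (EFin \o f).
  by apply: cont_integrable => //; rewrite -ge0_fin_numE// fin_num_measure.
have inu : nu.-integrable D (EFin \o f) by apply: cont_integrable => //; exact: nu_fin.
have iwm : (wmeas mw w0).-integrable D (EFin \o f).
  apply: cont_integrable => //; rewrite -ge0_fin_numE//.
  exact: (wmeas_fin mw w0 iw).
rewrite /Rintegral (eq_measure_integral (measure_add nu (wmeas mw w0))) => [|A mA _]; last first.
  by transitivity (nu A + wmeas mw w0 A)%E; [exact: munu|symmetry; exact: measure_addE].
rewrite integral_measure_add// fineD ?integrable_fin_num//; congr (_ + fine _).
rewrite (integral_wmeas iw mD iwm).
by apply: eq_integral => x _; rewrite -EFinM.
Qed.

End LebesgueDecomposition.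

(** * Cutoff functions *)

Section Cutoff.
Context {R : realType}.

Definition dst (V : set R) (x : R) : R := inf [set `|x - y| | y in V].

Section Distance.
Context (V : set R) (V0 : V !=set0).

Let dlb x : has_lbound [set `|x - y| | y in V].
Proof. by exists 0 => _ [y _ <-]. Qed.

Lemma dst_le (x y : R) : V y -> dst V x <= `|x - y|.
Proof. by move=> Vy; apply: ge_inf => //; exists y. Qed.

Lemma le_dst (x r : R) : (forall y, V y -> r <= `|x - y|) -> r <= dst V x.
Proof.
move=> h; apply: lb_le_inf; first by have [y Vy] := V0; exists `|x - y|, y.
by move=> _ [y Vy <-]; exact: h.
Qed.

Lemma dst_lip (x y : R) : `|dst V x - dst V y| <= `|x - y|.
Proof.
have h (a b : R) : dst V a - dst V b <= `|a - b|.
  rewrite lerBlDr -lerBlDl; apply: le_dst => z Vz.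
  rewrite lerBlDl; apply: le_trans (dst_le a Vz) _.
  exact: ler_distD.
by rewrite ler_norml h andbT lerNl opprB distrC h.
Qed.

Lemma cont_dst : continuous (dst V).
Proof.
move=> x; apply/cvgrPdist_le => e e0; near=> y.
by apply: le_trans (dst_lip _ _) _; near: y; exists e => // y /= /ltW.
Unshelve. all: by end_near.
Qed.

Lemma dst0 x : V x -> dst V x = 0.
Proof.
move=> Vx; apply/eqP; rewrite eq_le le_dst// andbT.
by have := dst_le x Vx; rewrite subrr normr0.
Qed.

Lemma dst_gt0 x : closed V -> ~ V x -> 0 < dst V x.
Proof.
move=> cV nVx; have : nbhs x (~` V) by apply: open_nbhs_nbhs; split => //; exact: closed_openC.
move=> [r /= r0 hr]; apply: lt_le_trans r0 _; apply: le_dst => y Vy.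
by rewrite leNgt; apply/negP => xy; exact: (hr y).
Qed.

End Distance.

(** The positive part of 1 - k dist(x, V), written with an absolute value so that continuity is
    immediate. *)
Definition tent (V : set R) (k : nat) (x : R) : R :=
  ((1 - k%:R * dst V x) + `|1 - k%:R * dst V x|) / 2.

Lemma tentE V k x : tent V k x = Num.max 0 (1 - k%:R * dst V x).
Proof.
rewrite /tent; have [h|/ltW h] := leP 0 (1 - k%:R * dst V x).
  by rewrite ger0_norm//; lra.
by rewrite ler0_norm// subrr mul0r.
Qed.

Lemma cont_tent V k : V !=set0 -> continuous (tent V k).
Proof.
move=> V0; have c1 : continuous (fun x => 1 - k%:R * dst V x).
  by apply: contB; [exact: cont_cst|apply: contZ; exact: cont_dst].
apply: contM; last exact: cont_cst.
apply: contD => //; apply: (cont_comp c1) => x; exact: norm_continuous.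
Qed.

Lemma tent01 V k x : V !=set0 -> 0 <= tent V k x <= 1.
Proof.
move=> V0; rewrite tentE le_max lexx ge_max ler01 /= gerBl mulr_ge0//.
by apply: le_dst => // y _.
Qed.

(** The tents over the closed set V tend pointwise to its indicator, which has [nu]-integral 0, so
    dominated convergence makes their integrals small. *)
Lemma cutoff (nu : {measure set (measurableTypeR R) -> \bar R}) (V : set R)
    (D : set (measurableTypeR R)) (c d c1 d1 e : R) : measurable D -> (nu D < +oo)%E ->
  compact V -> V `<=` `[c1, d1] -> nu V = 0%E -> c < c1 -> d1 < d -> 0 < e ->
  exists psi : R -> R, [/\ continuous psi, forall x, 0 <= psi x <= 1,
     forall x, ~~ (c <= x <= d) -> psi x = 0, forall x, V x -> psi x = 1 &
     \int[nu]_(x in D) psi x <= e].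
Proof.
move=> mD nD cV Vcd nuV cc1 dd1 e0.
have [->|/set0P V0] := eqVneq V set0.
  exists (fun=> 0); split=> //; first exact: cont_cst.
    by move=> x; rewrite lexx ler01.
  by rewrite Rintegral_cst// mul0r ltW.
have clV : closed V by exact: compact_closed.
have mV : measurable (V : set (measurableTypeR R)) by exact: closed_measurable.
pose r0 := Num.min (c1 - c) (d - d1).
have r00 : 0 < r0 by rewrite lt_min !subr_gt0 cc1.
have hout x : ~~ (c <= x <= d) -> r0 <= dst V x.
  move=> xcd; apply: le_dst => // y /Vcd; rewrite /= in_itv /= => /andP[y1 y2].
  move: xcd; rewrite negb_and -!ltNge => /orP[xc|dx].
    by apply: (@le_trans _ _ (c1 - c)); [rewrite ge_min lexx|rewrite ler0_norm; lra].
  by apply: (@le_trans _ _ (d - d1)); [rewrite ge_min lexx orbT|rewrite ger0_norm; lra].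
have mb k : measurable_fun D (EFin \o tent V k).
  apply/measurable_EFinP; apply: measurable_funTS; apply: continuous_measurable_fun.
  exact: cont_tent.
have bcvg x : D x -> (EFin \o tent V n) x @[n --> \oo] --> (EFin \o (\1_V : R -> R)) x.
  move=> _; rewrite /= indicE; have [Vx|nVx] := boolP (x \in V).
    have -> : (fun n => (tent V n x)%:E) = cst 1%:E; last exact: cvg_cst.
    apply/funext => n; rewrite tentE dst0//; last by rewrite inE in Vx.
    by rewrite mulr0 subr0 max_r.
  have px : 0 < dst V x by apply: dst_gt0 => //; rewrite notin_setE in nVx.
  apply: cvg_near_cst; near=> n; congr EFin; rewrite tentE max_l//.
  rewrite subr_le0 -ler_pdivrMr// mul1r; near: n; exact: nbhs_infty_ger.
have i1 : nu.-integrable D (cst 1%E).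
  by apply/integrableP; split => //; rewrite integral_cst/= ?normr1 ?mul1e.
have hdom : (\int[nu]_(x in D) (EFin \o tent V n) x)%E @[n --> \oo] -->
    (\int[nu]_(x in D) (EFin \o (\1_V : R -> R)) x)%E.
  apply: (dominated_cvg mD mb bcvg _ i1) => // n x _ /=; rewrite lee_fin.
  by have /andP[b0 b1] := tent01 n x V0; rewrite ger0_norm.
have lim0 : (\int[nu]_(x in D) (EFin \o (\1_V : R -> R)) x = 0)%E.
  rewrite integral_indic//; apply/eqP; rewrite -measure_le0 -nuV.
  by apply: le_measure; rewrite ?inE//; apply: measurableI.
rewrite lim0 in hdom.
have hn : nbhs (0 : \bar R)%E [set y | (y < e%:E)%E].
  by apply: open_nbhs_nbhs; split; [exact: open_ereal_lt_ereal|rewrite /= lte_fin].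
have [N _ hN] : \forall n \near \oo, (\int[nu]_(x in D) (EFin \o tent V n) x < e%:E)%E.
  exact: (hdom _ hn).
(* k >= N makes the integral small, and k >= 1 / r0 makes the tent vanish outside [c, d]. *)
have [k kr] : exists k, (N <= k)%N /\ r0^-1 <= k%:R.
  have [K _ hK] := nbhs_infty_ger r0^-1; exists (maxn N K).
  by split; [exact: leq_maxl|apply: hK; exact: leq_maxr].
exists (tent V k); split.
- exact: cont_tent.
- by move=> x; exact: tent01.
- move=> x /hout hx; rewrite tentE max_l// subr_le0.
  have [_ kr2] := kr; have rz : r0 != 0 by rewrite gt_eqF.
  by rewrite -[leLHS](mulVf rz); apply: ler_pM; [by rewrite invr_ge0 ltW|exact: ltW|exact: kr2|exact: hx].
- by move=> x Vx; rewrite tentE dst0// mulr0 subr0 max_r.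
have [Nk _] := kr; have h := hN k Nk.
have I0 : (0 <= \int[nu]_(x in D) (EFin \o tent V k) x)%E.
  by apply: integral_ge0 => x _; rewrite lee_fin; case/andP: (tent01 k x V0).
rewrite -lee_fin /Rintegral fineK; first exact: ltW.
by rewrite ge0_fin_numE//; exact: lt_trans h (ltry _).
Unshelve. all: by end_near.
Qed.

End Cutoff.

Section Decomposed.
Context {R : realType}.
Notation leb := (@lebesgue_measure R).
Notation Lam := (@Lam R).
Context (mu : {finite_measure set (measurableTypeR R) -> \bar R}).
Context (w : measurableTypeR R -> R) (mw : measurable_fun setT w) (w0 : forall x, 0 <= w x).
Context (nu : {measure set (measurableTypeR R) -> \bar R}).
Context (munu : forall A : set (measurableTypeR R), measurable A ->
  mu A = (nu A + \int[leb]_(x in A) (w x)%:E)%E).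
Context (N : set (measurableTypeR R)) (mN : measurable N) (nuN : nu N = 0%E).
Context (lebN : leb (~` N) = 0%E).
Context (c d : R) (c_1 : -1 < c) (cd : c < d) (d_1 : d < 1).
Context (m : R) (m0 : 0 < m).
Context (wm : {ae leb, forall x : measurableTypeR R, x \in `[c, d] -> m <= w x}).

Let D : set (measurableTypeR R) := `]-1, 1[.
Let mD : measurable D. Proof. exact: measurable_itv. Qed.
Let D1 t : D t -> -1 <= t <= 1.
Proof. by rewrite /D /= in_itv /= => /andP[? ?]; rewrite !ltW. Qed.
Let lebD : (leb D < +oo)%E.
Proof. by rewrite /D lebesgue_measure_itv /= lte_fin; case: ifP => _; rewrite ltry. Qed.
Let cdD : `[c, d] `<=` D.
Proof.
move=> x; rewrite /D /= !in_itv /= => /andP[cx xd].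
by rewrite (lt_le_trans c_1 cx) (le_lt_trans xd d_1).
Qed.

Definition wfloor (x : R) : R := Num.max (w x) m.

Definition lmu (f : R -> R) : R := \int[mu]_(x in D) f x.

Lemma posfun_measure (m' : {measure set (measurableTypeR R) -> \bar R}) (rho : R -> R) :
  (forall t, D t -> 0 <= rho t) -> m'.-integrable D (EFin \o rho) ->
  posfun (fun f => \int[m']_(x in D) (f x * rho x)).
Proof. by move=> rho0 irho; apply: (@posfun_int _ m' D id rho) => // x; exact: cvg_id. Qed.

Lemma posfun_finite (m' : {measure set (measurableTypeR R) -> \bar R}) :
  (m' D < +oo)%E -> posfun (fun f => \int[m']_(x in D) f x).
Proof.
move=> fin; have -> : (fun f : R -> R => \int[m']_(x in D) f x) =
    (fun f => \int[m']_(x in D) (f x * 1)).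
  by apply/funext => f; apply: eq_Rintegral => x _; rewrite mulr1.
by apply: posfun_measure => //; exact: (cont_integrable mD fin D1 (cont_cst 1)).
Qed.

Lemma posfun_add (l1 l2 : (R -> R) -> R) : posfun l1 -> posfun l2 ->
  posfun (fun f => l1 f + l2 f).
Proof.
move=> h1 h2; split=> [a f g cf cg|f cf f0].
  by rewrite (posfunP h1 a cf cg) (posfunP h2 a cf cg); ring.
by rewrite addr_ge0 ?(posfun_ge0 h1) ?(posfun_ge0 h2).
Qed.

Lemma posfun_lmu : posfun lmu.
Proof. by apply: posfun_finite; rewrite -ge0_fin_numE// fin_num_measure. Qed.

Lemma measurable_wfloor : measurable_fun setT wfloor.
Proof. by apply: measurable_maxr => //; exact: measurable_cst. Qed.

Lemma wfloor_ge x : m <= wfloor x.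
Proof. by rewrite le_max lexx orbT. Qed.

Let iw : leb.-integrable setT (EFin \o w) := density_integrable mw w0 munu.

Let iwI : intg c d w.
Proof. exact: (integrableS measurableT). Qed.

Lemma intg_wfloor : intg c d wfloor.
Proof.
have i2 : intg c d (fun x => w x + `|m|).
  by apply: intgD => //; exact: intg_cont (cont_cst _).
apply: (le_integrable _ _ _ i2) => // [|x _].
  by apply/measurable_EFinP/measurable_funTS; exact: measurable_wfloor.
rewrite /= lee_fin [leRHS]ger0_norm ?addr_ge0// ger0_norm; last by rewrite (le_trans (w0 x))// le_max lexx.
by rewrite ge_max lerDl normr_ge0 /= (le_trans (ler_norm _))// lerDr.
Qed.

Lemma sint_wfloor (F : R -> R -> R) :
  (forall h : R -> R, measurable_fun setT h -> measurable_fun setT (fun x => F (h x) x)) ->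
  sint c d (fun x => F (wfloor x) x) = sint c d (fun x => F (w x) x).
Proof.
move=> mF; rewrite /sint /Rintegral; congr fine; apply: ae_eq_integral => //.
- by apply/measurable_EFinP/measurable_funTS; apply: mF; exact: measurable_wfloor.
- by apply/measurable_EFinP/measurable_funTS; exact: mF.
apply: filterS wm => x h /= xcd; rewrite /wfloor max_l//; apply: h.
by rewrite inE.
Qed.

Lemma sint_wfloor_le (f : R -> R) : continuous f -> (forall x, 0 <= f x) ->
  sint c d (fun x => wfloor x * f x) <= lmu f.
Proof.
move=> cf f0; have mf := continuous_measurable_fun cf.
rewrite (@sint_wfloor (fun u x => u * f x)); last first.
  by move=> h mh; apply: measurable_funM.
rewrite /lmu (Rintegral_decomposition mw w0 munu mD D1 cf).
have nu0 : 0 <= \int[nu]_(x in D) f x by apply: Rintegral_ge0.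
apply: (@le_trans _ _ (\int[leb]_(x in D) (f x * w x))); last by rewrite lerDr.
have iD : leb.-integrable D (EFin \o (fun x => f x * w x)).
  apply: (integrable_cont_mul mD (X := id) (rho := w)) => //.
    by move=> x; exact: cvg_id.
  exact: (integrableS measurableT).
have iI : intg c d (fun x => w x * f x) by exact: intgM_cont.
apply: fine_le; [exact: integrable_fin_num iI|exact: integrable_fin_num iD|].
under eq_integral do rewrite mulrC.
apply: ge0_subset_integral => //.
- exact: measurable_int iD.
- by move=> x _; rewrite lee_fin mulr_ge0.
Qed.

(** N is null for [nu] and of full Lebesgue measure. Inner regularity gives a compact V inside N and
    [c1, d1] that misses little of [c1, d1]; a cutoff over V is 1 on V and nearly invisible for
    [nu]. *)
Lemma nearly_one_cutoff (c1 d1 e : R) : c < c1 -> d1 < d -> 0 < e ->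
  exists psi : R -> R, [/\ continuous psi, forall x, 0 <= psi x <= 1,
    forall x, ~~ (c <= x <= d) -> psi x = 0,
    sint c1 d1 (fun x => 1 - psi x) <= e & \int[nu]_(x in D) psi x <= e].
Proof.
move=> cc1 dd1 e0; pose A := N `&` (`[c1, d1] : set (measurableTypeR R)).
have mA : measurable A by exact: measurableI.
have lcd : (leb (`[c1, d1] : set (measurableTypeR R)) < +oo)%E.
  by rewrite lebesgue_measure_itv /= lte_fin; case: ifP => _; rewrite ltry.
have lA : (leb A < +oo)%E.
  by apply: le_lt_trans lcd; apply: le_measure; rewrite ?inE//; exact: subIsetr.
have [V [cV VA lV]] := lebesgue_regularity_inner mA lA e0.
have VN : V `<=` N by move=> x /VA[].
have Vcd : V `<=` `[c1, d1] by move=> x /VA[].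
have mV : measurable (V : set (measurableTypeR R)).
  by apply: closed_measurable; apply: compact_closed => //; exact: Rhausdorff.
have nuV : nu V = 0%E.
  by apply/eqP; rewrite -measure_le0 -nuN; apply: le_measure; rewrite ?inE.
have nuD : (nu D < +oo)%E by exact: (nu_fin w0 munu).
have [psi [cpsi psi01 psi0 psi1 ipsi]] := cutoff mD nuD cV Vcd nuV cc1 dd1 e0.
exists psi; split=> //.
have mVC : measurable (~` V : set (measurableTypeR R)) by exact: measurableC.
have mI : measurable_fun setT (\1_(~` V) : measurableTypeR R -> R) by exact: measurable_indic.
have i1 : intg c1 d1 (\1_(~` V) : R -> R).
  apply: (@intg_bounded _ _ _ _ 1 mI) => x _.
  by rewrite indicE; case: (_ \in _); rewrite ?normr1 ?normr0.
apply: (@le_trans _ _ (sint c1 d1 (\1_(~` V) : R -> R))).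
  apply: sint_le => // [|x _].
    by apply: intg_cont; apply: contB => //; exact: cont_cst.
  rewrite indicE; have [|] := boolP (x \in ~` V).
    by move=> _; rewrite gerBl; case/andP: (psi01 x).
  by rewrite notin_setE /= => /contrapT/psi1 ->; rewrite subrr.
rewrite -lee_fin /sint /Rintegral fineK; last exact: integrable_fin_num i1.
rewrite integral_indic//.
have sub : (~` V) `&` (`[c1, d1] : set (measurableTypeR R)) `<=` (A `\` V) `|` ~` N.
  move=> x [nVx xcd]; have [Nx|nNx] := pselect (N x); last by right.
  by left; split.
have mAV : measurable (A `\` V) by exact: measurableD.
have mNC : measurable (~` N) by exact: measurableC.
have h1 : (leb ((~` V) `&` (`[c1, d1] : set (measurableTypeR R))) <=
           leb ((A `\` V) `|` ~` N))%E.
  apply: le_measure => //; rewrite inE; [exact: measurableI|exact: measurableU].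
apply: le_trans h1 _; apply: le_trans (measureU2 _ mAV mNC) _.
apply: (@le_trans _ _ (leb (A `\` V) + leb (~` N))%E); first exact: lexx.
by rewrite lebN adde0 ltW.
Qed.

Lemma wfloor_approx (e : R) : 0 < e -> exists wt : R -> R,
  [/\ continuous wt, forall x, 0 <= wt x,
     leb.-integrable D (EFin \o (fun x => `|w x - wt x|)),
     \int[leb]_(x in D) `|w x - wt x| <= e &
     sint c d (fun x => `|wt x - wfloor x|) <= e].
Proof.
move=> e0; have iD : leb.-integrable D (EFin \o w) by exact: (integrableS measurableT).
have [g [cg ig gw]] := @approximation_continuous_integrable R D w mD lebD iD.
have hn : nbhs (0 : \bar R)%E [set y | (y < e%:E)%E].
  by apply: open_nbhs_nbhs; split; [exact: open_ereal_lt_ereal|rewrite /= lte_fin].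
have [K _ /(_ K (leqnn K)) /= hK] := gw _ hn.
(* As w >= 0, taking absolute values does not worsen the approximation. *)
pose wt x := `|g K x|.
have cwt : continuous wt by apply: (cont_comp (cg K)) => x; exact: norm_continuous.
have iwt : leb.-integrable D (EFin \o wt) by exact: (cont_integrable mD lebD D1 cwt).
have id1 : leb.-integrable D (EFin \o (fun x => `|w x - wt x|)).
  by apply: integrable_norm; exact: (integrableB mD iD iwt).
have id2 : leb.-integrable D (EFin \o (fun x => `|w x - g K x|)).
  by apply: integrable_norm; exact: (integrableB mD iD (ig K)).
have le1 : \int[leb]_(x in D) `|w x - wt x| <= e.
  apply: (@le_trans _ _ (\int[leb]_(x in D) `|w x - g K x|)).
    apply: le_Rintegral => // x _; rewrite /wt.
    by rewrite -{1}(ger0_norm (w0 x)); exact: ler_dist_dist.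
  rewrite -lee_fin /Rintegral fineK; first exact: ltW.
  exact: integrable_fin_num id2.
exists wt; split; [exact: cwt|by move=> x; exact: normr_ge0|exact: id1|exact: le1|].
apply: le_trans le1.
rewrite (@sint_wfloor (fun u x => `|wt x - u|)); last first.
  move=> h mh; apply: measurableT_comp => //; apply: measurable_funB => //.
  exact: continuous_measurable_fun.
have id3 : intg c d (fun x => `|w x - wt x|).
  by apply: intg_norm; apply: intgB => //; exact: intg_cont.
under [X in sint _ _ X]eq_fun do rewrite distrC.
apply: fine_le; [exact: integrable_fin_num id3|exact: integrable_fin_num id1|].
apply: ge0_subset_integral => //; first exact: measurable_int id1.
Qed.

Lemma approximants : exists2 M0 : R, 0 <= M0 &
  forall e c1 d1 : R, 0 < e -> c < c1 -> c1 <= d1 -> d1 < d ->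
  exists (psi wt : R -> R) (ls : (R -> R) -> R),
  [/\ continuous psi, forall x, 0 <= psi x <= 1,
     forall x, ~~ (c <= x <= d) -> psi x = 0,
     sint c1 d1 (fun x => 1 - psi x) <= e &
  [/\ continuous wt, forall x, 0 <= wt x & sint c d (fun x => `|wt x - wfloor x|) <= e] /\
  [/\ posfun ls, ls psi <= e, ls (fun=> 1) <= M0 &
   forall f : R -> R, continuous f -> (forall x, 0 <= f x) ->
     lmu f <= Lam (fun x => pi * arcw x * wt x * f x) + ls f]].
Proof.
have nuD : (nu D < +oo)%E by exact: (nu_fin w0 munu).
exists (\int[nu]_(x in D) 1 + 1); first by rewrite addr_ge0// Rintegral_ge0.
(* The bound 1 keeps [ls] of the constant 1 below the mass of [nu] plus 1; e / 2 is shared by the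
   singular part and the L^1 error of [wt]. *)
move=> e c1 d1 e0 cc1 cd1 dd1; pose e1 := Num.min 1 (e / 2).
have e10 : 0 < e1 by rewrite lt_min ltr01 divr_gt0.
have e11 : e1 <= 1 by rewrite ge_min lexx.
have e12 : e1 <= e / 2 by rewrite ge_min lexx orbT.
have e1e : e1 <= e by lra.
have [psi [cpsi psi01 psi0 ipsi npsi]] := nearly_one_cutoff cc1 dd1 e10.
have [wt [cwt wt0 iwt hwt swt]] := wfloor_approx e10.
pose rho x := `|w x - wt x|.
(* Since w <= wt + rho, mu is dominated by wt dx plus this functional. *)
pose ls f := \int[nu]_(x in D) f x + \int[leb]_(x in D) (f x * rho x).
have rho0 t : D t -> 0 <= rho t by move=> _; exact: normr_ge0.
have pls : posfun ls.
  by apply: posfun_add; [exact: posfun_finite|exact: posfun_measure].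
exists psi, wt, ls; split=> //; first exact: le_trans ipsi e1e.
split; first by split=> //; exact: le_trans swt e1e.
have irho (f : R -> R) : continuous f -> leb.-integrable D (EFin \o (fun x => f x * rho x)).
  move=> cf; apply: (integrable_cont_mul mD (X := id) (rho := rho)) => // x.
  exact: cvg_id.
split=> //.
- have : \int[leb]_(x in D) (psi x * rho x) <= \int[leb]_(x in D) rho x.
    apply: le_Rintegral => //; first exact: irho.
    by move=> x _; rewrite ler_piMl ?normr_ge0//; case/andP: (psi01 x).
  move=> h; apply: le_trans (lerD npsi (le_trans h hwt)) _.
  by rewrite [leRHS]splitr; exact: lerD.
- rewrite /ls lerD2l; under eq_Rintegral do rewrite mul1r.
  exact: le_trans hwt e11.
move=> f cf f0; rewrite /lmu (Rintegral_decomposition mw w0 munu mD D1 cf) /ls.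
rewrite [leRHS]addrCA lerD2l.
have iw1 : leb.-integrable D (EFin \o (fun x => f x * w x)).
  apply: (integrable_cont_mul mD (X := id) (rho := w)) => //.
    by move=> x; exact: cvg_id.
  exact: (integrableS measurableT).
have cfw : continuous (fun x => wt x * f x) by exact: contM.
have iw2 : leb.-integrable D (EFin \o (fun x => wt x * f x)).
  exact: (cont_integrable mD lebD D1 cfw).
under [X in Lam X]eq_fun do rewrite -mulrA.
rewrite (Lam_arcw cfw).
apply: (@le_trans _ _ (\int[leb]_(x in D) (wt x * f x) + \int[leb]_(x in D) (f x * rho x))).
  rewrite -RintegralD//; last exact: irho.
  apply: le_Rintegral => //.
    exact: (integrableD mD iw2 (irho f cf)).
  move=> x _; rewrite mulrC [f x * _]mulrC -mulrDl ler_wpM2r//.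
  by rewrite -lerBlDl ler_norm.
rewrite lerD2r; apply: fine_le; first exact: integrable_fin_num iw2.
  exact: integrable_fin_num (intg_cont (-1) 1 cfw).
apply: ge0_subset_integral => //.
- by apply/measurable_EFinP/measurable_funTS; exact: continuous_measurable_fun.
- by move=> x _; rewrite lee_fin mulr_ge0.
Qed.

End Decomposed.

Local Open Scope complex_scope.

(** * Complex exponential and sine kernel *)

Section ComplexModulus.
Context {R : realType}.
Implicit Types (z w : R[i]) (x : R).

Lemma cmodM z w : cmod (z * w) = cmod z * cmod w.
Proof. exact: ComplexField.Normc.normcM. Qed.

Lemma cmod0 : cmod (0 : R[i]) = 0.
Proof. exact: ComplexField.Normc.normc0. Qed.

Lemma cmod1 : cmod (1 : R[i]) = 1.
Proof. exact: ComplexField.Normc.normc1. Qed.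

Lemma cmod_eq0 z : cmod z = 0 -> z = 0.
Proof. exact: ComplexField.Normc.eq0_normc. Qed.

Lemma cmodV z : cmod z^-1 = (cmod z)^-1.
Proof. exact: ComplexField.Normc.normcV. Qed.

Lemma cmodX z n : cmod (z ^+ n) = cmod z ^+ n.
Proof. by elim: n => [|n IH]; rewrite ?expr0 ?cmod1// !exprS cmodM IH. Qed.

Lemma cmodD z w : cmod (z + w) <= cmod z + cmod w.
Proof. exact: le_normcD. Qed.

Lemma cmodN z : cmod (- z) = cmod z.
Proof. exact: normcN. Qed.

Lemma cmodB z w : cmod (z - w) <= cmod z + cmod w.
Proof. by rewrite -(cmodN w); exact: cmodD. Qed.

Lemma cmod_ge0 z : 0 <= cmod z.
Proof. by case: z => x y; exact: sqrtr_ge0. Qed.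

Lemma cmodC x : cmod x%:C = `|x|.
Proof. by rewrite /cmod /= expr0n /= addr0 sqrtr_sqr. Qed.

Lemma cmod_sum (I : Type) (r : seq I) (P : pred I) (F : I -> R[i]) :
  cmod (\sum_(i <- r | P i) F i) <= \sum_(i <- r | P i) cmod (F i).
Proof.
elim/big_rec2: _ => [|i y z _ h]; first by rewrite cmod0.
by apply: le_trans (cmodD _ _) _; rewrite lerD2l.
Qed.

Lemma natCE n : (n%:R : R[i]) = (n%:R : R)%:C.
Proof. by rewrite rmorph_nat. Qed.

Lemma cmod_nat n : cmod (n%:R : R[i]) = n%:R.
Proof. by rewrite natCE cmodC normr_nat. Qed.

(** Only indices outside Q remain, and W is nonnegative there. All truncation errors of double
    series below go through this. *)
Lemma sub_sum_cmod (I : finType) (P Q : pred I) (a : I -> R[i]) (W : I -> R) :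
  (forall i, Q i -> P i) -> (forall i, cmod (a i) <= W i) ->
  cmod (\sum_(i | P i) a i - \sum_(i | Q i) a i) <= \sum_i W i - \sum_(i | Q i) W i.
Proof.
move=> QP aW; rewrite (bigID Q P) /= (bigID Q (fun=> true)) /=.
have -> : \sum_(i | P i && Q i) a i = \sum_(i | Q i) a i.
  by apply: eq_bigl => i; rewrite andb_idl//; exact: QP.
rewrite addrAC subrr add0r addrAC subrr add0r.
apply: le_trans (cmod_sum _ _ _) _.
apply: (@le_trans _ _ (\sum_(i | P i && ~~ Q i) W i)); first exact: ler_sum.
rewrite big_mkcond [leRHS]big_mkcond /=; apply: ler_sum => i _.
have W0 : 0 <= W i by exact: le_trans (cmod_ge0 _) (aW i).
by case: (P i); case: (Q i).
Qed.

End ComplexModulus.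

Section DoubleSums.

Lemma sum_square (V : nmodType) N M (a : nat -> nat -> V) : (N <= M)%N ->
  \sum_(p : 'I_M * 'I_M | (p.1 < N)%N && (p.2 < N)%N) a p.1 p.2 =
  \sum_(j < N) \sum_(k < N) a j k.
Proof.
move=> NM; rewrite -(pair_big (fun j : 'I_M => (j < N)%N) (fun k : 'I_M => (k < N)%N)
  (fun j k => a j k)) /= [RHS](big_ord_widen M (fun j => \sum_(k < N) a j k))//.
by apply: eq_bigr => j _; rewrite (big_ord_widen M (a j)).
Qed.

Lemma sum_triangle (V : nmodType) M (a : nat -> nat -> V) :
  \sum_(p : 'I_M * 'I_M | (p.1 + p.2 < M)%N) a p.1 p.2 =
  \sum_(l < M) \sum_(j < l.+1) a j (l - j)%N.
Proof.
have -> : \sum_(p : 'I_M * 'I_M | (p.1 + p.2 < M)%N) a p.1 p.2 =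
    \sum_(j < M) \sum_(k < M - j) a j k.
  rewrite -(pair_big_dep xpredT (fun (j k : 'I_M) => (j + k < M)%N) (fun j k => a j k)) /=.
  apply: eq_bigr => j _; rewrite (big_ord_widen M (a j)) ?leq_subr//.
  by apply: eq_bigl => k; rewrite ltn_subRL.
elim: M => [|M IH]; first by rewrite !big_ord0.
rewrite [RHS]big_ord_recr /= -IH big_ord_recr /= subSn// subnn big_ord1.
rewrite [in RHS]big_ord_recr /= subnn addrA -big_split /=; congr (_ + _).
by apply: eq_bigr => j _; rewrite subSn ?(ltnW (ltn_ord j))// big_ord_recr.
Qed.

(** The binomial theorem, degree by degree; the weight h sees only the total degree. *)
Lemma sum_triangle_exp (F : numFieldType) M (u v : F) (h : nat -> F) :
  \sum_(p : 'I_M * 'I_M | (p.1 + p.2 < M)%N)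
     u ^+ p.1 / p.1`!%:R * (v ^+ p.2 / p.2`!%:R) * h (p.1 + p.2)%N =
  \sum_(l < M) h l * ((u + v) ^+ l / l`!%:R).
Proof.
rewrite (@sum_triangle _ M (fun j k => u ^+ j / j`!%:R * (v ^+ k / k`!%:R) * h (j + k)%N)).
have fz i : (i`!%:R : F) != 0 by rewrite pnatr_eq0 -lt0n fact_gt0.
apply: eq_bigr => l _; rewrite addrC exprDn mulr_suml mulr_sumr.
apply: eq_bigr => j _; have jl : (j <= l)%N by rewrite -ltnS.
rewrite subnKC// -(bin_fact jl) -mulr_natr !natrM invfM invfM.
have bz : ('C(l, j)%:R : F) != 0 by rewrite pnatr_eq0 -lt0n bin_gt0.
by field; rewrite !fz bz.
Qed.

End DoubleSums.

Section ExponentialSums.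
Context {R : realType}.

Definition Esum n (x : R) : R := \sum_(k < n) x ^+ k / k`!%:R.
Definition Fsum n (z : R[i]) : R[i] := \sum_(k < n) z ^+ k / k`!%:R.

Lemma cvg_Esum x : Esum n x @[n --> \oo] --> expR x.
Proof.
have -> : (fun n => Esum n x) = series (exp_coeff x).
  by apply/funext => n; rewrite /Esum /series /= big_mkord.
have -> : expR x = limn (series (exp_coeff x)) by [].
exact: is_cvg_series_exp_coeff.
Qed.

Lemma Esum_le n m (x : R) : 0 <= x -> (n <= m)%N -> Esum n x <= Esum m x.
Proof.
move=> x0 nm; rewrite /Esum (big_ord_widen m (fun k => x ^+ k / k`!%:R))//.
rewrite [leLHS]big_mkcond; apply: ler_sum => i _; case: ifP => // _.
by rewrite divr_ge0// exprn_ge0.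
Qed.

Lemma Esum_expR n (x : R) : 0 <= x -> Esum n x <= expR x.
Proof.
move=> x0; rewrite -(cvg_lim (@Rhausdorff R) (@cvg_Esum x)).
apply: (@nondecreasing_cvgn_le R (fun n => Esum n x)).
  by move=> a b ab; exact: Esum_le.
by apply/cvg_ex; exists (expR x); exact: cvg_Esum.
Qed.

Lemma Esum_ge0 n (x : R) : 0 <= x -> 0 <= Esum n x.
Proof. by move=> x0; apply: sumr_ge0 => k _; rewrite divr_ge0// exprn_ge0. Qed.

(** For x, y >= 0, the part of the double series of exp(x) exp(y) outside the square of side n. *)
Definition exp_tail n (x y : R) : R := expR x * expR y - Esum n x * Esum n y.

Lemma exp_tail_cvg x y (e : R) : 0 < e -> \forall n \near \oo, exp_tail n x y <= e.
Proof.
move=> e0; have : Esum n x * Esum n y @[n --> \oo] --> expR x * expR y.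
  by apply: cvgM; exact: cvg_Esum.
move=> /cvgrPdist_le /(_ e e0); apply: filterS => n.
by rewrite ler_norml => /andP[_].
Qed.

Section Domination.
Context (a : nat -> nat -> R[i]) (x y : R) (x0 : 0 <= x) (y0 : 0 <= y).
Context (ha : forall j k, cmod (a j k) <= x ^+ j / j`!%:R * (y ^+ k / k`!%:R)).

Lemma sum_dominating M : \sum_(p : 'I_M * 'I_M) x ^+ p.1 / p.1`!%:R * (y ^+ p.2 / p.2`!%:R) =
  Esum M x * Esum M y.
Proof. by rewrite /Esum big_distrlr /= pair_bigA. Qed.

(** The bound is independent of M and P, so squares and triangles of any larger size are all within
    the same tail of the N-square. *)
Lemma sum_dominated N M (P : pred ('I_M * 'I_M)) : (N <= M)%N ->
  (forall p : 'I_M * 'I_M, (p.1 < N)%N && (p.2 < N)%N -> P p) ->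
  cmod (\sum_(p | P p) a p.1 p.2 - \sum_(j < N) \sum_(k < N) a j k) <= exp_tail N x y.
Proof.
move=> NM NP; rewrite -(sum_square a NM).
have h := sub_sum_cmod (a := fun p : 'I_M * 'I_M => a p.1 p.2) NP (fun p => ha p.1 p.2).
apply: le_trans h _; rewrite sum_dominating.
rewrite (sum_square (fun j k => x ^+ j / j`!%:R * (y ^+ k / k`!%:R)) NM).
have -> : \sum_(j < N) \sum_(k < N) x ^+ j / j`!%:R * (y ^+ k / k`!%:R) = Esum N x * Esum N y.
  by rewrite /Esum big_distrlr.
rewrite /exp_tail lerD2r.
by apply: ler_pM; rewrite ?Esum_ge0// Esum_expR.
Qed.

Lemma square_dominated N M : (N <= M)%N ->
  cmod (\sum_(j < M) \sum_(k < M) a j k - \sum_(j < N) \sum_(k < N) a j k) <= exp_tail N x y.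
Proof.
move=> NM; have := @sum_dominated N M xpredT NM (fun _ _ => erefl).
by rewrite (pair_bigA _ (fun j k : 'I_M => a j k)).
Qed.

Lemma triangle_dominated N M : (N.*2 <= M)%N ->
  cmod (\sum_(p : 'I_M * 'I_M | (p.1 + p.2 < M)%N) a p.1 p.2 -
        \sum_(j < N) \sum_(k < N) a j k) <= exp_tail N x y.
Proof.
rewrite -addnn => NM; apply: sum_dominated; first exact: leq_trans (leq_addl _ _) NM.
move=> [j k] /= /andP[jN kN]; apply: leq_trans NM.
by rewrite -addnS leq_add// ltnW.
Qed.

End Domination.

Let iz : R[i] := 0 +i* 1.

Lemma izX n : iz ^+ n = if odd n then (-1) ^+ n./2 * iz else (-1) ^+ n./2.
Proof.
have i2 : iz ^+ 2 = -1 by rewrite expr2 /iz; simpc; congr (_ +i* _); rewrite ?oppr0.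
rewrite -{1}[n]odd_double_half -mul2n exprD exprM i2.
by case: ifP => _; rewrite ?expr1 ?expr0 ?mul1r// mulrC.
Qed.

Definition cosum n (y : R) : R := series (cos_coeff y) n.
Definition sisum n (y : R) : R := series (sin_coeff y) n.

Lemma Fsum_real n (x : R) : Fsum n x%:C = (Esum n x)%:C.
Proof.
rewrite /Fsum /Esum rmorph_sum; apply: eq_bigr => k _ /=.
by rewrite natCE -rmorphXn -fmorphV -rmorphM.
Qed.

Lemma Fsum_im n (y : R) : Fsum n (iz * y%:C) = (cosum n y)%:C + iz * (sisum n y)%:C.
Proof.
rewrite /cosum /sisum /series /= !big_mkord !rmorph_sum mulr_sumr -big_split /=.
apply: eq_bigr => k _; rewrite /cos_coeff /sin_coeff /= exprMn izX.
rewrite natCE -rmorphXn -fmorphV.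
have m1 i : ((-1) ^+ i : R[i]) = ((-1) ^+ i : R)%:C by rewrite rmorphXn rmorphN1.
have k2 q : odd q -> (q.-1)./2 = q./2.
  by case: q => [//|q] /= oq; rewrite uphalf_half (negbTE oq).
case: (boolP (odd k)) => ok /=.
  rewrite k2// m1 !mul0r rmorph0 add0r mul1r !rmorphM; ring.
by rewrite m1 !mul1r !mul0r rmorph0 mulr0 addr0 !rmorphM; ring.
Qed.

Lemma cmod_iz (y : R) : cmod (iz * y%:C) = `|y|.
Proof. by rewrite cmodM cmodC /cmod /iz /= expr0n expr1n /= add0r sqrtr1 mul1r. Qed.

(** [cexp] is given by Euler's formula. The product of the partial sums for x and i y is a sum over
    a square and converges by the real series; [Fsum] of x + i y is the sum over a triangle, which
    differs by a tail. *)
Lemma cexp_lim z (e : R) : 0 < e -> \forall n \near \oo, cmod (Fsum n z - cexp z) <= e.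
Proof.
move=> e0; pose x := complex.Re z; pose y := complex.Im z.
have zE : z = x%:C + iz * y%:C.
  have gen (u : R[i]) : u = (complex.Re u)%:C + iz * (complex.Im u)%:C.
    by rewrite /iz; case: u => r s /=; simpc.
  exact: gen.
pose a j k := x%:C ^+ j / j`!%:R * ((iz * y%:C) ^+ k / k`!%:R).
have ha j k : cmod (a j k) <= `|x| ^+ j / j`!%:R * (`|y| ^+ k / k`!%:R).
  by rewrite /a !cmodM !cmodV !cmodX !cmod_nat cmodC cmod_iz.
have e4 : 0 < e / 4 by rewrite divr_gt0.
have e2 : 0 < e / 2 by rewrite divr_gt0.
have c1 : Esum n x * cosum n y @[n --> \oo] --> expR x * cos y.
  by apply: cvgM; [exact: cvg_Esum|rewrite unlock; exact: is_cvg_series_cos_coeff].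
have c2 : Esum n x * sisum n y @[n --> \oo] --> expR x * sin y.
  by apply: cvgM; [exact: cvg_Esum|rewrite unlock; exact: is_cvg_series_sin_coeff].
move: c1 c2 => /cvgrPdist_le/(_ _ e4) c1 /cvgrPdist_le/(_ _ e4) c2.
have c3 := exp_tail_cvg `|x| `|y| e2.
have [N [N1 N2 N3]] : exists N, [/\ `|expR x * cos y - Esum N x * cosum N y| <= e / 4,
   `|expR x * sin y - Esum N x * sisum N y| <= e / 4 & exp_tail N `|x| `|y| <= e / 2].
  have [N0 _ h] := filterI c1 (filterI c2 c3); exists N0.
  by have [h1 [h2 h3]] := h N0 (leqnn N0).
exists N.*2 => // M /= NM.
have h1 := triangle_dominated (normr_ge0 _) (normr_ge0 _) ha NM.
have triE : \sum_(p : 'I_M * 'I_M | (p.1 + p.2 < M)%N) a p.1 p.2 = Fsum M z.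
  have := @sum_triangle_exp _ M x%:C (iz * y%:C) (fun=> 1).
  rewrite -zE /Fsum => h; rewrite -[RHS](eq_bigr _ (fun i _ => mul1r _)) -h.
  by apply: eq_bigr => p _; rewrite mulr1.
have sqE : \sum_(j < N) \sum_(k < N) a j k =
    (Esum N x * cosum N y)%:C + iz * (Esum N x * sisum N y)%:C.
  have -> : \sum_(j < N) \sum_(k < N) a j k = Fsum N x%:C * Fsum N (iz * y%:C).
    by rewrite /Fsum big_distrlr.
  by rewrite Fsum_real Fsum_im !rmorphM; ring.
rewrite triE sqE in h1.
have h2 : cmod ((Esum N x * cosum N y)%:C + iz * (Esum N x * sisum N y)%:C - cexp z) <= e / 4 + e / 4.
  have -> : cexp z = (expR x * cos y)%:C + iz * (expR x * sin y)%:C.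
    rewrite /cexp -/x -/y /iz; simpc; congr (_ +i* _); ring.
  set u := Esum _ _ * _; set v := Esum _ _ * _.
  have -> : u%:C + iz * v%:C - ((expR x * cos y)%:C + iz * (expR x * sin y)%:C) =
     (u - expR x * cos y)%:C + iz * (v - expR x * sin y)%:C by rewrite !rmorphB /=; ring.
  apply: le_trans (cmodD _ _) _; rewrite cmodC cmod_iz.
  by apply: lerD; rewrite distrC.
have -> : Fsum M z - cexp z = (Fsum M z - ((Esum N x * cosum N y)%:C + iz * (Esum N x * sisum N y)%:C))
  + ((Esum N x * cosum N y)%:C + iz * (Esum N x * sisum N y)%:C - cexp z) by ring.
apply: le_trans (cmodD _ _) _; apply: le_trans (lerD h1 h2) _; lra.
Qed.

(** A partial sum of sin(u) / u: cjk(0, l) / l! is (-1)^(l/2) / (l+1)! for even l and 0 for odd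
    l. *)
Definition Ssum n (u : R[i]) : R[i] := \sum_(l < n) (cjk 0 l : R)%:C * (u ^+ l / l`!%:R).

Let izz : iz != 0.
Proof. by rewrite /iz eq_complex /= negb_and oner_eq0 orbT. Qed.

Let factz i : (i`!%:R : R[i]) != 0.
Proof. by rewrite pnatr_eq0 -lt0n fact_gt0. Qed.

(* Multiplication by [u] turns [Ssum] into a partial sum of the sine series, which gives pointwise convergence
   to [csinc]; uniformity, including near the removable singularity, comes from [Ssum_tail]. *)
Lemma Ssum_mul n u : u * Ssum n u * (2 * iz) = Fsum n.+1 (iz * u) - Fsum n.+1 (- (iz * u)).
Proof.
rewrite /Fsum !big_ord_recl /= !expr0 opprD addrACA subrr add0r -sumrB.
rewrite /Ssum mulr_sumr mulr_suml; apply: eq_bigr => l _.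
rewrite /bump /= add1n exprNn !exprMn izX /= /cjk !add0n factS natrM.
have lz : (l.+1%:R : R[i]) != 0 by rewrite pnatr_eq0.
case: (boolP (odd l)) => ol /=.
  have -> : (-1) ^+ l.+1 = 1 :> R[i] by rewrite -signr_odd /= ol.
  by rewrite !mul1r rmorph0; ring.
have -> : (-1) ^+ l.+1 = -1 :> R[i] by rewrite -signr_odd /= ol.
rewrite uphalf_half (negbTE ol) add0n.
rewrite rmorphM fmorphV rmorphXn rmorphN1 rmorph_nat exprS.
by move: (l.+1%:R : R[i]) lz (factz l) => L lz fz; field; rewrite lz fz.
Qed.

Lemma Ssum0 n : (0 < n)%N -> Ssum n 0 = 1.
Proof.
case: n => // n _; rewrite /Ssum big_ord_recl /= big1 => [|i _].
  by rewrite /cjk /= fact0 !expr0 !divr1 !mulr1 rmorph1 addr0.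
by rewrite /bump /= expr0n /= mul0r mulr0.
Qed.

Lemma Ssum_lim z (e : R) : 0 < e ->
  \forall n \near \oo, cmod (Ssum n (pi%:C * z) - csinc z) <= e.
Proof.
move=> e0; rewrite /csinc; have [->|z0] := eqVneq z 0.
  exists 1%N => // n /= n0.
  by rewrite mulr0 Ssum0// subrr cmod0 ltW.
set u := pi%:C * z.
have u0 : u != 0 by rewrite mulf_neq0// eq_complex /= negb_and gt_eqF ?pi_gt0.
have cu : 0 < cmod u.
  by rewrite lt_def cmod_ge0 andbT; apply: contra u0 => /eqP/cmod_eq0 ->.
clearbody u; have e1 : 0 < e * cmod u by exact: mulr_gt0.
have [N _ hN] := filterI (cexp_lim (iz * u) e1) (cexp_lim (- (iz * u)) e1).
exists N => // n /= Nn; have [h1 h2] := hN n.+1 (leq_trans Nn (leqnSn n)).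
have -> : Ssum n u - csin u / u =
  ((Fsum n.+1 (iz * u) - cexp (iz * u)) - (Fsum n.+1 (- (iz * u)) - cexp (- (iz * u)))) /
  (2 * iz * u).
  have -> : Ssum n u = (Fsum n.+1 (iz * u) - Fsum n.+1 (- (iz * u))) / (2 * iz * u).
    rewrite -Ssum_mul; field; rewrite u0 izz; exact/andP.
  rewrite /csin -/iz; field; rewrite u0 izz; exact/andP.
rewrite cmodM cmodV !cmodM cmod_nat.
have -> : cmod iz = 1 by rewrite /cmod /iz /= expr0n expr1n /= add0r sqrtr1.
rewrite mulr1 ler_pdivrMr ?mulr_gt0//.
apply: le_trans (cmodB _ _) _; apply: le_trans (lerD h1 h2) _.
by move: (cmod u) => y; lra.
Qed.

Lemma Ssum_tail n m u (r : R) : (n <= m)%N -> cmod u <= r ->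
  cmod (Ssum m u - Ssum n u) <= expR r - Esum n r.
Proof.
move=> nm ur; have r0 : 0 <= r by exact: le_trans (cmod_ge0 u) ur.
rewrite /Ssum (big_ord_widen m (fun l => (cjk 0 l)%:C * (u ^+ l / l`!%:R)) nm).
have ha (l : 'I_m) : cmod ((cjk 0 l : R)%:C * (u ^+ l / l`!%:R)) <= r ^+ l / l`!%:R.
  rewrite !cmodM cmodC cmodV cmodX cmod_nat -[leRHS]mul1r.
  apply: ler_pM => //; [by rewrite mulr_ge0 ?invr_ge0 ?exprn_ge0 ?cmod_ge0|exact: cjk_le1|].
  rewrite ler_wpM2r ?invr_ge0//; apply: lerXn2r => //; rewrite nnegrE//; exact: cmod_ge0.
have QP (l : 'I_m) : (l < n)%N -> xpredT l by [].
apply: le_trans (sub_sum_cmod QP ha) _; rewrite -/(Esum m r).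
by rewrite -(big_ord_widen m (fun l => r ^+ l / l`!%:R) nm) lerD2r Esum_expR.
Qed.

Lemma csinc_approx n z (r : R) : cmod (pi%:C * z) <= r ->
  cmod (Ssum n (pi%:C * z) - csinc z) <= expR r - Esum n r.
Proof.
move=> zr; apply/ler_addgt0Pr => e e0.
have [N _ hN] := Ssum_lim z e0.
pose m := maxn N n; have h1 := hN m (leq_maxl N n).
have h2 := Ssum_tail (leq_maxr N n) zr.
have -> : Ssum n (pi%:C * z) - csinc z =
  - (Ssum m (pi%:C * z) - Ssum n (pi%:C * z)) + (Ssum m (pi%:C * z) - csinc z) by ring.
by apply: le_trans (cmodD _ _) _; rewrite cmodN lerD.
Qed.

(** For j + k even, (-1)^j = (-1)^k: the sign is the one that (-v)^k carries in the expansion of (u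
    - v)^(j+k). *)
Lemma cjk_sign j k : cjk j k = (-1) ^+ k * cjk 0 (j + k) :> R.
Proof.
rewrite /cjk !add0n; case: ifP => [_|]; first by rewrite mulr0.
move=> h; have jk : odd j = odd k by move: h; rewrite oddD; case: (odd j); case: (odd k).
by rewrite exprD -(signr_odd _ j) jk signr_odd mulrA.
Qed.

(** Over a triangle j + k < M the double sum is exactly [Ssum] at u - v, hence close to the sine
    kernel; the square is within [exp_tail] of every large triangle. Letting M grow removes the
    remaining error. *)
Lemma csinc_square N (r : R) (a b : R[i]) : cmod (pi%:C * a) <= r -> cmod (pi%:C * b) <= r ->
  cmod (\sum_(j < N) \sum_(k < N) (pi%:C * a) ^+ j / j`!%:R * ((pi%:C * b) ^+ k / k`!%:R) *
          (cjk j k)%:C - csinc (a - b)) <= exp_tail N r r.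
Proof.
move=> ar br; set u := pi%:C * a; set v := pi%:C * b.
have r0 : 0 <= r by exact: le_trans (cmod_ge0 _) ar.
have r20 : 0 <= r + r by rewrite addr_ge0.
pose F j k := u ^+ j / j`!%:R * (v ^+ k / k`!%:R) * (cjk j k)%:C.
have hF j k : cmod (F j k) <= r ^+ j / j`!%:R * (r ^+ k / k`!%:R).
  rewrite /F [leRHS](_ : _ = r ^+ j / j`!%:R * (r ^+ k / k`!%:R) * 1); last by rewrite mulr1.
  rewrite !cmodM !cmodV !cmodX !cmod_nat cmodC; apply: ler_pM => //; last exact: cjk_le1.
    by rewrite !mulr_ge0 ?invr_ge0 ?exprn_ge0 ?cmod_ge0.
  have h (z : R[i]) i : cmod z <= r -> 0 <= cmod z ^+ i / i`!%:R <= r ^+ i / i`!%:R.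
    move=> zr; rewrite divr_ge0 ?exprn_ge0 ?cmod_ge0//= ler_wpM2r ?invr_ge0//.
    by apply: lerXn2r => //; rewrite nnegrE//; exact: cmod_ge0.
  have /andP[? ?] := h u j ar; have /andP[? ?] := h v k br.
  exact: ler_pM.
apply/ler_addgt0Pr => e e0.
have := cvg_Esum (x := r + r); move=> /cvgrPdist_le/(_ e e0)[M0 _ hM0].
pose M := maxn M0 N.*2.
have := hM0 M (leq_maxl _ _); rewrite ler_norml => /andP[_ h0].
have h1 := triangle_dominated r0 r0 hF (leq_maxr M0 N.*2).
have := @sum_triangle_exp _ M u (- v) (fun l => (cjk 0 l : R)%:C).
rewrite -/(Ssum M _) => triE.
have uv : cmod (pi%:C * (a - b)) <= r + r.
  by rewrite mulrBr; apply: le_trans (cmodB _ _) _; exact: lerD.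
have h2 := csinc_approx M uv; rewrite mulrBr -/u -/v -triE in h2.
have triF : \sum_(p : 'I_M * 'I_M | (p.1 + p.2 < M)%N)
     u ^+ p.1 / p.1`!%:R * ((- v) ^+ p.2 / p.2`!%:R) * (cjk 0 (p.1 + p.2) : R)%:C =
   \sum_(p : 'I_M * 'I_M | (p.1 + p.2 < M)%N) F p.1 p.2.
  apply: eq_bigr => p _; rewrite /F exprNn.
  have -> : (cjk p.1 p.2 : R)%:C = (-1) ^+ p.2 * (cjk 0 (p.1 + p.2) : R)%:C.
    by rewrite (cjk_sign p.1) rmorphM rmorphXn rmorphN1.
  by ring.
rewrite triF in h2.
rewrite (_ : _ - _ = - (\sum_(p : 'I_M * 'I_M | (p.1 + p.2 < M)%N) F p.1 p.2 -
    \sum_(j < N) \sum_(k < N) F j k) +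
   (\sum_(p : 'I_M * 'I_M | (p.1 + p.2 < M)%N) F p.1 p.2 - csinc (a - b))); last by rewrite /F; ring.
apply: le_trans (cmodD _ _) _; rewrite cmodN; apply: lerD; first exact: h1.
exact: le_trans h2 h0.
Qed.

End ExponentialSums.

(** * Taylor expansion of the kernel at complex shifts *)

Section KernelExpansion.
Context {R : realType}.

Lemma map_poly_taylor n (q : {poly R}) (x : R) (h : R[i]) : (size q <= n)%N ->
  (map_poly (real_complex R) q).[x%:C + h] =
  \sum_(j < n) (q^`(j).[x])%:C * (h ^+ j / j`!%:R).
Proof.
move=> sq; rewrite (@nderiv_taylor_wide _ n); [|exact: mulrC|by rewrite size_map_poly].
apply: eq_bigr => j _; rewrite nderivn_map horner_map nderivn_def hornerMn.
have fz : (j`!%:R : R[i]) != 0 by rewrite pnatr_eq0 -lt0n fact_gt0.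
by rewrite -mulr_natr rmorphM rmorph_nat; field.
Qed.

Lemma rkernel_taylor (p : nat -> {poly R}) n (x : R) (h h' : R[i]) : (forall i, size (p i) = i.+1) ->
  rkernel p n (x%:C + h) (x%:C + h') =
  \sum_(j < n) \sum_(k < n) ((kap p n j k).[x])%:C * (h ^+ j / j`!%:R * (h' ^+ k / k`!%:R)).
Proof.
move=> sp; rewrite /rkernel.
transitivity (\sum_(i < n) \sum_(j < n) \sum_(k < n)
   ((p i)^`(j).[x] * (p i)^`(k).[x])%:C * (h ^+ j / j`!%:R * (h' ^+ k / k`!%:R))).
  apply: eq_bigr => i _; rewrite !(@map_poly_taylor n) ?sp// big_distrlr /=.
  by apply: eq_bigr => j _; apply: eq_bigr => k _; rewrite rmorphM; ring.
rewrite exchange_big /=; apply: eq_bigr => j _; rewrite exchange_big /=; apply: eq_bigr => k _.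
by rewrite kapE rmorph_sum mulr_suml.
Qed.

(** Three errors add up: the Taylor terms of the kernel outside the N-square, the replacement of the
    remaining coefficients by their limits, and the tail of the sine kernel. *)
Lemma kernel_gap (p : nat -> {poly R}) n N (x g A C r : R) (a b : R[i]) :
  (forall i, size (p i) = i.+1) -> (0 < n)%N -> (N <= n)%N -> 0 < A -> 0 < C -> 0 <= g ->
  (forall j k, `|(kap p n j k).[x]| <= A * C ^+ (j + k) * n%:R ^+ (j + k).+1) ->
  cmod (pi%:C * a) <= r -> cmod (pi%:C * b) <= r -> 0 < Num.sqrt (1 - x ^+ 2) <= 1 ->
  cmod ((n%:R)^-1 * rkernel p n
          (x%:C + pi%:C * a * (Num.sqrt (1 - x ^+ 2))%:C / n%:R)
          (x%:C + pi%:C * b * (Num.sqrt (1 - x ^+ 2))%:C / n%:R)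
        - g%:C * csinc (a - b)) <=
  \sum_(j < N) \sum_(k < N) r ^+ j / j`!%:R * (r ^+ k / k`!%:R) *
     `|(kap p n j k).[x] / n%:R ^+ (j + k).+1 -
       cjk j k * (g / Num.sqrt (1 - x ^+ 2) ^+ (j + k))| +
  (A * exp_tail N (C * r) (C * r) + g * exp_tail N r r).
Proof.
move=> sp n0 Nn A0 C0 g0 hK ar br.
set s := Num.sqrt _ => /andP[s0 s1].
have nz : (n%:R : R[i]) != 0 by rewrite pnatr_eq0 -lt0n.
have nR : 0 < n%:R :> R by rewrite ltr0n.
have r0 : 0 <= r by exact: le_trans (cmod_ge0 _) ar.
set u := pi%:C * a; set v := pi%:C * b.
pose co j k := u ^+ j / j`!%:R * (v ^+ k / k`!%:R).
pose kk j k : R := (kap p n j k).[x] / n%:R ^+ (j + k).+1.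
(* The shifts contribute s^(j+k), which cancels the power of s in the limit of [kk] and leaves g
   cjk(j, k). *)
pose t j k := co j k * (s ^+ (j + k) * kk j k)%:C.
have co_le j k : cmod (co j k) <= r ^+ j / j`!%:R * (r ^+ k / k`!%:R).
  rewrite !cmodM !cmodV !cmodX !cmod_nat.
  have h (z : R[i]) i : cmod z <= r -> 0 <= cmod z ^+ i / i`!%:R <= r ^+ i / i`!%:R.
    move=> zr; rewrite divr_ge0 ?exprn_ge0 ?cmod_ge0//= ler_wpM2r ?invr_ge0//.
    by apply: lerXn2r => //; rewrite nnegrE//; exact: cmod_ge0.
  have /andP[? ?] := h u j ar; have /andP[? ?] := h v k br.
  exact: ler_pM.
have sX i : 0 <= s ^+ i <= 1 by rewrite exprn_ge0 ?exprn_ile1// ltW.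
have rkE : (n%:R)^-1 * rkernel p n (x%:C + u * s%:C / n%:R) (x%:C + v * s%:C / n%:R) =
   \sum_(j < n) \sum_(k < n) t j k.
  rewrite rkernel_taylor// mulr_sumr; apply: eq_bigr => j _.
  rewrite mulr_sumr; apply: eq_bigr => k _.
  rewrite /t /co /kk !exprMn !exprVn !rmorphM fmorphV !rmorphXn rmorph_nat exprD exprS exprD.
  have fz i : (i`!%:R : R[i]) != 0 by rewrite pnatr_eq0 -lt0n fact_gt0.
  have nj : (n%:R ^+ j : R[i]) != 0 by rewrite expf_neq0.
  have nk : (n%:R ^+ k : R[i]) != 0 by rewrite expf_neq0.
  by field; rewrite !fz nz nj nk.
have h1 : cmod (\sum_(j < n) \sum_(k < n) t j k - \sum_(j < N) \sum_(k < N) t j k) <=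
    A * exp_tail N (C * r) (C * r).
  have Cr0 : 0 <= C * r by rewrite mulr_ge0// ltW.
  (* Division by A puts the terms below those of exp(C r)^2, the form that [square_dominated]
     requires. *)
  have ht j k : cmod ((A^-1)%:C * t j k) <= (C * r) ^+ j / j`!%:R * ((C * r) ^+ k / k`!%:R).
    have kb : `|s ^+ (j + k) * kk j k| <= A * C ^+ (j + k).
      have /andP[sj0 sj1] := sX (j + k)%N.
      rewrite normrM (ger0_norm sj0) -[leRHS]mul1r; apply: ler_pM => //.
      rewrite /kk normrM normfV (ger0_norm (exprn_ge0 _ (ltW nR))).
      by rewrite ler_pdivrMr ?exprn_gt0.
    have Ai : 0 < A^-1 by rewrite invr_gt0.
    rewrite cmodM cmodC (ger0_norm (ltW Ai)) /t [cmod (co j k * _)]cmodM cmodC.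
    apply: (@le_trans _ _ (A^-1 *
        (r ^+ j / j`!%:R * (r ^+ k / k`!%:R) * (A * C ^+ (j + k))))).
      apply: ler_wpM2l; first exact: ltW.
      by apply: ler_pM => //; exact: cmod_ge0.
    rewrite !exprMn exprD le_eqVlt; apply/orP; left; apply/eqP.
    have Az : A != 0 by rewrite gt_eqF.
    have fz i : (i`!%:R : R) != 0 by rewrite pnatr_eq0 -lt0n fact_gt0.
    by field; rewrite !fz Az.
  have := square_dominated Cr0 Cr0 ht Nn.
  have mS M : \sum_(j < M) \sum_(k < M) (A^-1)%:C * t j k = (A^-1)%:C * \sum_(j < M) \sum_(k < M) t j k.
    by rewrite mulr_sumr; apply: eq_bigr => j _; rewrite mulr_sumr.
  by rewrite !mS -mulrBr cmodM cmodC ger0_norm ?invr_ge0 ?(ltW A0)// ler_pdivrMl.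
have h2 : cmod (\sum_(j < N) \sum_(k < N) t j k -
    g%:C * \sum_(j < N) \sum_(k < N) co j k * (cjk j k)%:C) <=
  \sum_(j < N) \sum_(k < N) r ^+ j / j`!%:R * (r ^+ k / k`!%:R) *
     `|kk j k - cjk j k * (g / s ^+ (j + k))|.
  rewrite mulr_sumr -sumrB; apply: le_trans (cmod_sum _ _ _) _; apply: ler_sum => j _.
  rewrite mulr_sumr -sumrB; apply: le_trans (cmod_sum _ _ _) _; apply: ler_sum => k _.
  have /andP[sj0 sj1] := sX (j + k)%N.
  have sz : s ^+ (j + k) != 0 by rewrite expf_neq0// gt_eqF.
  have -> : t j k - g%:C * (co j k * (cjk j k)%:C) =
      co j k * (s ^+ (j + k) * (kk j k - cjk j k * (g / s ^+ (j + k))))%:C.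
    have -> : s ^+ (j + k) * (kk j k - cjk j k * (g / s ^+ (j + k))) =
       s ^+ (j + k) * kk j k - g * cjk j k by field.
    by rewrite /t rmorphB !rmorphM; ring.
  rewrite cmodM cmodC normrM (ger0_norm sj0); apply: ler_pM; rewrite ?cmod_ge0//.
    by rewrite mulr_ge0.
  by rewrite ler_piMl.
have h3 := csinc_square N ar br; rewrite -/u -/v in h3.
rewrite rkE.
rewrite (_ : _ - _ = (\sum_(j < n) \sum_(k < n) t j k - \sum_(j < N) \sum_(k < N) t j k) +
  ((\sum_(j < N) \sum_(k < N) t j k - g%:C * \sum_(j < N) \sum_(k < N) co j k * (cjk j k)%:C) +
   g%:C * (\sum_(j < N) \sum_(k < N) co j k * (cjk j k)%:C - csinc (a - b)))); last by ring.
apply: le_trans (cmodD _ _) _; rewrite addrCA; apply: lerD; first exact: h1.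
apply: le_trans (cmodD _ _) _; apply: lerD; first exact: h2.
by rewrite cmodM cmodC ger0_norm// ler_wpM2l.
Qed.

End KernelExpansion.

(** * Universality *)

Section KernelLimit.
Context {R : realType} (l : (R -> R) -> R) (hl : posfun l).
Context (p : nat -> {poly R}) (hp : onpolys l p).
Context (lp : forall n, 0 < lead_coef (p n)).
Context (hreg : forall d : R, 0 < d ->
  \forall n \near \oo, lead_coef (p n) <= (2 + d) ^+ n).
Context (c d : R) (c_1 : -1 < c) (cd : c < d) (d_1 : d < 1).
Context (m : R) (m0 : 0 < m) (w1 : R -> R) (mw : measurable_fun setT w1).
Context (wm : forall x, m <= w1 x) (iw : intg c d w1).
Context (hI : forall f : R -> R, continuous f -> (forall x, 0 <= f x) ->
  sint c d (fun x => w1 x * f x) <= l f).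
Notation Lam := (@Lam R).
Context (M0 : R) (M00 : 0 <= M0).
Context (happ : forall e c1 d1 : R, 0 < e -> c < c1 -> c1 <= d1 -> d1 < d ->
  exists (psi wt : R -> R) (ls : (R -> R) -> R),
  [/\ continuous psi, forall x, 0 <= psi x <= 1,
     forall x, ~~ (c <= x <= d) -> psi x = 0,
     sint c1 d1 (fun x => 1 - psi x) <= e &
  [/\ continuous wt, forall x, 0 <= wt x & sint c d (fun x => `|wt x - w1 x|) <= e] /\
  [/\ posfun ls, ls psi <= e, ls (fun=> 1) <= M0 &
   forall f : R -> R, continuous f -> (forall x, 0 <= f x) ->
     l f <= Lam (fun x => pi * arcw x * wt x * f x) + ls f]]).

Lemma exp_tail_ge0 n (x y : R) : 0 <= x -> 0 <= y -> 0 <= exp_tail n x y.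
Proof.
by move=> x0 y0; rewrite subr_ge0; apply: ler_pM; rewrite ?Esum_ge0// Esum_expR.
Qed.

(** H does not depend on a and b, which is the uniformity. It is integrable by construction, so
    measurability of the majorized function never comes up. *)
Lemma kernel_L1_limit (c' d' r eps : R) : c < c' -> c' <= d' -> d' < d -> 0 <= r -> 0 < eps ->
  \forall n \near \oo, exists2 H : R -> R, intg c' d' H /\ sint c' d' H <= eps &
  forall x (a b : R[i]), c' <= x <= d' -> cmod (pi%:C * a) <= r -> cmod (pi%:C * b) <= r ->
  cmod ((n%:R)^-1 * rkernel p n
          (x%:C + pi%:C * a * (Num.sqrt (1 - x ^+ 2))%:C / n%:R)
          (x%:C + pi%:C * b * (Num.sqrt (1 - x ^+ 2))%:C / n%:R)
        - (gfun w1 x)%:C * csinc (a - b)) <= H x.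
Proof.
move=> cc' cd' dd' r0 eps0.
have L0 : 0 <= d' - c' by rewrite subr_ge0.
have [A [C [A0 C0 hK]]] := kap_bound hl hp m0 wm iw hI cc' cd' dd'.
have [g0 g00 hg] := gfun_bound c_1 cd d_1 m0 wm.
have [s0 [s00 s01 hs]] := arc_lower c_1 cd d_1.
pose t := eps / (2 * ((A + g0) * (1 + (d' - c')))).
have L1 : 0 < 1 + (d' - c') by lra.
have t0 : 0 < t by rewrite divr_gt0// !mulr_gt0// addr_gt0.
have Cr0 : 0 <= C * r by rewrite mulr_ge0// ltW.
(* N is fixed before n, so that only finitely many of the limits [kappa_lim] have to hold at
   once. *)
have [N [N1 N2]] : exists N, exp_tail N (C * r) (C * r) <= t /\ exp_tail N r r <= t.
  have [N _ h] := filterI (exp_tail_cvg (C * r) (C * r) t0) (exp_tail_cvg r r t0).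
  by exists N; exact: (h N (leqnn N)).
pose T := A * exp_tail N (C * r) (C * r) + g0 * exp_tail N r r.
have TL : T * (d' - c') <= eps / 2.
  have hT : T <= (A + g0) * t.
    by rewrite mulrDl; apply: lerD; rewrite ler_wpM2l// ltW.
  apply: (@le_trans _ _ ((A + g0) * t * (1 + (d' - c')))).
    by apply: ler_pM => //; [|by rewrite lerDr]; rewrite addr_ge0// mulr_ge0 ?exp_tail_ge0// ltW.
  have Ag : A + g0 != 0 by rewrite gt_eqF// addr_gt0.
  rewrite le_eqVlt; apply/orP; left; apply/eqP; rewrite /t.
  by move: (1 + (d' - c')) L1 => y y0; field; rewrite Ag gt_eqF.
pose co (q : 'I_N * 'I_N) : R := r ^+ q.1 / q.1`!%:R * (r ^+ q.2 / q.2`!%:R).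
have co0 q : 0 <= co q by rewrite mulr_ge0// divr_ge0// exprn_ge0.
pose S := \sum_q co q; have S0 : 0 <= S by exact: sumr_ge0.
pose del := eps / (2 * (1 + S)).
have S1 : 0 < 1 + S by rewrite (lt_le_trans ltr01)// lerDl.
have del0 : 0 < del by rewrite divr_gt0// mulr_gt0.
pose K n (q : 'I_N * 'I_N) x := `|(kap p n q.1 q.2).[x] / n%:R ^+ (q.1 + q.2).+1 -
   kst w1 q.1 q.2 x|.
have hq0 : \forall n \near \oo, forall q, sint c' d' (K n q) <= del.
  apply: filter_forall => q.
  exact: (kappa_lim hl hp lp hreg c_1 cd d_1 m0 mw wm iw hI M00 happ).
near=> n.
have n0 : (0 < n)%N by near: n; exact: nbhs_infty_gt.
have Nn : (N <= n)%N by near: n; exact: nbhs_infty_ge.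
have hq : forall q, sint c' d' (K n q) <= del by near: n; exact: hq0.
have iK q : intg c' d' (fun x => co q * K n q x).
  apply: intgZ; apply: intg_norm; apply: intgB.
    by apply: intg_cont; apply: contM; [exact: cont_poly|exact: cont_cst].
  by apply: (intgS (ltW cc') (ltW dd')); exact: (intg_kst c_1 cd d_1 m0 mw wm).
have iT : intg c' d' (fun=> T) by exact: intg_cont (cont_cst _).
have iS : intg c' d' (fun x => \sum_q co q * K n q x) by exact: intg_sum.
exists (fun x => \sum_q co q * K n q x + T).
  split; first exact: intgD.
  rewrite sintD// sint_cst// sint_sum//.
  have : \sum_q sint c' d' (fun x => co q * K n q x) <= eps / 2; last by move: TL; lra.
  apply: (@le_trans _ _ (\sum_q co q * del)).
    apply: ler_sum => q _; rewrite sintZ ?ler_wpM2l//.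
    apply: intg_norm; apply: intgB.
      by apply: intg_cont; apply: contM; [exact: cont_poly|exact: cont_cst].
    by apply: (intgS (ltW cc') (ltW dd')); exact: (intg_kst c_1 cd d_1 m0 mw wm).
  rewrite -mulr_suml -/S.
  apply: (@le_trans _ _ ((1 + S) * del)); first by rewrite ler_wpM2r ?(ltW del0)// lerDr.
  rewrite le_eqVlt; apply/orP; left; apply/eqP; rewrite /del.
  by move: (1 + S) S1 => y y0; field; rewrite gt_eqF.
move=> x a b xcd ar br.
have xin : c <= x <= d.
  by have /andP[h1 h2] := xcd; rewrite (le_trans (ltW cc') h1) (le_trans h2 (ltW dd')).
have [gp gl _] := hg x xin; have [_ ax] := hs x xin.
have sx : 0 < Num.sqrt (1 - x ^+ 2) <= 1.
  by rewrite (lt_le_trans s00 ax) arcw_le1.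
apply: le_trans (kernel_gap hp.1 n0 Nn A0 C0 (ltW gp) _ ar br sx) _.
  by move=> j k; exact: hK.
apply: lerD; first by rewrite pair_bigA.
by rewrite lerD2l ler_wpM2r// exp_tail_ge0.
Unshelve. all: by end_near.
Qed.

End KernelLimit.

Section Bridges.
Context {R : realType}.

Lemma cont_cmod : continuous (cmod : R[i]^o -> R^o).
Proof.
move=> z U [e /= e0 hU].
have ez : 0 < e%:C :> R[i] by rewrite ltcR.
have h (u v : R[i]) : cmod u - cmod v <= cmod (u - v).
  by rewrite lerBlDr; apply: le_trans (cmodD _ _); rewrite subrK.
exists e%:C => // y /= zy; apply: hU; rewrite /ball_ /=.
have ne (u : R[i]) : `|u| = (cmod u)%:C by rewrite normc_def; case: u.
have zy' : cmod (z - y) < e by move: zy; rewrite ne ltcR.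
apply: le_lt_trans zy'; rewrite ler_norml lerNl opprB h andbT.
by apply: le_trans (h _ _) _; rewrite -opprB cmodN.
Qed.

Lemma compact_cmod (K : set R[i]^o) : compact K ->
  exists2 r : R, 0 <= r & forall a, K a -> cmod a <= r.
Proof.
move=> cK; have cI : compact (cmod @` K : set R^o).
  by apply: continuous_compact => //; apply: continuous_subspaceT; exact: cont_cmod.
have [M [_ hM]] := compact_bounded cI; exists (Num.max 0 (M + 1)).
  by rewrite le_max lexx.
move=> a Ka; rewrite le_max; apply/orP; right.
have M1 : M < M + 1 by rewrite ltrDl.
by have := hM _ M1 (cmod a) (ex_intro2 _ _ a Ka erefl); exact: le_trans (ler_norm _).
Qed.

Lemma regular_lead_coef (p : nat -> {poly R}) : (forall n, 0 < lead_coef (p n)) ->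
  regular_polys p -> forall d : R, 0 < d ->
  \forall n \near \oo, lead_coef (p n) <= (2 + d) ^+ n.
Proof.
move=> lp /cvgrPdist_le h d d0; near=> n.
have n0 : (0 < n)%N by near: n; exact: nbhs_infty_gt.
have nz : n%:R != 0 :> R by rewrite pnatr_eq0 -lt0n.
have : `|2 - lead_coef (p n) `^ (n%:R^-1)| <= d by near: n; exact: h.
rewrite ler_norml => /andP[h1 _].
have h2 : lead_coef (p n) `^ (n%:R^-1) <= 2 + d by lra.
have -> : lead_coef (p n) = (lead_coef (p n) `^ (n%:R^-1)) ^+ n.
  by rewrite -powR_mulrn ?powR_ge0// -powRrM mulVf// powRr1// ltW.
by apply: lerXn2r => //; rewrite nnegrE ?powR_ge0// addr_ge0// ltW.
Unshelve. all: by end_near.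
Qed.

End Bridges.

Import HBNNSimple.

(* [f] need not be measurable, unlike in [ae_ge0_le_integral]. *)
Lemma ae_le_integral (d : measure_display) (T : measurableType d) (R : realType)
    (mu : {measure set T -> \bar R}) (D : set T) (f h : T -> \bar R) :
  measurable D -> (forall x, D x -> (0 <= f x)%E) -> (forall x, D x -> (0 <= h x)%E) ->
  measurable_fun D h -> {ae mu, forall x, D x -> (f x <= h x)%E} ->
  (\int[mu]_(x in D) f x <= \int[mu]_(x in D) h x)%E.
Proof.
move=> mD f0 h0 mh fh; rewrite ge0_integralE//; apply: ge_ereal_sup => _ [k /= kf <-].
rewrite [leRHS]integral_mkcond.
have <- : (\int[mu]_x (k x)%:E = sintegral mu k)%E by rewrite integral_nnsfun// patch_setT.
apply: ae_ge0_le_integral => //.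
- by move=> x _; rewrite lee_fin.
- exact/measurable_EFinP.
- by move=> x _; rewrite /patch; case: ifPn => // /set_mem; exact: h0.
- exact/(measurable_restrictT h mD).
apply: filterS fh => x fhx _; apply: le_trans (kf x) _.
by rewrite /patch; case: ifPn => // /set_mem; exact: fhx.
Qed.

Unset Implicit Arguments.

Theorem theorem1p6 (R : realType)
    (mu : {finite_measure set (measurableTypeR R) -> \bar R})
    (mu_conc : mu (~` `]-1, 1[) = 0%E)
    (mu_inf : infinite_set (msupport mu))
    (p : nat -> {poly R}) (p_on : orthonormal_polys mu p)
    (mu_reg : regular_polys p)
    (w : measurableTypeR R -> R) (w_dens : ac_density mu w)
    (c d : R) (le_cd : c <= d) (I_sub : `[c, d] `<=` (`]-1, 1[ : set R))
    (w_lb : exists2 m : R, 0 < m &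
       {ae lebesgue_measure, forall x : measurableTypeR R,
          x \in `[c, d] -> m <= w x})
    (c' d' : R) (le_cd' : c' <= d')
    (I'_sub : (`[c', d'] : set R) `<=` interior (`[c, d] : set R))
    (K : set R[i]^o) (K_compact : compact K) :
  forall eps : R, 0 < eps ->
    \forall n \near \oo, forall a b : R[i], K a -> K b ->
      (\int[lebesgue_measure]_(x in `[c', d'])
         (cmod ((n%:R)^-1 *
                  rkernel p n
                    (x%:C + pi%:C * a * (Num.sqrt (1 - x ^+ 2))%:C / n%:R)
                    (x%:C + pi%:C * b * (Num.sqrt (1 - x ^+ 2))%:C / n%:R)
                - ((pi * w x * Num.sqrt (1 - x ^+ 2))^-1)%:C
                  * csinc (a - b))%R)%:E
       < eps%:E)%E.
Proof.
move=> eps eps0; have [sp lp op] := p_on; have [m m0 wm] := w_lb.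
have [mw w0 [nu [[N [mN nuN lebN]] munu]]] := w_dens.
have [c_1 _] : -1 < c /\ c < 1.
  by have := I_sub c; rewrite /= !in_itv /= lexx le_cd => /(_ isT)/andP[].
have [_ d_1] : -1 < d /\ d < 1.
  by have := I_sub d; rewrite /= !in_itv /= lexx le_cd => /(_ isT)/andP[].
(* The inclusion of I' in the interior of I yields the strict margins c < c' and d' < d, and with
   them c < d. *)
have inner (x : R) : c' <= x <= d' -> c < x < d.
  move=> xcd; have : interior (`[c, d] : set R) x by apply: I'_sub; rewrite /= in_itv.
  case=> e /= e0 he; have e2 : 0 < e / 2 by rewrite divr_gt0.
  have ball_in (y : R) : `|x - y| < e -> c <= y <= d.
    by move=> xy; have := he y xy; rewrite /= in_itv.
  have /andP[h1 _] : c <= x - e / 2 <= d.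
    by apply: ball_in; rewrite opprB addrC subrK ger0_norm; lra.
  have /andP[_ h2] : c <= x + e / 2 <= d.
    by apply: ball_in; rewrite opprD addrA subrr add0r normrN ger0_norm; lra.
  by apply/andP; split; lra.
have /andP[cc' _] : c < c' < d by apply: inner; rewrite lexx.
have /andP[_ dd'] : c < d' < d by apply: inner; rewrite lexx le_cd'.
have cd : c < d by lra.
have [r r0 hr] := compact_cmod K_compact.
have hl := posfun_lmu mu.
have hp : onpolys (lmu mu) p.
  split=> // i j; rewrite /pint /lmu /Rintegral.
  under eq_integral do rewrite hornerM.
  by rewrite op.
have hreg := regular_lead_coef lp mu_reg.
have [M0 M00 happ] := approximants mw w0 munu mN nuN lebN c_1 d_1 wm.
have p0 := @pi_gt0 R.
have pr0 : 0 <= pi * r by rewrite mulr_ge0// ltW.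
have e2 : 0 < eps / 2 by rewrite divr_gt0.
have hI := sint_wfloor_le mw w0 munu c_1 d_1 wm.
have := kernel_L1_limit hl hp lp hreg c_1 cd d_1 m0 (measurable_wfloor mw m)
  (wfloor_ge w m) (intg_wfloor mw w0 munu c d m) hI M00 happ cc' le_cd' dd' pr0 e2.
apply: filterS => n [H [iH sH] hH] a b Ka Kb.
have bnd z : K z -> cmod (pi%:C * z) <= pi * r.
  by move=> /hr zr; rewrite cmodM cmodC ger0_norm ?(ltW p0)// ler_wpM2l ?(ltW p0).
have H0 x : c' <= x <= d' -> 0 <= H x.
  by move=> xcd; apply: le_trans (hH x a b xcd (bnd a Ka) (bnd b Kb)); exact: cmod_ge0.
apply: (@le_lt_trans _ _ (\int[lebesgue_measure]_(x in `[c', d']) (H x)%:E)%E); last first.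
  apply: (@le_lt_trans _ _ (eps / 2)%:E); last by rewrite lte_fin; lra.
  by rewrite -[leLHS]fineK ?lee_fin//; exact: integrable_fin_num iH.
(* The bound by H is stated for [wfloor], which agrees with w almost everywhere on I because w >= m
   there. *)
apply: ae_le_integral => //.
- by move=> x _; rewrite lee_fin cmod_ge0.
- exact: measurable_int iH.
apply: filterS wm => x wx /=; rewrite in_itv /= => xcd; rewrite lee_fin.
have xin : x \in `[c, d].
  by rewrite in_itv /=; have /andP[h1 h2] := inner x xcd; rewrite !ltW.
have := hH x a b xcd (bnd a Ka) (bnd b Kb).
by rewrite /gfun /wfloor max_l ?wx// /arcw [pi * w x * _]mulrAC.
Qed.
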